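(* Let $c$ be a radial cost, and let $\mu,\nu\in\mathcal M_+(\Omega)$ satisfy $\mu\ll\mathcal L$ and $\nu=\sum_{i=1}^M m_i\delta_{x_i}$ with $m_i>0$, $x_i\in\Omega$ and $x_i\neq x_j$ for $i\neq j$. Let $\gamma\in\mathcal M_+(\Omega\times\Omega)$, $w\in\mathbb R^M$, and set $\rho=\pi_{1\#}\gamma$. Consider the conditions (a) $\gamma=\sum_{i=1}^M\rho\llcorner C_i(w)\otimes\delta_{x_i}$; (b) $\rho\ll\mu$, $\ \tfrac{\mathrm d\rho}{\mathrm d\mu}(x)\in\partial F^*(-c(x,x_i)+w_i)$ for $\mu$-a.e. $x\in C_i(w)$ (for each $i\in\{1,\dots,M\}$), and $\tfrac{\mathrm d\rho}{\mathrm d\mu}(x)=0$ for ($\mu$-a.e.) $x\in R$; (c) $\tfrac{\rho(C_i(w))}{m_i}\in\partial F^*(-w_i)$ for $i\in\{1,\dots,M\}$. If $W(\mu,\nu)<\infty$ and $\gamma$ and $w$ are optimal for $W(\mu,\nu)$, i.e. $\gamma$ minimizes $\mathcal E$ over $\mathcal M_+(\Omega\times\Omega)$ and $w$ maximizes $\mathcal G$ over $\mathbb R^M$, then (a), (b) and (c) hold. Conversely, if $\gamma$ and $w$ satisfy (a), (b) and (c), then $\gamma$ minimizes $\mathcal E$ and $w$ maximizes $\mathcal G$.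
   Context: $\Omega=\overline U\subset\mathbb R^d$ with $U$ open; $d(\cdot,\cdot)$ is the Euclidean distance; $\mathcal L$ is the $d$-dimensional Lebesgue measure; $\mathcal M_+(X)$ is the set of finite nonnegative Radon measures on $X$; $\pi_1,\pi_2:\Omega\times\Omega\to\Omega$ are the coordinate projections, $T_\#\mu$ denotes pushforward and $\rho\llcorner A$ the restriction of $\rho$ to $A$; $\partial$ denotes the convex subdifferential. Marginal discrepancy: $F:[0,\infty)\to[0,\infty]$ is proper, convex, lower semi-continuous with $\lim_{s\to\infty}F(s)/s=\infty$. For $\rho,\mu\in\mathcal M_+(\Omega)$ set $\mathcal F(\rho|\mu)=\int_\Omega F\big(\tfrac{\mathrm d\rho}{\mathrm d\mu}\big)\,\mathrm d\mu$ if $\rho\ll\mu$ and $\mathcal F(\rho|\mu)=+\infty$ otherwise. $F$ is extended by $F(s)=\infty$ for $s<0$, and $F^*(z)=\sup_{s\ge0}(z s-F(s))$, $z\in\mathbb R$. Cost: $c:\Omega\times\Omega\to[0,\infty]$ is lower semi-continuous. It is called radial if $c(x,y)=\ell(d(x,y))$ for a nondecreasing function $\ell:[0,\infty)\to[0,\infty]$ with $\ell(0)=0$ that is strictly increasing and continuous on its domain $\{\ell<\infty\}$. Unbalanced transport: $W(\mu,\nu)=\inf\{\mathcal E(\gamma)\mid\gamma\in\mathcal M_+(\Omega\times\Omega)\}$, where $\mathcal E(\gamma)=\int_{\Omega\times\Omega}c\,\mathrm d\gamma+\mathcal F(\pi_{1\#}\gamma|\mu)+\mathcal F(\pi_{2\#}\gamma|\nu)$.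 Generalized Laguerre cells for $x_1,\dots,x_M\in\Omega$ and $w\in\mathbb R^M$: $C_i(w)=\{x\in\Omega\mid c(x,x_i)<\infty,\ c(x,x_i)-w_i\le c(x,x_j)-w_j\text{ for all }j\in\{1,\dots,M\}\}$. Residual set: $R=\{x\in\Omega\mid c(x,x_i)=\infty\text{ for all }i\in\{1,\dots,M\}\}$. Dual objective: $\mathcal G:\mathbb R^M\to(-\infty,\infty]$, $\mathcal G(w)=-\sum_{i=1}^M\big(\int_{C_i(w)}F^*(-c(x,x_i)+w_i)\,\mathrm d\mu(x)+F^*(-w_i)\,m_i\big)+F(0)\,\mu(R)$ with $\infty\cdot0=0$; the dual tessellation formulation of $W(\mu,\nu)$ is $\sup_{w\in\mathbb R^M}\mathcal G(w)$.
   Formalization: For d=1 only, it is additionally assumed that for every weight vector distinct cells C_i, C_j overlap in a μ-null set; without this G counts overlaps twice and the claim fails, e.g. for ℓ(r)=r. For d≥2 this is proved from μ≪L and radiality. *)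

(* Defs.v *)
From HB Require Import structures.
From mathcomp Require Import all_boot all_order all_algebra.
From mathcomp Require Import all_classical all_reals all_analysis.

Set Implicit Arguments.
Unset Strict Implicit.
Unset Printing Implicit Defensive.

Import Order.TTheory GRing.Theory Num.Theory.
Import numFieldNormedType.Exports.

Local Open Scope classical_set_scope.
Local Open Scope ring_scope.
Local Open Scope ereal_scope.
Local Open Scope charge_scope.

HB.instance Definition _ (R : realType) (d : nat) :=
  @isMeasurable.Build (sigma_display (@open 'rV[R]_d)) 'rV[R]_d <<s @open 'rV[R]_d >>
    (@sigma_algebra0 _ _ _) (@sigma_algebraC _ _) (@sigma_algebra_bigcup _ _ _).

(* The norm of the library on ['rV[R]_d] is the sup norm; it induces the same
   topology, but the costs below are functions of the Euclidean distance. *)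
Definition eucl_dist (R : realType) (d : nat) (x y : 'rV[R]_d) : R :=
  Num.sqrt (\sum_(i < d) (x ord0 i - y ord0 i) ^+ 2)%R.

(* The d-fold product of the one-dimensional Lebesgue measure, obtained by
   splitting off the first coordinate. Only its values on Borel sets matter. *)
Fixpoint lebesgue_rV (R : realType) (d : nat) : set 'rV[R]_d -> \bar R :=
  if d is d'.+1 then
    fun A => (@lebesgue_measure R \x @lebesgue_rV R d')
      [set p | A (row_mx (p.1%:M : 'rV[R]_1) p.2)]
  else \d_(0%R : 'rV[R]_0).

(* A measure on a measurable subset [A] of [T] is represented by a measure on
   [T] for which the complement of [A] is null. In particular M_+(A), for [A]
   closed in R^d, is the set of all concentrated finite Borel measures: these
   are automatically Radon. *)
Definition concentrated (R : realType) (disp : measure_display)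
  (T : measurableType disp) (m : set T -> \bar R) (A : set T) : Prop :=
  m (~` A) = 0.

(* Convertible to [mrestr], but does not require a proof that [D] is
   measurable. *)
Definition restriction (R : realType) (disp : measure_display)
  (T : measurableType disp) (m : set T -> \bar R) (D : set T) :
  set T -> \bar R := fun A => m (A `&` D).

Section marginals.
Context (disp : measure_display) (T : measurableType disp) (R : realType).
Variable gamma : {finite_measure set (T * T)%type -> \bar R}.

Definition marginal1 : set T -> \bar R := pushforward gamma fst.
Definition marginal2 : set T -> \bar R := pushforward gamma snd.

Let marginal1_0 : marginal1 set0 = 0.
Proof. exact: measure0. Qed.

Let marginal1_ge0 A : 0 <= marginal1 A.
Proof. exact: measure_ge0. Qed.

Let marginal1_sigma_additive : semi_sigma_additive marginal1.
Proof.
apply: (@measure_semi_sigma_additive _ _ _ (pushforward gamma fst)).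
exact: measurable_fst.
Qed.

HB.instance Definition _ := isMeasure.Build _ _ _ marginal1
  marginal1_0 marginal1_ge0 marginal1_sigma_additive.

Let marginal1_fin : fin_num_fun marginal1.
Proof.
move=> A mA; apply: fin_num_measure.
by rewrite -[X in measurable X]setTI; exact: measurable_fst.
Qed.

HB.instance Definition _ := Measure_isFinite.Build _ _ _ marginal1
  marginal1_fin.

Let marginal2_0 : marginal2 set0 = 0.
Proof. exact: measure0. Qed.

Let marginal2_ge0 A : 0 <= marginal2 A.
Proof. exact: measure_ge0. Qed.

Let marginal2_sigma_additive : semi_sigma_additive marginal2.
Proof.
apply: (@measure_semi_sigma_additive _ _ _ (pushforward gamma snd)).
exact: measurable_snd.
Qed.

HB.instance Definition _ := isMeasure.Build _ _ _ marginal2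
  marginal2_0 marginal2_ge0 marginal2_sigma_additive.

Let marginal2_fin : fin_num_fun marginal2.
Proof.
move=> A mA; apply: fin_num_measure.
by rewrite -[X in measurable X]setTI; exact: measurable_snd.
Qed.

HB.instance Definition _ := Measure_isFinite.Build _ _ _ marginal2
  marginal2_fin.

End marginals.

(* Radon-Nikodym derivative of finite measures, real-valued. The derivative of
   the library is finite everywhere when [rho `<< mu], so that [fine] loses
   nothing in that case. *)
Definition density (R : realType) (disp : measure_display)
  (T : measurableType disp) (rho mu : {finite_measure set T -> \bar R})
  (x : T) : R := fine (('d (charge_of_finite_measure rho) '/d mu) x).

(* A function F : [0, oo) -> [0, oo] is represented by its extension by +oo to
   the negative numbers. *)
Record entropy_function (R : realType) (F : R -> \bar R) : Prop := {
  entropy_neg : forall s : R, (s < 0)%R -> F s = +oo;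
  entropy_ge0 : forall s, 0 <= F s;
  entropy_proper : exists s, F s < +oo;
  entropy_convex : forall s t a : R, (0 <= a <= 1)%R ->
    F (a * s + (1 - a) * t)%R <= a%:E * F s + (1 - a)%:E * F t;
  entropy_lsc : lower_semicontinuous F;
  entropy_superlinear : F s * (s^-1)%:E @[s --> +oo%R] --> +oo }.

Definition conjugate (R : realType) (F : R -> \bar R) (z : R) : \bar R :=
  ereal_sup [set (z * s)%:E - F s | s in [set s : R | (0 <= s)%R]].

Definition subdifferential (R : realType) (f : R -> \bar R) (z : R) : set R :=
  [set s | forall y, f z + (s * (y - z))%:E <= f y].

Definition discrepancy (R : realType) (disp : measure_display)
  (T : measurableType disp) (F : R -> \bar R) (Omega : set T)
  (rho mu : {finite_measure set T -> \bar R}) : \bar R :=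
  if `[< rho `<< mu >] then \int[mu]_(x in Omega) F (density rho mu x)
  else +oo.

Section transport.
Context (R : realType) (d : nat).
Notation E := 'rV[R]_d.
(* Costs are only considered on [Omega `*` Omega]; their values elsewhere are
   irrelevant. *)
Variables (Omega : set E) (c : E -> E -> \bar R) (F : R -> \bar R).

Definition cost_function : Prop :=
  (forall x y, Omega x -> Omega y -> 0 <= c x y) /\
  lower_semicontinuous
    (fun p : subspace (Omega `*` Omega) => c p.1 p.2).

Definition radial_profile (l : R -> \bar R) : Prop :=
  let dom := [set r : R | (0 <= r)%R /\ l r < +oo] in
  [/\ l 0%R = 0,
      (forall r s : R, (0 <= r <= s)%R -> l r <= l s),
      (forall r s : R, dom r -> dom s -> (r < s)%R -> l r < l s) &
      {within dom, continuous l}].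

Definition radial_cost : Prop := exists2 l, radial_profile l &
  forall x y, Omega x -> Omega y -> c x y = l (eucl_dist x y).

Definition transport_energy (mu nu : {finite_measure set E -> \bar R})
  (gamma : {finite_measure set (E * E)%type -> \bar R}) : \bar R :=
  \int[gamma]_(p in Omega `*` Omega) c p.1 p.2
  + discrepancy F Omega (marginal1 gamma) mu
  + discrepancy F Omega (marginal2 gamma) nu.

Definition transport_value (mu nu : {finite_measure set E -> \bar R}) : \bar R :=
  ereal_inf [set transport_energy mu nu gamma |
    gamma in [set gamma : {finite_measure set (E * E)%type -> \bar R} |
              concentrated gamma (Omega `*` Omega)]].

Definition optimal_plan (mu nu : {finite_measure set E -> \bar R})
  (gamma : {finite_measure set (E * E)%type -> \bar R}) : Prop :=
  concentrated gamma (Omega `*` Omega) /\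
  forall gamma' : {finite_measure set (E * E)%type -> \bar R},
    concentrated gamma' (Omega `*` Omega) ->
    transport_energy mu nu gamma <= transport_energy mu nu gamma'.

Context (M : nat).
Variable p : 'I_M -> E.

Definition laguerre_cell (w : 'rV[R]_M) (i : 'I_M) : set E :=
  [set x | [/\ Omega x, c x (p i) < +oo &
    forall j, c x (p i) - (w ord0 i)%:E <= c x (p j) - (w ord0 j)%:E]].

Definition residual_set : set E :=
  [set x | Omega x /\ forall i, c x (p i) = +oo].

(* For d >= 2, absolute continuity of [mu] and radiality of the cost make this a
   fact, because spheres about distinct centres meet in a
   null set of each of them. For d = 1
   it can fail: for l r = r and w_i - w_j = |x_i - x_j|, the i-th and j-th cells
   share a half-line, on which the dual objective counts [mu] twice. *)
Definition null_overlaps (mu : {finite_measure set E -> \bar R}) : Prop :=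
  forall (w : 'rV[R]_M) (i j : 'I_M), i != j ->
    mu (laguerre_cell w i `&` laguerre_cell w j) = 0.

(* -c(x, x_i) + w_i, a real number on the i-th cell. *)
Definition cell_potential (w : 'rV[R]_M) (i : 'I_M) (x : E) : R :=
  (- fine (c x (p i)) + w ord0 i)%R.

Definition dual_objective (mu : {finite_measure set E -> \bar R})
  (m : 'I_M -> R) (w : 'rV[R]_M) : \bar R :=
  - (\sum_(i < M)
      (\int[mu]_(x in laguerre_cell w i) conjugate F (cell_potential w i x)
       + conjugate F (- w ord0 i)%R * (m i)%:E))
  + F 0%R * mu residual_set.

Definition optimal_weights (mu : {finite_measure set E -> \bar R})
  (m : 'I_M -> R) (w : 'rV[R]_M) : Prop :=
  forall w', dual_objective mu m w' <= dual_objective mu m w.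

Definition condition_a (gamma : {finite_measure set (E * E)%type -> \bar R})
  (w : 'rV[R]_M) : Prop :=
  forall A, measurable A -> gamma A = \sum_(i < M)
    (restriction (marginal1 gamma) (laguerre_cell w i) \x \d_(p i)) A.

Definition condition_b (mu : {finite_measure set E -> \bar R})
  (gamma : {finite_measure set (E * E)%type -> \bar R}) (w : 'rV[R]_M) : Prop :=
  [/\ marginal1 gamma `<< mu,
      (forall i, {ae mu, forall x, laguerre_cell w i x ->
         subdifferential (conjugate F) (cell_potential w i x)
           (density (marginal1 gamma) mu x)}) &
      {ae mu, forall x, residual_set x -> density (marginal1 gamma) mu x = 0%R}].

Definition condition_c (m : 'I_M -> R)
  (gamma : {finite_measure set (E * E)%type -> \bar R}) (w : 'rV[R]_M) : Prop :=
  forall i, subdifferential (conjugate F) (- w ord0 i)%R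
    (fine (marginal1 gamma (laguerre_cell w i)) / m i)%R.

End transport.

(* Main.v *)
(* Write h(x) = max_i (w_i - c(x, x_i)), so that C_i(w) is where the maximum is
   attained at i. For a plan of finite energy (necessarily carried by the slices
   Omega x {x_i}), E(gamma) - G(w) is the sum of three nonnegative gaps: the
   integral of c(x, x_i) + h(x) - w_i against gamma, and the two gaps in the
   Young inequality for (drho/dmu, h) and for (gamma(Omega x {x_i})/m_i, -w_i).
   They vanish exactly when (a), (b) and (c) hold, which gives weak duality and
   the converse implication, and reduces the forward one to the absence of a
   duality gap. If w is optimal, the one-sided derivatives of G at w along the
   coordinate axes are expressed by the one-sided slopes of F^*, because the
   cells overlap in null sets only; their signs make it possible to construct a
   plan satisfying (a), (b) and (c), hence one whose energy is G(w).

   In dimension at least 2 the overlaps are null because a set whose part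
   on each sphere about x_i lies in a hyperplane normal to x_i - x_j is null. *)
Require Import Defs.
From HB Require Import structures.
From mathcomp Require Import all_boot all_order all_algebra.
From mathcomp Require Import all_classical all_reals all_analysis.
From mathcomp Require Import measurable_realfun ring lra.
Set Implicit Arguments.
Unset Strict Implicit.
Unset Printing Implicit Defensive.

Import Order.TTheory GRing.Theory Num.Theory.
Import numFieldNormedType.Exports.

Local Open Scope classical_set_scope.
Local Open Scope ring_scope.
Local Open Scope ereal_scope.

(** * One-sided slopes of convex functions on the line *)

Section Slopes.
Context {R : realType}.
Implicit Type f : R -> R.

(** Two obstacles shape the proof. The first is infinity: cost, entropies and the integrals of [F^*]
    may all be infinite, so energy and dual value cannot simply be subtracted. Superlinearity of [F]
    makes [F^*] finite, and the potential is bounded above; measuring [F^*] of it downwards from an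
    upper bound leaves nonnegative integrands only. The second is that stationarity along the
    coordinate axes does not imply optimality for a general nonsmooth convex function. Here it
    suffices because the cells are disjoint up to null sets: the density on one cell is chosen
    independently of the others, and each coordinate only asks that two intervals meet, the masses
    its cell can receive and the multiples by [m i] of the subgradients of [F^*] at [- w_i].
    Finiteness of [W] bounds the dual objective by weak duality, which makes its difference
    quotients integrable. *)

Definition convex_on_line f := forall x y a : R, (0 <= a <= 1)%R ->
  (f (a * x + (1 - a) * y) <= a * f x + (1 - a) * f y)%R.

Lemma convex_chord f (x y z : R) : convex_on_line f -> (x < y)%R -> (y < z)%R ->
  (f y * (z - x) <= (z - y) * f x + (y - x) * f z)%R.
Proof.
move=> cf xy yz.
have zx : (0 < z - x)%R by lra.
have a01 : (0 <= (z - y) / (z - x) <= 1)%R.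
  apply/andP; split; first by rewrite divr_ge0//; lra.
  by rewrite ler_pdivrMr//; lra.
have := cf x z ((z - y) / (z - x))%R a01.
have -> : (1 - (z - y) / (z - x) = (y - x) / (z - x))%R by field; rewrite gt_eqF.
have -> : ((z - y) / (z - x) * x + (y - x) / (z - x) * z = y)%R.
  by field; rewrite gt_eqF.
move=> h; have := ler_wpM2r (ltW zx) h.
rewrite mulrDl [X in (_ <= X)%R -> _](_ : _ =
  (z - y) * f x + (y - x) * f z)%R//.
by field; rewrite gt_eqF.
Qed.

Definition slope f (z t : R) : R := ((f (z + t) - f z) / t)%R.

Lemma slopeE f (z t : R) : t != 0%R -> (f (z + t) = f z + t * slope f z t)%R.
Proof. by move=> t0; rewrite /slope; field. Qed.

(** [convex_chord] at [z], [z + s] and [z + t] in increasing order, one case per sign pattern;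
    multiplying by the positive one of [s * t] and [- s * t] clears both denominators. *)
Lemma slope_le f (z s t : R) : convex_on_line f ->
  s != 0%R -> t != 0%R -> (s <= t)%R -> (slope f z s <= slope f z t)%R.
Proof.
move=> cf s0 t0; rewrite le_eqVlt => /predU1P[->//|st].
have := slopeE f z s0; have := slopeE f z t0.
set A := slope f z s; set B := slope f z t => fB fA.
have [s_lt0|s_gt0|s_eq0] := ltgtP s 0%R; last by rewrite s_eq0 eqxx in s0.
- have [t_lt0|t_gt0|t_eq0] := ltgtP t 0%R; last by rewrite t_eq0 eqxx in t0.
  + have p1 : (z + s < z + t)%R by lra.
    have p2 : (z + t < z)%R by lra.
    have h := convex_chord cf p1 p2.
    rewrite -subr_ge0 -(pmulr_rge0 _ (_ : 0 < s * t)%R) ?nmulr_rgt0//.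
    by rewrite fA fB in h; nra.
  + have p1 : (z + s < z)%R by lra.
    have p2 : (z < z + t)%R by lra.
    have h := convex_chord cf p1 p2.
    rewrite -subr_ge0 -(pmulr_rge0 _ (_ : 0 < - s * t)%R); last first.
      by rewrite mulr_gt0// oppr_gt0.
    by rewrite fA fB in h; nra.
- have p1 : (z < z + s)%R by lra.
  have p2 : (z + s < z + t)%R by lra.
  have h := convex_chord cf p1 p2.
  rewrite -subr_ge0 -(pmulr_rge0 _ (_ : 0 < s * t)%R); last first.
    by rewrite mulr_gt0//; lra.
  by rewrite fA fB in h; nra.
Qed.

(** Chord slopes increase with the increment, so these are the one-sided derivatives. As an infimum
    and a supremum they come with their bounds; the limits follow in [cvg_right_slope] and
    [cvg_left_slope]. *)
Definition right_slope f (z : R) : R := inf [set slope f z t | t in [set t | 0 < t]%R].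
Definition left_slope f (z : R) : R := sup [set slope f z t | t in [set t | t < 0]%R].

Section convex.
Variables (f : R -> R) (cf : convex_on_line f).

Lemma has_lbound_right_slopes z :
  has_inf [set slope f z t | t in [set t | 0 < t]%R].
Proof.
split; first by exists (slope f z 1%R); exists 1%R => //=.
exists (slope f z (-1)%R) => _ [t /= t0 <-].
by apply: slope_le => //; rewrite ?oppr_eq0 ?oner_eq0 ?gt_eqF//; lra.
Qed.

Lemma has_ubound_left_slopes z :
  has_sup [set slope f z t | t in [set t | t < 0]%R].
Proof.
split; first by exists (slope f z (-1)%R); exists (-1)%R => //=; lra.
exists (slope f z 1%R) => _ [t /= t0 <-].
by apply: slope_le => //; rewrite ?oner_eq0 ?lt_eqF//; lra.
Qed.

Lemma right_slope_le z t : (0 < t)%R -> (right_slope f z <= slope f z t)%R.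
Proof.
move=> t0; apply: ge_inf; last by exists t.
by have [] := has_lbound_right_slopes z.
Qed.

Lemma left_slope_ge z t : (t < 0)%R -> (slope f z t <= left_slope f z)%R.
Proof.
move=> t0; apply: ub_le_sup; last by exists t.
by have [] := has_ubound_left_slopes z.
Qed.

Lemma right_slope_ge z t : (t < 0)%R -> (slope f z t <= right_slope f z)%R.
Proof.
move=> t0; apply: lb_le_inf; first by have [] := has_lbound_right_slopes z.
move=> _ [s /= s0 <-].
by apply: slope_le => //; [exact: ltr0_neq0|exact: lt0r_neq0|lra].
Qed.

Lemma left_slope_le z t : (0 < t)%R -> (left_slope f z <= slope f z t)%R.
Proof.
move=> t0; apply: ge_sup; first by have [] := has_ubound_left_slopes z.
move=> _ [s /= s0 <-].
by apply: slope_le => //; [exact: ltr0_neq0|exact: lt0r_neq0|lra].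
Qed.

Definition subgradient (z s : R) := forall y, (f z + s * (y - z) <= f y)%R.

Lemma subgradientP z s :
  (forall t, (0 < t)%R -> (s <= slope f z t)%R) ->
  (forall t, (t < 0)%R -> (slope f z t <= s)%R) -> subgradient z s.
Proof.
move=> hr hl y.
have [->|yz] := eqVneq y z; first by rewrite subrr mulr0 addr0.
have yz0 : (y - z != 0)%R by rewrite subr_eq0.
have := slopeE f z yz0; rewrite (addrC z) subrK => ->.
rewrite lerD2l mulrC.
have [yz'|yz'|/eqP] := ltgtP (y - z)%R 0%R; last by rewrite (negbTE yz0).
- by rewrite ler_nM2l//; exact: hl.
- by rewrite ler_pM2l//; exact: hr.
Qed.

Lemma right_slope_subgradient z : subgradient z (right_slope f z).
Proof.
by apply: subgradientP => t t0; [exact: right_slope_le|exact: right_slope_ge].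
Qed.

Lemma left_slope_subgradient z : subgradient z (left_slope f z).
Proof.
by apply: subgradientP => t t0; [exact: left_slope_le|exact: left_slope_ge].
Qed.

Lemma subgradient_mono z1 z2 s1 s2 : subgradient z1 s1 -> subgradient z2 s2 ->
  (z1 < z2)%R -> (s1 <= s2)%R.
Proof.
move=> h1 h2 z12; rewrite leNgt; apply/negP => s21.
have : (0 < (s1 - s2) * (z2 - z1))%R by rewrite mulr_gt0 ?subr_gt0.
by have := h1 z2; have := h2 z1; lra.
Qed.

Lemma subgradient_convex z s1 s2 a : subgradient z s1 -> subgradient z s2 ->
  (0 <= a <= 1)%R -> subgradient z ((1 - a) * s1 + a * s2)%R.
Proof.
move=> h1 h2 /andP[a0 a1] y; have := h1 y; have := h2 y.
set u := f z; set v := f y; set p := (y - z)%R => k2 k1.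
have a1' : (0 <= 1 - a)%R by lra.
have := ler_wpM2l a0 k2; have := ler_wpM2l a1' k1; lra.
Qed.

Lemma right_slope_nd : {homo right_slope f : x y / (x <= y)%R}.
Proof.
move=> x y; rewrite le_eqVlt => /predU1P[->//|xy].
exact: subgradient_mono (right_slope_subgradient x) (right_slope_subgradient y) xy.
Qed.

Lemma left_slope_nd : {homo left_slope f : x y / (x <= y)%R}.
Proof.
move=> x y; rewrite le_eqVlt => /predU1P[->//|xy].
exact: subgradient_mono (left_slope_subgradient x) (left_slope_subgradient y) xy.
Qed.

Lemma left_slope_le_right z : (left_slope f z <= right_slope f z)%R.
Proof.
apply: ge_sup; first by have [] := has_ubound_left_slopes z.
by move=> _ [t t0 <-]; exact: right_slope_ge.
Qed.

Lemma cvg_right_slope z :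
  slope f z n.+1%:R^-1%R @[n --> \oo] --> right_slope f z.
Proof.
apply/cvgrPdist_le => e e0.
have [_ [t /= t0 <-] te] : exists2 y,
    [set slope f z t | t in [set t | 0 < t]%R] y & (y < right_slope f z + e)%R.
  by apply: inf_adherent => //; exact: has_lbound_right_slopes.
near=> n.
have nt : (n.+1%:R^-1 < t)%R.
  near: n; exact: (near_infty_natSinv_lt (PosNum t0)).
have n0 : (0 < n.+1%:R^-1 :> R)%R by rewrite invr_gt0.
rewrite ler_distlC; apply/andP; split.
  by rewrite (le_trans _ (right_slope_le z n0))// gerBl ltW.
rewrite (le_trans _ (ltW te))//; apply: slope_le => //; rewrite ?gt_eqF//.
exact: ltW.
Unshelve. all: by end_near. Qed.

Lemma cvg_left_slope z :
  slope f z (- n.+1%:R^-1)%R @[n --> \oo] --> left_slope f z.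
Proof.
apply/cvgrPdist_le => e e0.
have [_ [t /= t0 <-] te] : exists2 y,
    [set slope f z t | t in [set t | t < 0]%R] y & (left_slope f z - e < y)%R.
  by apply: sup_adherent => //; exact: has_ubound_left_slopes.
have t0' : (0 < - t)%R by rewrite oppr_gt0.
near=> n.
have nt : (n.+1%:R^-1 < - t)%R.
  near: n; exact: (near_infty_natSinv_lt (PosNum t0')).
have n0 : (0 < n.+1%:R^-1 :> R)%R by rewrite invr_gt0.
rewrite ler_distlC; apply/andP; split; last first.
  have n0' : (- n.+1%:R^-1 < 0 :> R)%R by rewrite oppr_lt0.
  by rewrite (le_trans (left_slope_ge z n0'))// lerDl ltW.
rewrite (le_trans (ltW te))//; apply: slope_le => //; rewrite ?lt_eqF ?oppr_lt0//.
by rewrite lerNr ltW.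
Unshelve. all: by end_near. Qed.

End convex.
End Slopes.

(** * The conjugate of the entropy function *)

Section Conjugate.
Context {R : realType}.
Variables (F : R -> \bar R) (hF : entropy_function F).

Lemma conjugate_ge (z s : R) : (z * s)%:E - F s <= conjugate F z.
Proof.
have [s0|s0] := leP 0%R s; first by apply: ereal_sup_ubound; exists s.
by rewrite (entropy_neg hF s0) addeNy leNye.
Qed.

(** A point where [F] is finite bounds the supremum below. Above, superlinearity gives
    [z * s <= F s] beyond some [S], and up to [|S|] the terms are at most [|z| * |S|]. *)
Lemma conjugate_fin_num z : conjugate F z \is a fin_num.
Proof.
have [S [_ hS]] : \forall s \near +oo%R, (z%:E <= F s * (s^-1)%:E).
  exact: (cvgey_ge (entropy_superlinear hF)).
have [s0 s0F] := entropy_proper hF.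
rewrite fin_numElt; apply/andP; split.
  apply: (@lt_le_trans _ _ ((z * s0)%:E - F s0)); last exact: conjugate_ge.
  have : F s0 \is a fin_num by rewrite ge0_fin_numE// (entropy_ge0 hF).
  by move=> /fineK <-; rewrite -EFinB ltNyr.
apply: (@le_lt_trans _ _ (`|z| * `|S|)%:E); last by rewrite ltry.
apply: ge_ereal_sup => _ [s /= s0' <-].
have Fs0 := entropy_ge0 hF s.
have [sS|Ss] := leP s `|S|%R.
  apply: (@le_trans _ _ (z * s)%:E).
    by rewrite -[leRHS]sube0 leeB.
  rewrite lee_fin (le_trans (ler_norm _))// normrM ler_wpM2l//.
  by rewrite (ger0_norm s0').
have s_gt0 : (0 < s)%R by exact: le_lt_trans Ss.
have h := hS s (le_lt_trans (ler_norm _) Ss).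
apply: (@le_trans _ _ 0); last by rewrite lee_fin mulr_ge0.
move: Fs0 h; case: (F s) => [r| |] //=.
rewrite -EFinM !lee_fin ler_pdivlMr// => Fs0 h; lra.
Qed.

Definition rconjugate (z : R) : R := fine (conjugate F z).

Lemma rconjugateE z : conjugate F z = (rconjugate z)%:E.
Proof. by rewrite /rconjugate fineK// conjugate_fin_num. Qed.

Lemma young (z s : R) : (z * s)%:E <= F s + (rconjugate z)%:E.
Proof.
have := conjugate_ge z s; have := entropy_ge0 hF s; rewrite rconjugateE.
case: (F s) => [r _|_ _|//]; last by rewrite addye// leey.
by rewrite -EFinB -EFinD !lee_fin; lra.
Qed.

Lemma rconjugate_le (z b : R) :
  (forall s, (0 <= s)%R -> (z * s)%:E <= F s + b%:E) -> (rconjugate z <= b)%R.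
Proof.
move=> h; rewrite -lee_fin -rconjugateE; apply: ge_ereal_sup => _ [s /= s0 <-].
have := h s s0; have := entropy_ge0 hF s; case: (F s) => [r| |] //=.
- by rewrite -EFinD -EFinB !lee_fin => *; lra.
- by move=> *; rewrite addeNy leNye.
Qed.

(** Only [s >= 0] competes in the supremum. *)
Lemma rconjugate_nd : {homo rconjugate : x y / (x <= y)%R}.
Proof.
move=> x y xy; apply: rconjugate_le => s s0.
by apply: le_trans (young y s); rewrite lee_fin ler_wpM2r.
Qed.

Lemma rconjugate_convex : convex_on_line rconjugate.
Proof.
move=> x y a /andP[a0 a1]; apply: rconjugate_le => s s0.
have := young x s; have := young y s; have := entropy_ge0 hF s.
case: (F s) => [r|_ _ _|//]; last by rewrite addye// leey.
rewrite -!EFinD !lee_fin => _ hy hx.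
have a1' : (0 <= 1 - a)%R by lra.
have := ler_wpM2l a0 hx; have := ler_wpM2l a1' hy; lra.
Qed.

(* The slopes of the chords from (s, b) to the left part of the epigraph lie
   below those to the right part; lower semicontinuity at [s] keeps both
   families bounded, so a line through (s, b) of intermediate slope exists. *)
Lemma affine_minorant (s b : R) : b%:E < F s ->
  exists y : R, forall t, (b + y * (t - s))%:E <= F t.
Proof.
move=> bF.
have [b0|b0] := leP b 0%R.
  exists 0%R => t; rewrite mul0r addr0.
  by apply: le_trans (entropy_ge0 hF t); rewrite lee_fin.
have [V /nbhs_ballP[e /= e0 eV] Vb] := entropy_lsc hF bF.
have near_s t : (`|s - t| < e)%R -> b%:E < F t by move=> ?; apply: Vb; apply: eV.
(* Slopes [B] and [- B] lower the line through (s, b) to 0 at distance [e], on the left and on the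
   right respectively. Nearer than [e], [F] exceeds [b]; farther away [F >= 0] is enough. *)
pose B := (b / e)%R.
have B0 : (0 < B)%R by rewrite divr_gt0.
have Be : (B * e = b)%R by rewrite /B; field; rewrite gt_eqF.
(* The slopes of the chords from the left; [- B] keeps the family nonempty when [F] is +oo on the
   left of [s]. *)
pose L := [set y | y = (- B)%R \/ exists2 t, (t < s)%R &
  exists2 r, F t = r%:E & y = ((b - r) / (s - t))%R].
have far_le (t r : R) : (t != s) -> F t = r%:E -> (b - r <= B * `|s - t|)%R.
  move=> ts Ft; have [st|st] := ltP `|s - t|%R e.
    have := near_s t st; rewrite Ft lte_fin => br.
    have := mulr_ge0 (ltW B0) (normr_ge0 (s - t)%R); lra.
  have := ler_wpM2l (ltW B0) st.
  have := entropy_ge0 hF t; rewrite Ft lee_fin; lra.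
have Lub y t r : L y -> (s < t)%R -> F t = r%:E -> (y * (t - s) <= r - b)%R.
  move=> Ly st Ft; have ts0 : (0 < t - s)%R by rewrite subr_gt0.
  case: Ly => [->|[u us [q Fu ->]]].
    by have := far_le t r (negbT (gt_eqF st)) Ft; rewrite ltr0_norm ?subr_lt0// mulNr; lra.
  have su0 : (0 < s - u)%R by rewrite subr_gt0.
  rewrite mulrAC ler_pdivrMr//.
  have tu0 : (0 < t - u)%R by lra.
  have a01 : (0 <= (t - s) / (t - u) <= 1)%R.
    apply/andP; split; first by rewrite divr_ge0// ltW.
    by rewrite ler_pdivrMr//; lra.
  have := entropy_convex hF u t a01.
  have -> : ((t - s) / (t - u) * u + (1 - (t - s) / (t - u)) * t = s)%R.
    by field; rewrite gt_eqF.
  move=> /(lt_le_trans bF); rewrite Fu Ft -!EFinM -EFinD lte_fin => h.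
  have := ltr_pM2r tu0 b ((t - s) / (t - u) * q + (1 - (t - s) / (t - u)) * r)%R.
  rewrite h (_ : (((t - s) / (t - u) * q + (1 - (t - s) / (t - u)) * r)
    * (t - u) = (t - s) * q + (s - u) * r)%R); last by field; rewrite gt_eqF.
  by move=> /esym; lra.
have Lsup : has_sup L.
  split; first by exists (- B)%R; left.
  exists B => y [->|[u us [q Fu ->]]]; first lra.
  rewrite ler_pdivrMr ?subr_gt0//.
  by have := far_le u q (negbT (lt_eqF us)) Fu; rewrite gtr0_norm ?subr_gt0.
exists (sup L) => t.
case: (ltgtP t s) => [ts|st|->]; last by rewrite subrr mulr0 addr0 ltW.
- have := entropy_ge0 hF t; case Ft : (F t) => [r| |] // _; last by rewrite leey.
  rewrite lee_fin.
  have : ((b - r) / (s - t) <= sup L)%R.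
    by apply: ub_le_sup; [exact: Lsup.2|right; exists t => //; exists r].
  by rewrite ler_pdivrMr ?subr_gt0//; lra.
- have := entropy_ge0 hF t; case Ft : (F t) => [r| |] // _; last by rewrite leey.
  have ts0 : (0 < t - s)%R by rewrite subr_gt0.
  rewrite lee_fin -lerBrDl -ler_pdivlMr//.
  apply: ge_sup; first exact: Lsup.1.
  by move=> y Ly; rewrite ler_pdivlMr//; exact: Lub Ly st Ft.
Qed.

Lemma subdifferentialP (z s : R) :
  subdifferential (conjugate F) z s <-> subgradient rconjugate z s.
Proof.
by split=> h y; have := h y; rewrite !rconjugateE -EFinD lee_fin.
Qed.

(** From left to right this is biconjugation: were [F s] larger than [z * s - F^* z], some [c]
    strictly between would admit a line of slope [y] through (s, c) below [F], whence
    [F^* y <= y * s - c], against the subgradient inequality at [y]. *)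
Lemma subdifferential_young_eq (z s : R) :
  subdifferential (conjugate F) z s <-> F s + (rconjugate z)%:E = (z * s)%:E.
Proof.
rewrite subdifferentialP; split => [h|h y].
  apply/eqP; rewrite eq_le young andbT addeC -leeBrDl// -EFinB.
  rewrite leNgt; apply/negP => aF.
  have [c /andP[ac cF]] : exists c : R, ((z * s - rconjugate z)%:E < c%:E < F s).
    move: aF; case: (F s) => [r|_|//].
      rewrite lte_fin => ar; exists ((z * s - rconjugate z + r) / 2)%R.
      by rewrite !lte_fin midf_lt//= midf_lt.
    by exists (z * s - rconjugate z + 1)%R; rewrite ltry lte_fin ltrDl ltr01.
  have [y hy] := affine_minorant cF.
  have : (rconjugate y <= y * s - c)%R.
    apply: rconjugate_le => t _; apply: le_trans (leeD2r _ (hy t)).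
    by rewrite -EFinD lee_fin; lra.
  by have := h y; move: ac; rewrite lte_fin; lra.
have Fs : F s = (z * s - rconjugate z)%:E.
  move: h; case: (F s) => [r| |] //= [] <-; congr EFin; lra.
by have := young y s; rewrite Fs -EFinD lee_fin; lra.
Qed.

End Conjugate.

(** * Borel sets of row vectors and the measure structure of [lebesgue_rV] *)

Section RowVectorBorel.
Context {R : realType}.

Lemma measurable_coord d (i : 'I_d) :
  measurable_fun [set: 'rV[R]_d] (fun x : 'rV[R]_d => x ord0 i).
Proof.
apply: (measurability (@RGenOpens.G R)); first exact: RGenOpens.measurableE.
move=> _ [_ [a [b ->]] <-]; rewrite setTI; apply: sub_sigma_algebra.
apply: open_comp; last exact: interval_open.
by move=> x _; exact: coord_continuous.
Qed.

(** Balls of the sup norm are boxes, so every open set is a countable union of boxes with rational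
    corners; the preimage of a box is a finite intersection. *)
Lemma measurable_fun_rV disp (T : measurableType disp) d (f : T -> 'rV[R]_d) :
  (forall i, measurable_fun [set: T] (fun t => f t ord0 i)) ->
  measurable_fun [set: T] f.
Proof.
move=> mf; apply: (measurability (@open 'rV[R]_d)); first by [].
move=> _ [V oV <-]; rewrite setTI.
pose box (q : {ffun 'I_d -> rat * rat}) : set 'rV[R]_d :=
  [set x | forall i, (ratr (q i).1 < x ord0 i < ratr (q i).2)%R].
pose G (q : {ffun 'I_d -> rat * rat}) : set T :=
  if `[< box q `<=` V >] then f @^-1` box q else set0.
have -> : f @^-1` V = \bigcup_q G q.
  apply/seteqP; split => [t Vft|t [q _]]; last first.
    by rewrite /G; case: asboolP => // qV /qV.
  have := oV; rewrite openE => /(_ _ Vft) /nbhs_ballP[e /= e0 eV].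
  have hq i : exists q : rat * rat,
      [/\ (ratr q.1 < f t ord0 i < ratr q.2)%R,
          (f t ord0 i - e < ratr q.1)%R & (ratr q.2 < f t ord0 i + e)%R].
    have l1 : (f t ord0 i - e < f t ord0 i)%R by lra.
    have l2 : (f t ord0 i < f t ord0 i + e)%R by lra.
    have [q1] := rat_in_itvoo l1; rewrite in_itv/= => /andP[h1 h1'].
    have [q2] := rat_in_itvoo l2; rewrite in_itv/= => /andP[h2 h2'].
    by exists (q1, q2); split => //=; rewrite h1' h2.
  have [q hq'] := choice hq.
  exists [ffun i => q i] => //; rewrite /G.
  have -> : `[< box [ffun i => q i] `<=` V >].
    apply/asboolP => x xq; apply: eV; split => // i j; rewrite (ord1 i).
    have := xq j; have [] := hq' j; rewrite ffunE => /andP[? ?] ? ? /andP[? ?].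
    by rewrite /ball/= ltr_distlC; apply/andP; split; lra.
  by move=> i; rewrite ffunE; have [] := hq' i.
apply: countable_bigcupT_measurable => // q; rewrite /G.
case: ifPn => // _.
rewrite (_ : _ @^-1` _ = \bigcap_(i in [set: 'I_d])
    ((fun t => f t ord0 i) @^-1` `]ratr (q i).1, ratr (q i).2[%classic)).
  apply: fin_bigcap_measurable => // i _.
  by rewrite -[X in measurable X]setTI; exact: mf.
by apply/seteqP; split => [t h i _|t h i]; have := h i; rewrite /= ?in_itv; apply.
Qed.

Lemma measurable_eucl_dist disp (T : measurableType disp) d
    (f g : T -> 'rV[R]_d) :
  measurable_fun [set: T] f -> measurable_fun [set: T] g ->
  measurable_fun [set: T] (fun t => eucl_dist (f t) (g t)).
Proof.
move=> mf mg; rewrite /eucl_dist.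
apply: (@measurableT_comp _ _ _ _ _ _ (@Num.sqrt R)).
  by apply: nondecreasing_measurable => // x y xy; exact: ler_wsqrtr.
apply: measurable_sum => i; apply: measurable_funX; apply: measurable_funB.
  exact: measurableT_comp (measurable_coord i) mf.
exact: measurableT_comp (measurable_coord i) mg.
Qed.

Lemma emeasurable_nondecreasing (l : R -> \bar R) :
  {homo l : x y / (x <= y)%R >-> x <= y} -> measurable_fun [set: R] l.
Proof.
move=> lnd; apply: (measurability (@ErealGenCInfty.G R)).
  exact: ErealGenCInfty.measurableE.
move=> _ [_ [r ->] <-]; rewrite setTI; apply: is_interval_measurable => s t/=.
rewrite !in_itv/= !andbT => rs rt u /andP[su _].
by rewrite in_itv/= andbT (le_trans rs)// lnd.
Qed.

Definition cons_rV d (q : measurableTypeR R * 'rV[R]_d) : 'rV[R]_(1 + d) :=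
  row_mx (q.1%:M : 'rV[R]_1) q.2.

Definition uncons_rV d (x : 'rV[R]_(1 + d)) : measurableTypeR R * 'rV[R]_d :=
  (x ord0 ord0, rsubmx x).

Lemma cons_rVK d : cancel (@cons_rV d) (@uncons_rV d).
Proof.
move=> [y x]; rewrite /cons_rV /uncons_rV /= row_mxKr; congr pair.
transitivity (row_mx (y%:M : 'rV[R]_1) x ord0 (lshift d ord0)).
  by congr (row_mx _ _ _ _); exact: val_inj.
by rewrite row_mxEl mxE eqxx mulr1n.
Qed.

Lemma measurable_cons_rV d : measurable_fun setT (@cons_rV d).
Proof.
apply: measurable_fun_rV => i; rewrite /cons_rV.
case: (splitP i) => j ij.
  rewrite (_ : i = lshift d j); last exact: val_inj.
  rewrite (_ : (fun t => _) = fst); first exact: measurable_fst.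
  by apply/funext => t; rewrite row_mxEl (ord1 j) mxE eqxx mulr1n.
rewrite (_ : i = rshift 1 j); last exact: val_inj.
rewrite (_ : (fun t => _) = (fun x : 'rV[R]_d => x ord0 j) \o snd).
  exact: measurableT_comp (measurable_coord j) measurable_snd.
by apply/funext => t; rewrite row_mxEr.
Qed.

Lemma measurable_uncons_rV d : measurable_fun setT (@uncons_rV d).
Proof.
apply/measurable_fun_pairP; split; first exact: measurable_coord.
apply: measurable_fun_rV => i /=.
rewrite (_ : (fun t => _) = (fun x : 'rV[R]_(1 + d) => x ord0 (rshift 1 i))).
  exact: measurable_coord.
by apply/funext => t; rewrite mxE.
Qed.

Section lift_measure.
Context d (m : {sigma_finite_measure set 'rV[R]_d -> \bar R}).

(** The successor case of [lebesgue_rV], restated so that a measure can be attached to it.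
    Sigma-finiteness is carried along for the next product. *)
Definition lift_measure : set 'rV[R]_(1 + d) -> \bar R :=
  pushforward (@lebesgue_measure R \x m) (@cons_rV d).

Let lift0 : lift_measure set0 = 0.
Proof. by rewrite /lift_measure /pushforward preimage_set0 measure0. Qed.

Let lift_ge0 A : 0 <= lift_measure A.
Proof. by rewrite /lift_measure /pushforward. Qed.

Let lift_sigma_additive : semi_sigma_additive lift_measure.
Proof.
apply: (@measure_semi_sigma_additive _ _ _
  (pushforward (@lebesgue_measure R \x m) (@cons_rV d))).
exact: measurable_cons_rV.
Qed.

HB.instance Definition _ := isMeasure.Build _ _ _ lift_measure
  lift0 lift_ge0 lift_sigma_additive.

Let lift_sigma_finite : sigma_finite setT lift_measure.
Proof.
(* Both exhaustions are nondecreasing, so the products of [F n] and [G n] with the same index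
   already cover the whole space. *)
have /sigma_finiteP[F [FT ndF Foo]] := sigma_finiteT (@lebesgue_measure R).
have /sigma_finiteP[G [GT ndG Goo]] := sigma_finiteT m.
exists (fun n => @uncons_rV d @^-1` (F n `*` G n)).
  rewrite -preimage_bigcup (_ : \bigcup_n (F n `*` G n) = setT)//.
  apply/seteqP; split => // -[y x] _.
  have [n _ Fny] : (\bigcup_n F n) y by rewrite -FT.
  have [k _ Gkx] : (\bigcup_n G n) x by rewrite -GT.
  exists (maxn n k) => //; split => /=.
    by have /subsetPset := ndF _ _ (leq_maxl n k); apply.
  by have /subsetPset := ndG _ _ (leq_maxr n k); apply.
move=> n; have [mF Fn] := Foo n; have [mG Gn] := Goo n; split.
  rewrite -[X in measurable X]setTI; apply: measurable_uncons_rV => //.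
  exact: measurableX.
rewrite /lift_measure /pushforward -comp_preimage.
rewrite (_ : @uncons_rV d \o @cons_rV d = id) ?preimage_id.
  by rewrite product_measure1E// lte_mul_pinfty// ge0_fin_numE.
by apply/funext => t; exact: cons_rVK.
Qed.

HB.instance Definition _ := Measure_isSigmaFinite.Build _ _ _ lift_measure
  lift_sigma_finite.

End lift_measure.

Lemma lebesgue_rV_measure d :
  exists m : {sigma_finite_measure set 'rV[R]_d -> \bar R},
    @lebesgue_rV R d = m.
Proof.
elim: d => [|d [m mE]]; first by exists (\d_ (0%R : 'rV[R]_0)).
by exists (lift_measure m) => /=; rewrite mE.
Qed.

End RowVectorBorel.

(** * Null sets under preimages on the line *)

Section NullSets.
Context {R : realType}.
Local Notation leb := (@lebesgue_measure R).

(** On [E] the inverse of [phi] is Lipschitz with constant [C]. If intervals of small total length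
    cover [N], the part of [E] sent into one of length [b - a] lies within [C * (b - a)] of any of
    its points. On arbitrary sets [leb] is the outer measure, and the estimate is made there. *)
Lemma expansive_preimage_null (phi : R -> R) (E N : set R) (C : R) :
  (0 <= C)%R ->
  (forall s t, E s -> E t -> (`|s - t| <= C * `|phi s - phi t|)%R) ->
  leb N = 0 -> leb (E `&` phi @^-1` N) = 0.
Proof.
move=> C0 hE N0; apply/eqP; rewrite eq_le; apply/andP; split; last first.
  exact: outer_measure_ge0.
apply/lee_addgt0Pr => e e0; rewrite add0e.
have C1 : (0 < 2 * C + 1)%R by lra.
(* Chosen so that [2 * C * eps <= e]; the added 1 keeps the denominator positive when [C] is 0. *)
pose eps := (e / (2 * C + 1))%R.
have eps0 : (0 < eps)%R by rewrite divr_gt0.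
have /ereal_inf_lt[z [/= A [mA NA] Az] ze] : leb N < eps%:E by rewrite N0 lte_fin.
pose X k := E `&` phi @^-1` A k.
have XA k : leb (X k) <= (2 * C)%:E * wlength idfun (A k).
  have [/eqP ->|/set0P[s [Es As]]] := boolP (X k == set0).
    rewrite [leLHS](_ : _ = 0); last exact: measure0.
    by rewrite mule_ge0// ?lee_fin ?mulr_ge0//; exact: wlength_ge0.
  have /ocitvP[A0|[[a b /= ab Aab]]] := mA k; first by rewrite A0 in As.
  rewrite Aab wlength_itv_bnd ?(ltW ab)//=.
  have ba0 : (0 <= C * (b - a))%R by rewrite mulr_ge0// subr_ge0 ltW.
  apply: (@le_trans _ _ (leb `[(s - C * (b - a))%R, (s + C * (b - a))%R]%classic)).
    apply: le_outer_measure => t [Et At] /=; rewrite in_itv/=.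
    have h : (`|s - t| <= C * (b - a))%R.
      apply: (le_trans (hE s t Es Et)); rewrite ler_wpM2l//.
      move: As At; rewrite /= Aab /= !in_itv/= => /andP[? ?] /andP[? ?].
      by rewrite ler_norml; apply/andP; split; lra.
    by move: h; rewrite ler_norml => /andP[? ?]; apply/andP; split; lra.
  rewrite lebesgue_measure_itv/=; case: ifPn => _; last first.
    by rewrite lee_fin -mulrA mulr_ge0.
  by rewrite lee_fin; lra.
apply: (@le_trans _ _ (leb (\bigcup_k X k))).
  by apply: le_outer_measure => t [Et /NA[k _ At]]; exists k.
apply: (@le_trans _ _ (\sum_(k <oo) leb (X k))).
  exact: outer_measure_sigma_subadditive.
apply: (@le_trans _ _ (\sum_(k <oo) (2 * C)%:E * wlength idfun (A k))).
  by apply: lee_nneseries => k *; [exact: outer_measure_ge0|exact: XA].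
rewrite nneseriesZl; last by move=> k _; exact: wlength_ge0.
rewrite Az; apply: (@le_trans _ _ ((2 * C)%:E * eps%:E)).
  by apply: lee_wpmul2l; [rewrite lee_fin mulr_ge0|exact: ltW].
rewrite -EFinM lee_fin /eps mulrA ler_pdivrMr// mulrC ler_wpM2l ?ltW//; lra.
Qed.

(** The difference of two values factors as [(s - t) * (s + t - 2 * a)], so on either side of [a],
    at distance at least [1 / (n + 1)], the parabola is expansive with constant [n + 1]. These
    countably many pieces and the point [a] cover the line. *)
Lemma sqr_preimage_null (a k : R) (N : set R) :
  leb N = 0 -> leb [set z | N ((z - a) ^+ 2 + k)%R] = 0.
Proof.
move=> N0.
pose phi (z : R) := ((z - a) ^+ 2 + k)%R.
pose Er n : set R := [set z | (n.+1%:R^-1 <= z - a)%R].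
pose El n : set R := [set z | (n.+1%:R^-1 <= a - z)%R].
have n0 n : (0 < n.+1%:R^-1 :> R)%R by rewrite invr_gt0.
have expand n (s t : R) : (n.+1%:R^-1 <= `|s + t - 2 * a|)%R ->
    (`|s - t| <= n.+1%:R * `|phi s - phi t|)%R.
  move=> h; rewrite (_ : phi s - phi t = (s - t) * (s + t - 2 * a))%R; last first.
    by rewrite /phi; ring.
  by rewrite normrM mulrCA ler_peMr// -ler_pdivrMl// mulr1.
have r0 n : leb (Er n `&` phi @^-1` N) = 0.
  apply: (@expansive_preimage_null _ _ _ n.+1%:R) => // s t; rewrite /Er/= => hs ht.
  apply: expand; move: (n0 n) hs ht; set u := (n.+1%:R^-1)%R => u0 hs ht.
  by rewrite ger0_norm; lra.
have l0 n : leb (El n `&` phi @^-1` N) = 0.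
  apply: (@expansive_preimage_null _ _ _ n.+1%:R) => // s t; rewrite /El/= => hs ht.
  apply: expand; move: (n0 n) hs ht; set u := (n.+1%:R^-1)%R => u0 hs ht.
  by rewrite ler0_norm; lra.
have a0 : leb [set a] = 0 by exact: lebesgue_measure_set1.
have U0 (X Y : set R) : leb X = 0 -> leb Y = 0 -> leb (X `|` Y) = 0.
  move=> X0 Y0; apply/eqP; rewrite eq_le outer_measure_ge0 andbT.
  have <- : leb X + leb Y = 0 by rewrite X0 Y0 adde0.
  exact: outer_measureU2.
have bigU0 (X : nat -> set R) : (forall n, leb (X n) = 0) ->
    leb (\bigcup_n X n) = 0.
  move=> X0; apply/eqP; rewrite eq_le outer_measure_ge0 andbT.
  have <- : \sum_(n <oo) leb (X n) = 0 by rewrite eseries0.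
  exact: outer_measure_sigma_subadditive.
apply/eqP; rewrite eq_le outer_measure_ge0 andbT.
rewrite -(U0 _ _ a0 (U0 _ _ (bigU0 _ r0) (bigU0 _ l0))).
apply: le_outer_measure => z /= Nz.
have arch (u : R) : (0 < u)%R -> exists n, (n.+1%:R^-1 <= u)%R.
  move=> u0; near \oo => n; exists n.
  by apply/ltW; near: n; exact: (near_infty_natSinv_lt (PosNum u0)).
have [za|za|->] := ltgtP z a; last by left.
- have [|n hn] := arch (a - z)%R; first by rewrite subr_gt0.
  by right; right; exists n.
- have [|n hn] := arch (z - a)%R; first by rewrite subr_gt0.
  by right; left; exists n.
Unshelve. all: by end_near. Qed.

End NullSets.

(** * Null sets in product spaces *)

Section ProductNull.
Context d1 d2 (T1 : measurableType d1) (T2 : measurableType d2) (R : realType).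
Variables (m1 : {sigma_finite_measure set T1 -> \bar R}).
Variables (m2 : {sigma_finite_measure set T2 -> \bar R}).

Lemma product_null_xsection (A : set (T1 * T2)) : measurable A ->
  (m1 \x m2) A = 0 <-> {ae m1, forall x, m2 (xsection A x) = 0}.
Proof.
move=> mA.
have mf : measurable_fun setT (m2 \o xsection A).
  exact: measurable_fun_xsection.
have -> : (m1 \x m2) A = \int[m1]_x `|(m2 \o xsection A) x|.
  by apply: eq_integral => x _; rewrite gee0_abs.
rewrite ae_eq_integral_abs//; split; apply: filterS => x //=; exact.
Qed.

Lemma product_null_ysection (A : set (T1 * T2)) : measurable A ->
  (forall y, m1 (ysection A y) = 0) -> (m1 \x m2) A = 0.
Proof.
move=> mA A0; rewrite (@product_measure_unique _ _ _ _ _ m1 m2 (m1 \x^ m2))//.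
  by apply: integral0_eq => y _; exact: A0.
by move=> B C mB mC; exact: product_measure2E.
Qed.

End ProductNull.

(** * Planar sets whose part on each circle lies in a line *)

Section CircleSections.
Context {R : realType}.
Local Notation leb := (@lebesgue_measure R).
Local Notation R' := (measurableTypeR R).

(** Eliminating [v * z] leaves a quadratic equation for [y] with leading coefficient
    [u ^+ 2 + v ^+ 2]. One root is [y0], and Vieta's formula gives the other. *)
Lemma line_circle_roots (u v y z y0 z0 : R) :
  (u ^+ 2 + v ^+ 2 != 0)%R -> (u * y + v * z = u * y0 + v * z0)%R ->
  (y ^+ 2 + z ^+ 2 = y0 ^+ 2 + z0 ^+ 2)%R ->
  y = y0 \/ (y = 2 * u * (u * y0 + v * z0) / (u ^+ 2 + v ^+ 2) - y0)%R.
Proof.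
move=> uv0 lin circ; set k := (_ - _)%R.
have : ((y - y0) * (y - k) = 0)%R.
  apply: (mulfI uv0); rewrite mulr0.
  rewrite [LHS](_ : _ = (u ^+ 2 + v ^+ 2) * (y ^+ 2 - y0 ^+ 2)
    - 2 * u * (u * y0 + v * z0) * (y - y0))%R; last by rewrite /k; field.
  have lin' : (v * z = u * y0 + v * z0 - u * y)%R by lra.
  have e : ((v * z) ^+ 2 = v ^+ 2 * (y0 ^+ 2 + z0 ^+ 2 - y ^+ 2))%R.
    by rewrite exprMn -circ; ring.
  by rewrite lin' in e; lra.
by move=> /eqP; rewrite mulf_eq0 !subr_eq0 => /orP[]/eqP ->; [left|right].
Qed.

(* Replacing [z] by [q = (y - a)^2 + (z - b)^2] maps [S] to a set whose sections
   at fixed [q] have at most two points: a line meets a circle at most twice. *)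
Lemma circle_sections_null (a b u v : R) (S : set (R' * R')) :
  measurable S -> (u != 0%R) || (v != 0%R) ->
  (forall y z y' z', S (y, z) -> S (y', z') ->
    ((y - a) ^+ 2 + (z - b) ^+ 2 = (y' - a) ^+ 2 + (z' - b) ^+ 2)%R ->
    (u * y + v * z = u * y' + v * z')%R) ->
  (leb \x leb) S = 0.
Proof.
move=> mS uv hS.
(* Over [(y, q)] the possible [z] are [b + rad] and [b - rad]. Where [q < (y - a) ^+ 2] the square
   root has the default value 0; such points are excluded from [T]. *)
pose rad (t : R' * R') : R := Num.sqrt (t.2 - (t.1 - a) ^+ 2).
have mrad : measurable_fun setT rad.
  apply: (@measurableT_comp _ _ _ _ _ _ (@Num.sqrt R)).
    by apply: nondecreasing_measurable => // x y xy; exact: ler_wsqrtr.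
  apply: measurable_funB => //; apply: measurable_funX.
  by apply: measurable_funB.
pose T : set (R' * R') := [set t | ((t.1 - a) ^+ 2 <= t.2)%R] `&`
  ((fun t => (t.1, b + rad t)%R) @^-1` S `|` (fun t => (t.1, b - rad t)%R) @^-1` S).
have mT : measurable T.
  apply: measurableI.
    rewrite -[X in measurable X]setTI; apply: measurable_fun_le => //.
    by apply: measurable_funX; apply: measurable_funB.
  apply: measurableU; rewrite -[X in measurable X]setTI.
    have : measurable_fun setT (fun t : R' * R' => (t.1, b + rad t)%R : R' * R').
      by apply: measurable_fun_pair => //; apply: measurable_funD.
    exact.
  have : measurable_fun setT (fun t : R' * R' => (t.1, b - rad t)%R : R' * R').
    by apply: measurable_fun_pair => //; apply: measurable_funB.
  exact.
have ST y z : S (y, z) -> T (y, (z - b) ^+ 2 + (y - a) ^+ 2)%R.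
  move=> Syz; split => /=; first by rewrite lerDr sqr_ge0.
  rewrite /rad /= addrK sqrtr_sqr.
  have [zb|zb] := leP 0%R (z - b)%R; [left|right].
    by rewrite /= ger0_norm// addrC subrK.
  by rewrite /= ltr0_norm// opprK addrC subrK.
have TS y q : T (y, q) -> exists z,
    S (y, z) /\ ((y - a) ^+ 2 + (z - b) ^+ 2 = q)%R.
  move=> [/= qy]; have radE : (rad (y, q) ^+ 2 = q - (y - a) ^+ 2)%R.
    by rewrite /rad sqr_sqrtr//= subr_ge0.
  case=> Sz; [exists (b + rad (y, q))%R|exists (b - rad (y, q))%R]; split => //.
    by rewrite [(b + _)%R]addrC addrK radE addrC subrK.
  by rewrite [(b - _)%R]addrC addrK sqrrN radE addrC subrK.
have T0 : (leb \x leb) T = 0.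
  apply: product_null_ysection => // q.
  apply: countable_lebesgue_measure0; apply: finite_set_countable.
  have [[y0 Ty0]|noT] := pselect (exists y0, T (y0, q)); last first.
    rewrite (_ : ysection _ _ = set0); first exact: finite_set0.
    by apply/seteqP; split => // y /ysectionP Ty; case: noT; exists y.
  have [z0 [Sz0 q0]] := TS _ _ Ty0.
  pose k := ((2 * u * (u * (y0 - a) + v * (z0 - b)) / (u ^+ 2 + v ^+ 2) -
    (y0 - a)) + a)%R.
  have uv0 : (u ^+ 2 + v ^+ 2 != 0)%R.
    by rewrite paddr_eq0 ?sqr_ge0// !expf_eq0/= negb_and.
  apply: (@sub_finite_set _ _ [set y0; k]); last exact: finite_set2.
  move=> y /ysectionP Ty; have [z [Sz qz]] := TS _ _ Ty.
  have lin := hS _ _ _ _ Sz Sz0 (etrans qz (esym q0)).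
  have lin' : (u * (y - a) + v * (z - b) = u * (y0 - a) + v * (z0 - b))%R.
    have aux (s t : R) : (u * (s - a) + v * (t - b) =
        (u * s + v * t) - (u * a + v * b))%R by ring.
    by rewrite !aux lin.
  have [yy|yk] := line_circle_roots uv0 lin' (etrans qz (esym q0)); [left|right].
    by apply: (addIr (- a)%R).
  by apply: (addIr (- a)%R); rewrite yk addrK.
(* Now the other order of integration: almost every section of [T] at fixed [y] is null, and the
   section of [S] is contained in its preimage under a parabola. *)
apply/product_null_xsection => //.
move/product_null_xsection : T0 => /(_ mT); apply: filterS => y Ty.
apply/eqP; rewrite eq_le outer_measure_ge0 andbT.
rewrite -(sqr_preimage_null b ((y - a) ^+ 2)%R Ty); apply: le_outer_measure.
by move=> z /xsectionP Syz /=; apply/xsectionP; exact: ST.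
Qed.

End CircleSections.

(** * Sets whose part on each sphere lies in a hyperplane *)

Section SphereSections.
Context {R : realType}.
Local Notation leb := (@lebesgue_measure R).
Local Notation R' := (measurableTypeR R).

Lemma cons_rV0 d (q : R' * 'rV[R]_d) : cons_rV q ord0 ord0 = q.1.
Proof. by have := congr1 fst (cons_rVK q). Qed.

Lemma cons_rVS d (q : R' * 'rV[R]_d) i : cons_rV q ord0 (lift ord0 i) = q.2 ord0 i.
Proof.
rewrite (_ : lift ord0 i = rshift 1 i); last exact: val_inj.
by rewrite /cons_rV row_mxEr.
Qed.

Lemma sum_cons_rV d (f : R -> 'I_(1 + d) -> R) (q : R' * 'rV[R]_d) :
  (\sum_(i < 1 + d) f (cons_rV q ord0 i) i =
   f q.1 ord0 + \sum_(i < d) f (q.2 ord0 i) (lift ord0 i))%R.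
Proof.
rewrite big_ord_recl cons_rV0; congr (_ + _)%R.
by apply: eq_bigr => i _; rewrite cons_rVS.
Qed.

Definition line_on_spheres d (a v : 'rV[R]_d) (S : set 'rV[R]_d) :=
  forall x y, S x -> S y ->
  (\sum_(i < d) (x ord0 i - a ord0 i) ^+ 2 =
   \sum_(i < d) (y ord0 i - a ord0 i) ^+ 2)%R ->
  (\sum_(i < d) x ord0 i * v ord0 i = \sum_(i < d) y ord0 i * v ord0 i)%R.

(** While the first two entries of [v] vanish, induction drops the first coordinate. Otherwise all
    coordinates but the first two are frozen and the planar lemma applies. In dimension 1 the claim
    fails for a half-line starting at [a], which meets each sphere in at most one point. *)
Lemma line_on_spheres_null d (a v : 'rV[R]_d) (S : set 'rV[R]_d) :
  measurable S -> (2 <= d)%N -> v != 0%R -> line_on_spheres a v S ->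
  lebesgue_rV S = 0.
Proof.
elim: d a v S => [//|d IH] a v S mS d2 v0 hS.
case: d => [//|d] in IH a v S mS d2 v0 hS *.
have [m mE] := @lebesgue_rV_measure R d.
have [m1 m1E] := @lebesgue_rV_measure R d.+1.
have preim n (B : set 'rV[R]_(1 + n)) :
    measurable B -> measurable (@cons_rV R n @^-1` B).
  by move=> mB; rewrite -[X in measurable X]setTI; exact: measurable_cons_rV.
have -> : lebesgue_rV S = (leb \x m1) (@cons_rV R d.+1 @^-1` S).
  by rewrite -m1E.
pose i0 : 'I_d.+2 := ord0; pose i1 : 'I_d.+2 := lift ord0 ord0.
have [v01|/norP[]] := boolP ((v ord0 i0 != 0%R) || (v ord0 i1 != 0%R)); last first.
  move=> /negPn/eqP v0E /negPn/eqP v1E.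
  (* A nonzero [v] whose first two entries vanish has a third one, so the dimension stays at least 2
     after one coordinate is dropped. *)
  have d_gt0 : (2 <= d.+1)%N.
    rewrite ltnS lt0n; apply: contraNneq v0 => d0; apply/eqP/rowP => i.
    rewrite mxE; case: (unliftP ord0 i) => [j ->|->//].
    by rewrite (_ : j = ord0)//; apply: val_inj => /=; case: j => -[|j]//=; rewrite d0.
  apply/product_null_xsection; first exact: preim.
  apply: nearW => y; rewrite -m1E.
  apply: (IH (rsubmx (a : 'rV_(1 + d.+1))) (rsubmx (v : 'rV_(1 + d.+1)))) => //.
  - by apply: measurable_xsection; exact: (preim d.+1 S mS).
  - apply: contra v0 => /eqP /rowP v'0; apply/eqP/rowP => i; rewrite mxE.
    case: (unliftP ord0 i) => [j ->|->//].
    have := v'0 j; rewrite !mxE => <-; congr (v _ _); exact: val_inj.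
  - move=> x x' /xsectionP Sx /xsectionP Sx' dist.
    have E i : rshift 1 i = lift ord0 i :> 'I_(1 + d.+1) by exact: val_inj.
    have := hS _ _ Sx Sx'.
    rewrite !(@sum_cons_rV d.+1 (fun t i => (t - a ord0 i) ^+ 2)%R).
    rewrite !(@sum_cons_rV d.+1 (fun t i => t * v ord0 i)%R) /= v0E !mulr0 !add0r.
    have F (z : 'rV[R]_d.+1) (f : R -> R -> R) (b : 'rV[R]_(1 + d.+1)) :
        (\sum_(i < d.+1) f (z ord0 i) (b ord0 (lift ord0 i)) =
         \sum_(i < d.+1) f (z ord0 i) (rsubmx b ord0 i))%R.
      by apply: eq_bigr => i _; rewrite mxE E.
    rewrite !(F _ (fun s t => (s - t) ^+ 2)%R) !(F _ (fun s t => s * t)%R).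
    by rewrite dist; apply.
pose C y : set (R' * 'rV[R]_d) :=
  [set t | S (cons_rV (y, cons_rV t))].
(* The coordinates are regrouped so that the second one is integrated innermost; Tonelli can then
   exchange the first with the remaining ones. *)
pose B : set ((R' * 'rV[R]_d) * R') :=
  [set t | S (cons_rV (t.1.1, cons_rV (t.2, t.1.2)))].
have mB : measurable B.
  have : measurable_fun setT (fun t : (R' * 'rV[R]_d) * R' =>
      cons_rV (t.1.1, cons_rV (t.2, t.1.2))).
    apply: measurableT_comp; first exact: measurable_cons_rV.
    apply: measurable_fun_pair.
      exact: measurableT_comp measurable_fst measurable_fst.
    apply: measurableT_comp; first exact: measurable_cons_rV.
    apply: measurable_fun_pair => //.
    exact: measurableT_comp measurable_snd measurable_fst.
  by move=> mc; rewrite -[X in measurable X]setTI; exact: mc.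
have mC y : measurable (C y).
  have : measurable_fun setT (fun t : R' * 'rV[R]_d => cons_rV (y, cons_rV t)).
    apply: measurableT_comp; first exact: measurable_cons_rV.
    by apply: measurable_fun_pair => //; exact: measurable_cons_rV.
  by move=> mc; rewrite -[X in measurable X]setTI; exact: mc.
pose f (t : R' * 'rV[R]_d) : \bar R := leb (xsection B t).
have mf : measurable_fun setT f by apply: (@measurable_fun_xsection _ _ _ _ R leb B mB).
have f0 t : 0 <= f t by exact: measure_ge0.
have lift_prod y : m1 (xsection (@cons_rV R d.+1 @^-1` S) y) = \int[m]_x f (y, x).
  rewrite -m1E /= mE (@product_measure_unique _ _ _ _ _ _ _ (leb \x^ m))//; last 2 first.
  - by move=> A A' mA mA'; exact: product_measure2E.
  - rewrite [X in measurable X](_ : _ = C y)//.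
    by apply/seteqP; split => t; rewrite /C /=;
      [move=> /xsectionP|move=> St; apply/xsectionP].
  apply: eq_integral => x _; rewrite /f /=; congr (leb _).
  apply/seteqP; split => z.
    by move=> /ysectionP /= /xsectionP Sz; apply/xsectionP.
  by move=> /xsectionP Sz; apply/ysectionP => /=; apply/xsectionP.
transitivity (\int[leb]_y \int[m]_x f (y, x)).
  by apply: eq_integral => y _; exact: lift_prod.
rewrite fubini_tonelli//; apply: integral0_eq => x _.
pose A : set (R' * R') := [set t | S (cons_rV (t.1, cons_rV (t.2, x)))].
have mA : measurable A.
  have : measurable_fun setT (fun t : R' * R' =>
      cons_rV (t.1, cons_rV (t.2, x))).
    apply: measurableT_comp; first exact: measurable_cons_rV.
    apply: measurable_fun_pair => //.
    apply: measurableT_comp; first exact: measurable_cons_rV.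
    exact: measurable_fun_pair.
  by move=> mc; rewrite -[X in measurable X]setTI; exact: mc.
transitivity ((leb \x leb) A).
  apply: eq_integral => y _; apply: (congr1 leb).
  by apply/seteqP; split => z /xsectionP ?; apply/xsectionP.
apply: (@circle_sections_null R (a ord0 i0) (a ord0 i1) (v ord0 i0) (v ord0 i1)) => //.
move=> y z y' z' Ayz Ayz' dist; have := hS _ _ Ayz Ayz'.
rewrite !(@sum_cons_rV d.+1 (fun t i => (t - a ord0 i) ^+ 2)%R).
rewrite !(@sum_cons_rV d.+1 (fun t i => t * v ord0 i)%R) /=.
rewrite !(@sum_cons_rV d (fun t i => (t - a ord0 (lift ord0 i)) ^+ 2)%R).
rewrite !(@sum_cons_rV d (fun t i => t * v ord0 (lift ord0 i))%R) /= !addrA.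
rewrite -/i0 -/i1 dist => /(_ erefl) /addIr.
by rewrite !(mulrC (v _ _)).
Qed.

End SphereSections.

(** * Measurability of the cells and their null overlaps *)

Section RadialCost.
Context {R : realType} {d : nat}.
Variables (Omega : set 'rV[R]_d) (c : 'rV[R]_d -> 'rV[R]_d -> \bar R).
Hypothesis mOmega : measurable Omega.
Hypothesis radial_c : radial_cost Omega c.

Lemma eucl_dist_ge0 (x y : 'rV[R]_d) : (0 <= eucl_dist x y)%R.
Proof. exact: sqrtr_ge0. Qed.

Lemma sqr_eucl_dist (x y : 'rV[R]_d) :
  (eucl_dist x y ^+ 2 = \sum_(i < d) (x ord0 i - y ord0 i) ^+ 2)%R.
Proof. by rewrite sqr_sqrtr// sumr_ge0// => i _; exact: sqr_ge0. Qed.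

Lemma measurable_cost :
  measurable_fun (Omega `*` Omega) (fun q : 'rV[R]_d * 'rV[R]_d => c q.1 q.2).
Proof.
have [l [_ lnd _ _] cE] := radial_c.
(* The profile is monotone on nonnegative arguments only; truncating at 0 makes it monotone on the
   whole line without changing the cost. *)
pose f (q : 'rV[R]_d * 'rV[R]_d) := l (Num.max (eucl_dist q.1 q.2) 0%R).
apply: (eq_measurable_fun f).
  move=> q; rewrite inE => -[q1 q2]; rewrite /f cE//.
  by rewrite max_l// eucl_dist_ge0.
apply: measurable_funTS.
apply: (@measurableT_comp _ _ _ _ _ _ (fun r : R => l (Num.max r 0%R))).
  apply: emeasurable_nondecreasing => r s rs; apply: lnd.
  by rewrite le_max lexx orbT/= ge_max !le_max rs lexx orbT.
exact: measurable_eucl_dist.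
Qed.

Lemma measurable_cost_to y : Omega y -> measurable_fun Omega (c^~ y).
Proof.
move=> Oy mO A mA.
have mh : measurable_fun setT (fun x : 'rV[R]_d => (x, y)).
  by apply: measurable_fun_pair => //; exact: measurable_cst.
have := measurable_cost (measurableX mOmega mOmega) mA.
move/mh => /(_ measurableT); rewrite setTI; congr (measurable _).
by apply/seteqP; split => x /=; [move=> [[]]|move=> []].
Qed.

Section cells.
Context {M : nat}.
Variables (p : 'I_M -> 'rV[R]_d).
Hypothesis Omega_p : forall i, Omega (p i).

Lemma measurable_laguerre_cell (w : 'rV[R]_M) i :
  measurable (laguerre_cell Omega c p w i).
Proof.
have mc j := measurable_cost_to (Omega_p j).
have -> : laguerre_cell Omega c p w i =
    (Omega `&` [set x | c x (p i) < +oo]) `&`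
    \bigcap_(j in [set: 'I_M]) (Omega `&`
      [set x | c x (p i) - (w ord0 i)%:E <= c x (p j) - (w ord0 j)%:E]).
  apply/seteqP; split => [x [Ox cx h]|x [[Ox cx] h]].
    by split => // j _; split => //; exact: h.
  by split => // j; have [] := h j I.
apply: measurableI; first exact: emeasurable_fun_infty_o.
apply: fin_bigcap_measurable => // j _.
by apply: measurable_lee => //; exact: emeasurable_funB.
Qed.

Lemma measurable_residual_set : measurable (residual_set Omega c p).
Proof.
have mc j := measurable_cost_to (Omega_p j).
have -> : residual_set Omega c p = Omega `&`
    \bigcap_(j in [set: 'I_M]) (Omega `&` [set x | +oo <= c x (p j)]).
  apply/seteqP; split => [x [Ox h]|x [Ox h]]; split => // j.
    by move=> _; split => //=; rewrite h.
  by have [_] := h j I; rewrite /= leye_eq => /eqP.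
apply: measurableI => //; apply: fin_bigcap_measurable => // j _.
exact: emeasurable_fun_c_infty.
Qed.

(** On the overlap the costs to [p i] and [p j] differ by a constant. Two of its points at equal
    distance from [p i] thus have equal finite cost to [p j], and by strict monotonicity equal
    distance to it. The difference of the two squared distances is affine with gradient along
    [p i - p j], so both points lie on one hyperplane. *)
Lemma null_overlaps_of_radial (mu : {finite_measure set 'rV[R]_d -> \bar R}) :
  mu `<< @lebesgue_rV R d -> injective p ->
  (d = 1%N -> null_overlaps Omega c p mu) -> null_overlaps Omega c p mu.
Proof.
move=> mu_leb p_inj d1 w i j ij.
have [l [l0 lnd linc _] cE] := radial_c.
set S := _ `&` _.
have mS : measurable S by apply: measurableI; exact: measurable_laguerre_cell.
have [|d_gt1] := leqP d 1.
  rewrite leq_eqVlt => /predU1P[/d1|d0]; first exact.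
  (* In dimension 0 all points coincide, against [i != j] and injectivity. *)
  exfalso; move/eqP: ij; apply; apply: p_inj; apply/rowP => k.
  by have := ltn_ord k; rewrite ltnNge (leq_trans _ (leq0n _))//.
have [m mE] := @lebesgue_rV_measure R d.
rewrite mE in mu_leb; move/null_content_dominatesP : mu_leb; apply => //.
suff : lebesgue_rV S = 0 by rewrite mE.
apply: (@line_on_spheres_null _ _ (p i) (p i - p j)%R) => //.
  by rewrite subr_eq0; apply: contraNneq ij => /p_inj ->.
move=> x y Sx Sy distE.
have dist_i : eucl_dist x (p i) = eucl_dist y (p i).
  by rewrite /eucl_dist distE.
have potE z : S z -> exists2 r, c z (p i) = r%:E &
    c z (p j) = (r - w ord0 i + w ord0 j)%:E.
  move=> [[Oz ci hi] [_ cj hj]].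
  have := cE z (p i) Oz (Omega_p i); have := cE z (p j) Oz (Omega_p j).
  have l_ge0 k : (0 <= l (eucl_dist z (p k))).
    by rewrite -l0; apply: lnd; rewrite lexx eucl_dist_ge0.
  move: (l_ge0 i) (l_ge0 j); rewrite -!cE//.
  move: ci cj (hi j) (hj i); case: (c z (p i)) => [r| |]//; case: (c z (p j)) => [s| |]//.
  rewrite -!EFinB !lee_fin => _ _ h1 h2 _ _ _ _; exists r => //; congr EFin; lra.
have dist_j : eucl_dist x (p j) = eucl_dist y (p j).
  have [rx rxE sxE] := potE x Sx; have [ry ryE syE] := potE y Sy.
  have [[Ox _ _] _] := Sx; have [[Oy _ _] _] := Sy.
  have rr : rx = ry by apply: EFin_inj; rewrite -rxE -ryE !cE// dist_i.
  have ll : l (eucl_dist x (p j)) = l (eucl_dist y (p j)).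
    by rewrite -!cE// sxE syE rr.
  have fin : l (eucl_dist x (p j)) < +oo by rewrite -cE// sxE ltry.
  have [xy|xy|//] := ltgtP (eucl_dist x (p j)) (eucl_dist y (p j)).
  - have : l (eucl_dist x (p j)) < l (eucl_dist y (p j)).
      by apply: linc => //; split; rewrite ?eucl_dist_ge0// -ll.
    by rewrite ll ltxx.
  - have : l (eucl_dist y (p j)) < l (eucl_dist x (p j)).
      by apply: linc => //; split; rewrite ?eucl_dist_ge0// -ll.
    by rewrite ll ltxx.
have := congr1 (fun r => r ^+ 2)%R dist_i; have := congr1 (fun r => r ^+ 2)%R dist_j.
rewrite !sqr_eucl_dist => ej ei.
have lin (z : 'rV[R]_d) : (\sum_(k < d) z ord0 k * (p i - p j)%R ord0 k =
   (\sum_(k < d) (z ord0 k - p j ord0 k) ^+ 2 - \sum_(k < d) (z ord0 k - p i ord0 k) ^+ 2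
   + \sum_(k < d) (p i ord0 k ^+ 2 - p j ord0 k ^+ 2)) / 2)%R.
  rewrite -sumrB -big_split/= mulr_suml; apply: eq_bigr => k _.
  by rewrite !mxE; field.
by rewrite !lin ei ej.
Qed.

End cells.
End RadialCost.

(** * The potential of a weight vector *)

Section Potential.
Context {R : realType} {d M : nat}.
Variables (Omega : set 'rV[R]_d) (c : 'rV[R]_d -> 'rV[R]_d -> \bar R).
Variables (p : 'I_M -> 'rV[R]_d).
Hypothesis mOmega : measurable Omega.
Hypothesis radial_c : radial_cost Omega c.
Hypothesis c_ge0 : forall x y, Omega x -> Omega y -> 0 <= c x y.
Hypothesis Omega_p : forall i, Omega (p i).
Implicit Types (w : 'rV[R]_M) (x : 'rV[R]_d).

(* The maximum over i of w_i - c(x, x_i); it equals [cell_potential] on every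
   cell, and -oo on the residual set, where [potential] is the junk value 0. *)
Definition epotential (w : 'rV[R]_M) (x : 'rV[R]_d) : \bar R :=
  \big[maxe/-oo]_(i < M) ((w ord0 i)%:E - c x (p i)).

Definition potential w x : R := fine (epotential w x).

Definition reached := Omega `\` residual_set Omega c p.

Lemma measurable_reached : measurable reached.
Proof. by apply: measurableD => //; exact: measurable_residual_set. Qed.

Lemma measurable_potential w : measurable_fun Omega (potential w).
Proof.
apply: (@measurableT_comp _ _ _ _ _ _ (@fine R)) => //.
rewrite /epotential; elim: (index_enum 'I_M) => [|i s ih].
  by apply: (eq_measurable_fun (cst -oo)) => // x _; rewrite big_nil.
apply: (eq_measurable_fun (fun x => maxe ((w ord0 i)%:E - c x (p i))
    (\big[maxe/-oo]_(j <- s) ((w ord0 j)%:E - c x (p j))))).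
  by move=> x _; rewrite big_cons.
apply: measurable_maxe => //; apply: emeasurable_funB => //.
exact: measurable_cost_to.
Qed.

Lemma cell_fin_num w i x : laguerre_cell Omega c p w i x -> c x (p i) \is a fin_num.
Proof. by case=> Ox cx _; rewrite ge0_fin_numE// c_ge0. Qed.

Lemma cell_subset_reached w i : laguerre_cell Omega c p w i `<=` reached.
Proof. by move=> x [Ox cx _]; split => // -[_ /(_ i) cy]; rewrite cy in cx. Qed.

Lemma epotential_ge w x i : (w ord0 i)%:E - c x (p i) <= epotential w x.
Proof. exact: (le_bigmax _ (fun i => (w ord0 i)%:E - c x (p i))). Qed.

Lemma potential_cell w i x : laguerre_cell Omega c p w i x ->
  potential w x = cell_potential c p w i x.
Proof.
move=> Cx; have [Ox cx hx] := Cx.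
have cf := cell_fin_num Cx.
rewrite /potential (_ : epotential w x = (cell_potential c p w i x)%:E)//.
rewrite /cell_potential addrC EFinD EFinN fineK//.
apply/eqP; rewrite eq_le epotential_ge andbT.
apply/bigmax_leP; split; first by rewrite leNye.
move=> j _; have := hx j; have := c_ge0 Ox (Omega_p j).
rewrite -(fineK cf); case: (c x (p j)) => [r|_ _|//]; last by rewrite addeNy leNye.
by rewrite -!EFinB !lee_fin => _ h; lra.
Qed.

Lemma reached_cell w x : reached x -> exists i, laguerre_cell Omega c p w i x.
Proof.
move=> [Ox nRx].
have [i0 ci0] : exists i, c x (p i) < +oo.
  apply: contrapT => h; apply: nRx; split => // i.
  by apply/eqP; rewrite -leye_eq leNgt; apply/negP => ?; apply: h; exists i.
have [i _ Hi] := @eq_bigmax _ _ _ -oo i0 predT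
  (fun i => (w ord0 i)%:E - c x (p i)) isT (fun i _ => leNye _).
have i0i : (w ord0 i0)%:E - c x (p i0) <= (w ord0 i)%:E - c x (p i).
  by rewrite -Hi; exact: (le_bigmax_cond _ (fun i => (w ord0 i)%:E - c x (p i))).
have fin_i : c x (p i) < +oo.
  move: i0i ci0; have := c_ge0 Ox (Omega_p i0).
  by case: (c x (p i0)) => [r| |]//; case: (c x (p i)) => [s| |]// *; rewrite ltry.
exists i; split => // j.
have ji : (w ord0 j)%:E - c x (p j) <= (w ord0 i)%:E - c x (p i).
  by rewrite -Hi; exact: (le_bigmax_cond _ (fun i => (w ord0 i)%:E - c x (p i))).
move: ji fin_i; have := c_ge0 Ox (Omega_p i); have := c_ge0 Ox (Omega_p j).
case: (c x (p i)) => [r| |]//; case: (c x (p j)) => [s| |]//.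
  by rewrite -!EFinB !lee_fin => *; lra.
by move=> *; rewrite addye// leey.
Qed.

(** On the residual set the cost is +oo, so the default value of [potential] does no harm. *)
Lemma cost_gap_ge0 w i x : Omega x ->
  0 <= c x (p i) + (potential w x - w ord0 i)%:E.
Proof.
move=> Ox.
have [Rx|nRx] := pselect (residual_set Omega c p x).
  by rewrite (Rx.2 i) addye.
have [j Cj] := reached_cell w (conj Ox nRx).
rewrite (potential_cell Cj) /cell_potential.
have [_ _ /(_ i)] := Cj; rewrite -(fineK (cell_fin_num Cj)).
have := c_ge0 Ox (Omega_p i); case: (c x (p i)) => [r| |]//=.
by rewrite -!EFinB -EFinD !lee_fin => _ h; lra.
Qed.

Lemma cost_gap_eq0 w i x : Omega x ->
  c x (p i) + (potential w x - w ord0 i)%:E = 0 <-> laguerre_cell Omega c p w i x.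
Proof.
move=> Ox; split => [gap0|Ci]; last first.
  rewrite (potential_cell Ci) /cell_potential -{1}(fineK (cell_fin_num Ci)).
  by rewrite -EFinD; congr EFin; lra.
have [Rx|nRx] := pselect (residual_set Omega c p x).
  by move: gap0; rewrite (Rx.2 i) addye.
have cE : c x (p i) = (w ord0 i - potential w x)%:E.
  move: gap0; have := c_ge0 Ox (Omega_p i); case: (c x (p i)) => [r| |]//= _.
  by move=> [] h; congr EFin; lra.
split; rewrite ?cE ?ltry// => j.
have := cost_gap_ge0 w j Ox; have := c_ge0 Ox (Omega_p j).
case: (c x (p j)) => [r|_ _|//]; last by rewrite addye// leey.
by rewrite -!EFinD !lee_fin => _ h; lra.
Qed.

(** [0 <= K] covers the residual set, where [potential] has the default value 0. *)
Lemma potential_le w (K : R) x : (forall i, w ord0 i <= K)%R -> (0 <= K)%R ->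
  Omega x -> (potential w x <= K)%R.
Proof.
move=> wK K0 Ox.
have [Rx|nRx] := pselect (residual_set Omega c p x).
  rewrite /potential /epotential big1_idem ?maxxx//.
  by move=> i _; rewrite Rx.2 addeNy.
have [j Cj] := reached_cell w (conj Ox nRx).
rewrite (potential_cell Cj) /cell_potential.
have := c_ge0 Ox (Omega_p j); rewrite -(fineK (cell_fin_num Cj)) lee_fin.
by have := wK j; lra.
Qed.

End Potential.

(** * Bookkeeping with infinite values *)

Section LedgerOfExtendedReals.
Context {R : realType}.

(* The cost, entropy and gap terms are moved between the two sides of the
   identities so that no oo - oo occurs, at the price of the auxiliary terms
   [Ik] and [a1], ..., [a4], which cancel in [primal - dual = g1 + g2 + g3]. *)
Lemma ledger (Ec Ik g1 g2 g3 Phi0 Phi1 Phi2 A : \bar R) (a1 a2 a3 a4 b : R) :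
  0 <= Ec -> 0 <= Ik -> 0 <= g1 -> 0 <= g2 -> 0 <= g3 -> 0 <= Phi0 ->
  0 <= Phi1 -> 0 <= Phi2 -> 0 <= A ->
  Ec + a1%:E = g1 + Ik -> Phi1 + Ik + a2%:E = g2 + a3%:E + A ->
  Phi2 + a4%:E = g3 -> (a1 + a4 = a3 + b)%R ->
  let primal := Ec + (Phi1 + Phi0) + Phi2 in
  let dual := A - (a2 + b)%:E + Phi0 in
  [/\ dual <= primal,
      primal < +oo -> primal <= dual -> [/\ g1 = 0, g2 = 0 & g3 = 0] &
      g1 = 0 -> g2 = 0 -> g3 = 0 -> primal <= dual].
Proof.
move=> Ec0 Ik0 g10 g20 g30 Phi00 Phi10 Phi20 A0 e1 e2 e3 e4; cbv zeta.
set primal := Ec + _ + _; set dual := A - _ + _.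
(* A finite primal value makes [Ec] and the three [Phi] finite, and the identities pass finiteness
   on to all other terms; linear arithmetic remains. *)
have fin : primal < +oo -> (dual <= primal) /\
    (primal <= dual -> [/\ g1 = 0, g2 = 0 & g3 = 0]).
  rewrite {}/primal {}/dual.
  move: Ec0 Phi10 Phi00 Phi20 e1 e2 e3.
  case: Ec => [ec| |]//; case: Phi1 => [f1| |]//; case: Phi0 => [f0| |]//;
    case: Phi2 => [f2| |]// ; try by move=> ? ? ? ? ? ? ?; rewrite /= ltxx.
  move=> _ _ _ _.
  move: g10 Ik0; case: g1 => [h1| |]//; case: Ik => [ik| |]// g10 Ik0 //.
  case=> e1.
  move: g20 A0; case: g2 => [h2| |]//; case: A => [a| |]// g20 A0 //.
  case=> e2.
  move: g30; case: g3 => [h3| |]// g30; case=> e3 _.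
  rewrite !lee_fin in g10 g20 g30.
  rewrite -?EFinB -?EFinD !lee_fin; split; first lra.
  by move=> h; split; congr EFin; lra.
split.
- have [/eqP|] := eqVneq primal +oo; first by move=> /eqP ->; rewrite leey.
  by rewrite -ltey => /fin[].
- by move=> /fin[].
(* Infinite values are allowed here. If [A] or [Phi0] is +oo, so is the dual value; otherwise the
   identities with zero gaps make every term finite. *)
- move=> z1 z2 z3; clear fin; rewrite {}/primal {}/dual; move: e1 e2 e3; rewrite z1 z2 z3.
  move: A0 Phi00; case: A => [a| |]//; case: Phi0 => [f0| |]//;
    try by move=> *; rewrite leey.
  move=> _ _.
  move: Phi10 Ik0; case: Phi1 => [f1| |]//; case: Ik => [ik| |]// _ _ //.
  move: Ec0; case: Ec => [ec| |]// _; case=> e1; case=> e2.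
  move: Phi20; case: Phi2 => [f2| |]// _; case=> e3.
  by rewrite -?EFinB -?EFinD lee_fin; lra.
Qed.

End LedgerOfExtendedReals.

(** * Integrals over almost-partitions *)

Section IntegralLemmas.
Context disp (T : measurableType disp) (R : realType).
Variable mu : {finite_measure set T -> \bar R}.

(** If [f] has infinite integral, both sides are -oo, because the positive part of [K - f] is
    bounded by [|K|]. *)
Lemma integral_cstB (D : set T) (f : T -> R) (K : R) : measurable D ->
  measurable_fun D f -> (forall x, D x -> (0 <= f x)%R) ->
  \int[mu]_(x in D) (K - f x)%:E =
  (K * fine (mu D))%:E - \int[mu]_(x in D) (f x)%:E.
Proof.
move=> mD mf f0.
have muD : mu D \is a fin_num by exact: fin_num_measure.
have intK : mu.-integrable D (EFin \o cst K).
  exact: finite_measure_integrable_cst.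
have KE : \int[mu]_(x in D) K%:E = (K * fine (mu D))%:E.
  by rewrite integral_cst// EFinM fineK.
have mEf : measurable_fun D (EFin \o f) by exact/measurable_EFinP.
have [foo|] := ltP (\int[mu]_(x in D) (f x)%:E) +oo.
  have intf : mu.-integrable D (EFin \o f).
    apply/integrableP; split => //.
    under eq_integral => x xD.
      rewrite /= ger0_norm; last by apply: f0; rewrite inE in xD.
      over.
    by [].
  by rewrite (integralB_EFin mD intK intf) KE.
rewrite leye_eq => /eqP foo; rewrite foo.
pose q x := (K - f x)%:E.
have mq : measurable_fun D q by apply/measurable_EFinP; exact: measurable_funB.
have mqp : measurable_fun D (q^\+) by exact: measurable_funepos.
have mqn : measurable_fun D (q^\-) by exact: measurable_funeneg.
rewrite integralE.
have -> : \int[mu]_(x in D) ((fun x => (K - f x)%:E)^\- x) = +oo.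
  apply/eqP; rewrite -leye_eq.
  have : +oo <= \int[mu]_(x in D) ((fun x => (K - f x)%:E)^\- x) + `|K|%:E * mu D.
    rewrite -(@integral_cst _ _ _ mu D mD) -ge0_integralD//; last first.
      by move=> x _; rewrite lee_fin.
    rewrite -foo; apply: ge0_le_integral => //.
    - exact: emeasurable_funD.
    - move=> x Dx; rewrite funenegE /= -EFin_max -EFinD lee_fin.
      have := ler_norm K; have : (- (K - f x) <= Num.max (- (K - f x)) 0)%R.
        by rewrite le_max lexx.
      lra.
  by rewrite -(fineK muD) -EFinM -leeBlDr.
have : \int[mu]_(x in D) ((fun x => (K - f x)%:E)^\+ x) <= `|K|%:E * mu D.
  rewrite -(@integral_cst _ _ _ mu D mD); apply: ge0_le_integral => //.
    move=> x Dx; rewrite funeposE /= -EFin_max lee_fin ge_max normr_ge0 andbT.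
    have := f0 x Dx; have := ler_norm K; lra.
rewrite -(fineK muD) -EFinM.
by case: (integral _ _ _) => [r| |]//.
Qed.

Section almost_partition.
Context (M : nat) (C : 'I_M -> set T) (D : set T).
Hypotheses (mD : measurable D) (mC : forall i, measurable (C i)).
Hypothesis CD : forall i, C i `<=` D.
Hypothesis coverD : mu (D `\` \bigcup_i C i) = 0.
Hypothesis overlap0 : forall i j, i != j -> mu (C i `&` C j) = 0.

Lemma ae_unique_cell :
  {ae mu, forall x, forall i j, C i x -> C j x -> i = j}.
Proof.
apply: filter_forall => i; apply: filter_forall => j.
have [->|ij] := eqVneq i j; first exact: nearW.
exists (C i `&` C j); split; [exact: measurableI|exact: overlap0|].
by move=> x /= h; apply: contrapT => nC; apply: h => Ci Cj; exfalso; apply: nC.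
Qed.

(** Serves three families: the cells under [mu], the slices under a plan and the atoms under
    [nu]. *)
Lemma integral_almost_partition (g : T -> \bar R) :
  measurable_fun D g -> (forall x, D x -> 0 <= g x) ->
  \sum_(i < M) \int[mu]_(x in C i) g x = \int[mu]_(x in D) g x.
Proof.
move=> mg g0.
have gC0 i x : D x -> 0 <= (g \_ (C i)) x.
  by rewrite patchE; case: ifPn => // _; exact: g0.
have mgC i : measurable_fun D (g \_ (C i)).
  apply/(measurable_restrict _ (mC i) mD).
  by apply: (measurable_funS mD _ mg); exact: subIsetl.
under eq_bigr => i _.
  rewrite -(setIidr (@CD i)) integral_mkcondr.
  over.
rewrite -ge0_integral_sum//.
apply: ge0_ae_eq_integral => //.
- exact: emeasurable_sum.
- by move=> x Dx; apply: sume_ge0 => i _; exact: gC0.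
- have covered : {ae mu, forall x, D x -> exists i, C i x}.
    exists (D `\` \bigcup_i C i); split => //.
      by apply: measurableD => //; exact: fin_bigcup_measurable.
    move=> x /= nx; apply: contrapT => h; apply: nx => Dx.
    by apply: contrapT => nC; apply: h; split => // -[i _ Ci]; apply: nC; exists i.
  move: covered ae_unique_cell; apply: filterS2 => x cover_x uniq_x Dx.
  have [i Ci] := cover_x Dx.
  rewrite (bigD1 i)//= big1 => [|j ji]; first by rewrite adde0 patchE mem_set.
  rewrite patchE memNset// => Cj; move/eqP: ji; apply; exact: uniq_x.
Qed.

Lemma measure_almost_partition : \sum_(i < M) mu (C i) = mu D.
Proof.
rewrite -[RHS]mul1e -(@integral_cst _ _ _ mu _ mD 1).
rewrite -(@integral_almost_partition (cst 1))//.
by apply: eq_bigr => i _; rewrite integral_cst// mul1e.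
Qed.

End almost_partition.
End IntegralLemmas.

(** * The dual objective as a single integral *)

Section DualFormula.
Context {R : realType} {d M : nat}.
Variables (Omega : set 'rV[R]_d) (c : 'rV[R]_d -> 'rV[R]_d -> \bar R).
Variables (p : 'I_M -> 'rV[R]_d) (F : R -> \bar R).
Variables (mu : {finite_measure set 'rV[R]_d -> \bar R}) (m : 'I_M -> R).
Hypothesis mOmega : measurable Omega.
Hypothesis radial_c : radial_cost Omega c.
Hypothesis c_ge0 : forall x y, Omega x -> Omega y -> 0 <= c x y.
Hypothesis Omega_p : forall i, Omega (p i).
Hypothesis overlaps : null_overlaps Omega c p mu.
Hypothesis hF : entropy_function F.

Local Notation cell := (laguerre_cell Omega c p).
Local Notation reached := (reached Omega c p).
Local Notation pot := (potential c p).
Local Notation Fs := (rconjugate F).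

Lemma measurable_rconjugate (D : set R) : measurable D -> measurable_fun D Fs.
Proof. by move=> mD; apply: nondecreasing_measurable => //; exact: rconjugate_nd. Qed.

Lemma reached_sub : reached `<=` Omega.
Proof. by move=> x []. Qed.

Lemma measurable_potential_reached w : measurable_fun reached (pot w).
Proof.
apply: (measurable_funS mOmega reached_sub).
exact: measurable_potential.
Qed.

Lemma measurable_rconjugate_potential w :
  measurable_fun reached (Fs \o pot w).
Proof.
apply: (@measurable_comp _ _ _ _ _ _ setT) => //.
  exact: measurable_rconjugate.
exact: measurable_potential_reached.
Qed.

Lemma cells_cover w : reached `\` \bigcup_i cell w i = set0.
Proof.
apply/seteqP; split => // x [rx]; apply.
by have [i Ci] := reached_cell c_ge0 Omega_p w rx; exists i.
Qed.

Lemma integral_cells w (g : 'rV[R]_d -> \bar R) :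
  measurable_fun reached g -> (forall x, reached x -> 0 <= g x) ->
  \sum_(i < M) \int[mu]_(x in cell w i) g x = \int[mu]_(x in reached) g x.
Proof.
move=> mg g0; apply: integral_almost_partition => //.
- exact: measurable_reached.
- by move=> i; exact: measurable_laguerre_cell.
- by move=> i; exact: cell_subset_reached.
- by rewrite cells_cover measure0.
- by move=> i j ij; exact: overlaps.
Qed.

Lemma measure_cells w : \sum_(i < M) mu (cell w i) = mu reached.
Proof.
apply: measure_almost_partition => //.
- exact: measurable_reached.
- by move=> i; exact: measurable_laguerre_cell.
- by move=> i; exact: cell_subset_reached.
- by rewrite cells_cover measure0.
- by move=> i j ij; exact: overlaps.
Qed.

Lemma integral_cell_conjugate w (K : R) i :
  (forall x, reached x -> (Fs (pot w x) <= K)%R) ->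
  \int[mu]_(x in cell w i) conjugate F (cell_potential c p w i x) =
  (K * fine (mu (cell w i)))%:E -
  \int[mu]_(x in cell w i) (K - Fs (pot w x))%:E.
Proof.
move=> FK; have mC : measurable (cell w i) by exact: measurable_laguerre_cell.
have CD := @cell_subset_reached _ _ _ Omega c p w i.
rewrite -integral_cstB//; last 2 first.
- apply: measurable_funB => //.
  apply: (measurable_funS (measurable_reached mOmega radial_c Omega_p) CD).
  exact: measurable_rconjugate_potential.
- by move=> x /CD /FK; rewrite subr_ge0.
apply: eq_integral => x; rewrite inE => Cx.
rewrite rconjugateE// -(potential_cell c_ge0 Omega_p Cx); congr EFin; lra.
Qed.

(** On a cell the integral of [F^*] may be -oo; measured downwards from [K] it becomes the integral
    of a nonnegative function, and null overlaps merge the cells into one domain. *)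
Lemma dual_objectiveE w (K : R) :
  (forall x, reached x -> (Fs (pot w x) <= K)%R) ->
  dual_objective Omega c F p mu m w =
  \int[mu]_(x in reached) (K - Fs (pot w x))%:E -
  (K * fine (mu reached) + \sum_(i < M) Fs (- w ord0 i) * m i)%:E +
  F 0%R * mu (residual_set Omega c p).
Proof.
move=> FK; rewrite /dual_objective; congr (_ + _).
have A0 x : reached x -> 0 <= (K - Fs (pot w x))%:E.
  by move=> /FK; rewrite lee_fin subr_ge0.
have mA : measurable_fun reached (fun x => (K - Fs (pot w x))%:E).
  apply/measurable_EFinP; apply: measurable_funB => //.
  exact: measurable_rconjugate_potential.
rewrite -(integral_cells w mA A0).
have -> : fine (mu reached) = (\sum_(i < M) fine (mu (cell w i)))%R.
  rewrite -(measure_cells w) -sum_fine// => i _; apply: fin_num_measure.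
  exact: measurable_laguerre_cell.
have Ai0 i : 0 <= \int[mu]_(x in cell w i) (K - Fs (pot w x))%:E.
  by apply: integral_ge0 => x /cell_subset_reached /A0.
under eq_bigr => i _.
  rewrite (integral_cell_conjugate i FK) rconjugateE// -EFinM addeAC -EFinD.
  over.
rewrite big_split/= sumEFin big_split/= -mulr_sumr sumeN; last first.
  by move=> i j _ _; apply: ge0_adde_def; rewrite inE; exact: Ai0.
have : 0 <= \sum_(i < M) \int[mu]_(x in cell w i) (K - Fs (pot w x))%:E.
  by apply: sume_ge0.
by case: (\sum_(i < M) _) => [s| |]// _; rewrite -!EFinN -!EFinD ?opprB.
Qed.

End DualFormula.

(** * Plans carried by the slices *)

Section PlanDuality.
Context {R : realType} {d M : nat}.
Variables (Omega : set 'rV[R]_d) (c : 'rV[R]_d -> 'rV[R]_d -> \bar R).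
Variables (p : 'I_M -> 'rV[R]_d) (F : R -> \bar R).
Variables (mu nu : {finite_measure set 'rV[R]_d -> \bar R}) (m : 'I_M -> R).
Hypothesis mOmega : measurable Omega.
Hypothesis radial_c : radial_cost Omega c.
Hypothesis c_ge0 : forall x y, Omega x -> Omega y -> 0 <= c x y.
Hypothesis Omega_p : forall i, Omega (p i).
Hypothesis p_inj : injective p.
Hypothesis overlaps : null_overlaps Omega c p mu.
Hypothesis hF : entropy_function F.
Hypothesis m_gt0 : forall i, (0 < m i)%R.
Hypothesis nuE : forall A, measurable A ->
  nu A = \sum_(i < M) (m i)%:E * \d_(p i) A.

Local Notation cell := (laguerre_cell Omega c p).
Local Notation residual := (residual_set Omega c p).
Local Notation reached := (reached Omega c p).
Local Notation pot := (potential c p).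
Local Notation Fs := (rconjugate F).
Local Notation E2 := ('rV[R]_d * 'rV[R]_d)%type.

Lemma measurable_set1_rV (x : 'rV[R]_d) : measurable [set x].
Proof.
rewrite -[X in measurable X]setCK; apply: measurableC; apply: sub_sigma_algebra.
by rewrite openC; exact/accessible_closed_set1/hausdorff_accessible/norm_hausdorff.
Qed.

Definition slice i : set E2 := Omega `*` [set p i].

Lemma measurable_slice i : measurable (slice i).
Proof. by apply: measurableX => //; exact: measurable_set1_rV. Qed.

Lemma slice_disjoint i j : i != j -> slice i `&` slice j = set0.
Proof.
move=> ij; apply/seteqP; split => // -[x y] [[/= _ ->] [/= _ /p_inj eij]].
by rewrite eij eqxx in ij.
Qed.

Lemma slice_sub i : slice i `<=` Omega `*` Omega.
Proof. by move=> [x y] [/= Ox ->]; split => //=. Qed.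

Lemma nu_p i : nu [set p i] = (m i)%:E.
Proof.
rewrite nuE; last exact: measurable_set1_rV.
rewrite (bigD1 i)//= diracE mem_set// mule1 big1 ?adde0// => j ji.
by rewrite diracE memNset ?mule0// => /p_inj/eqP; exact/negP.
Qed.

Lemma nu_compl_p : nu (~` \bigcup_i [set p i]) = 0.
Proof.
rewrite nuE.
  rewrite big1// => i _; rewrite diracE memNset ?mule0//.
  by apply; exists i.
apply: measurableC; apply: fin_bigcup_measurable => // i _.
exact: measurable_set1_rV.
Qed.

Section plan.
Variable gamma : {finite_measure set E2 -> \bar R}.
Hypothesis gamma_slices : gamma (~` \bigcup_i slice i) = 0.
Local Notation rho := (marginal1 gamma).
Local Notation sigma := (marginal2 gamma).

Let mslices : measurable (\bigcup_i slice i).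
Proof. by apply: fin_bigcup_measurable => // i _; exact: measurable_slice. Qed.

Lemma slices_null (A : set E2) : measurable A ->
  A `<=` ~` (\bigcup_i slice i) -> gamma A = 0.
Proof.
move=> mA sA; apply/eqP; rewrite eq_le measure_ge0 andbT -gamma_slices.
by apply: le_measure; rewrite ?inE//; exact: measurableC.
Qed.

Lemma integral_slices (D : set E2) (g : E2 -> \bar R) : measurable D ->
  (forall i, slice i `<=` D) -> measurable_fun D g -> (forall q, D q -> 0 <= g q) ->
  \sum_(i < M) \int[gamma]_(q in slice i) g q = \int[gamma]_(q in D) g q.
Proof.
move=> mD sD mg g0; apply: integral_almost_partition => //.
- exact: measurable_slice.
- apply: slices_null; first exact: measurableD.
  by move=> q [].
- by move=> i j ij; rewrite slice_disjoint// measure0.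
Qed.

Lemma measure_slices (A : set E2) : measurable A ->
  gamma A = \sum_(i < M) gamma (A `&` slice i).
Proof.
move=> mA.
have h := @integral_slices setT (EFin \o \1_A) measurableT (fun _ _ _ => I).
have := h _ _; rewrite integral_indic// setIT => <-//.
  apply: eq_bigr => i _; rewrite integral_indic//; exact: measurable_slice.
  by apply/measurable_EFinP; exact: measurable_indic.
by move=> q _; rewrite lee_fin.
Qed.

Lemma marginal1_slices (A : set 'rV[R]_d) : measurable A -> A `<=` Omega ->
  rho A = \sum_(i < M) gamma (A `*` [set p i]).
Proof.
move=> mA AO; rewrite /marginal1 /pushforward measure_slices; last first.
  by rewrite -[X in measurable X]setTI; exact: measurable_fst.
apply: eq_bigr => i _; congr (gamma _).
apply/seteqP; split => -[x y]; first by move=> [/= Ax [/= _ ->]].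
by move=> [/= Ax ->]; split => //; split => //=; exact: (AO _ Ax).
Qed.

Lemma marginal2_p i : sigma [set p i] = gamma (slice i).
Proof.
have mp := measurable_set1_rV (p i).
rewrite /marginal2 /pushforward [LHS]measure_slices; last first.
  by rewrite -[X in measurable X]setTI; apply: measurable_snd.
rewrite (bigD1 i)//= big1 ?adde0 => [|j ji].
  congr (gamma _); apply/seteqP; split => -[x y] /=; first by case.
  by move=> [/= Ox ->].
rewrite (_ : _ `&` _ = set0) ?measure0//.
apply/seteqP; split => // -[x y] [/= -> [/= _ /p_inj ij]].
by rewrite ij eqxx in ji.
Qed.

Definition mass i : R := fine (gamma (slice i)).

Lemma massE i : gamma (slice i) = (mass i)%:E.
Proof. by rewrite /mass fineK// fin_num_measure//; exact: measurable_slice. Qed.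

Lemma total_mass_reached : rho residual = 0 -> rho reached = (\sum_(i < M) mass i)%:E.
Proof.
move=> rR; have mR : measurable residual by exact: measurable_residual_set.
have mr : measurable reached by exact: measurable_reached.
transitivity (rho Omega).
  have OE : Omega = residual `|` reached.
    apply/seteqP; split => x; last by case=> -[].
    by move=> Ox; have [|] := pselect (residual x); [left|right].
  have disj : residual `&` reached = set0.
    by apply/seteqP; split => // x [Rx [_]].
  have -> : rho Omega = rho residual + rho reached.
    by rewrite [in LHS]OE; exact: measureU.
  by rewrite rR add0e.
rewrite marginal1_slices// -sumEFin; apply: eq_bigr => i _; exact: massE.
Qed.

End plan.
End PlanDuality.

(** * The three gaps and the identities behind them *)

Section PlanLedger.
Context {R : realType} {d M : nat}.
Variables (Omega : set 'rV[R]_d) (c : 'rV[R]_d -> 'rV[R]_d -> \bar R).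
Variables (p : 'I_M -> 'rV[R]_d) (F : R -> \bar R).
Variables (mu nu : {finite_measure set 'rV[R]_d -> \bar R}) (m : 'I_M -> R).
Hypothesis mOmega : measurable Omega.
Hypothesis radial_c : radial_cost Omega c.
Hypothesis c_ge0 : forall x y, Omega x -> Omega y -> 0 <= c x y.
Hypothesis Omega_p : forall i, Omega (p i).
Hypothesis p_inj : injective p.
Hypothesis overlaps : null_overlaps Omega c p mu.
Hypothesis hF : entropy_function F.
Hypothesis m_gt0 : forall i, (0 < m i)%R.
Hypothesis nuE : forall A, measurable A ->
  nu A = \sum_(i < M) (m i)%:E * \d_(p i) A.
Variable gamma : {finite_measure set ('rV[R]_d * 'rV[R]_d)%type -> \bar R}.

Local Notation cell := (laguerre_cell Omega c p).
Local Notation residual := (residual_set Omega c p).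
Local Notation reached := (reached Omega c p).
Local Notation pot := (potential c p).
Local Notation Fs := (rconjugate F).
Local Notation E2 := ('rV[R]_d * 'rV[R]_d)%type.
Local Notation slice := (slice Omega p).
Local Notation mass := (mass Omega p gamma).
Local Notation rho := (marginal1 gamma).
Local Notation sigma := (marginal2 gamma).

Hypothesis gamma_slices : gamma (~` \bigcup_i slice i) = 0.
Hypothesis rho_mu : rho `<< mu.
Hypothesis sigma_nu : sigma `<< nu.
Hypothesis rho_residual : rho residual = 0.

(* A version of the density that is nonnegative everywhere. *)
Definition rate (x : 'rV[R]_d) : R := fine (Radon_Nikodym_SigmaFinite.f rho mu x).

Lemma rateE x : (rate x)%:E = Radon_Nikodym_SigmaFinite.f rho mu x.
Proof. by rewrite /rate fineK//; exact: Radon_Nikodym_SigmaFinite.f_fin_num. Qed.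

Lemma rate_ge0 x : (0 <= rate x)%R.
Proof. by rewrite -lee_fin rateE; exact: Radon_Nikodym_SigmaFinite.f_ge0. Qed.

Lemma measurable_rate D : measurable_fun D rate.
Proof.
apply: measurable_funTS; apply/measurable_EFinP.
rewrite (_ : EFin \o rate = Radon_Nikodym_SigmaFinite.f rho mu).
  by apply: measurable_int; exact: Radon_Nikodym_SigmaFinite.f_integrable.
by apply/funext => x /=; rewrite rateE.
Qed.

Lemma density_rate : {ae mu, forall x, density rho mu x = rate x}.
Proof.
have := ae_eq_Radon_Nikodym_SigmaFinite rho_mu measurableT.
by apply: filterS => x /(_ I) fx; rewrite /density /rate fx.
Qed.

Lemma integral_rate (D : set 'rV[R]_d) (k : 'rV[R]_d -> R) : measurable D ->
  measurable_fun D k -> (forall x, D x -> (0 <= k x)%R) ->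
  \int[mu]_(x in D) (rate x * k x)%:E = \int[rho]_(x in D) (k x)%:E.
Proof.
move=> mD mk k0.
(* The change of variables asks for nonnegativity everywhere, hence the extension by 0. *)
pose k' := k \_ D.
have mk' : measurable_fun D (EFin \o k').
  apply/measurable_EFinP; apply: (eq_measurable_fun k) => // x xD.
  by rewrite /k' patchE xD.
have k'0 x : 0 <= (EFin \o k') x.
  rewrite /= lee_fin /k' patchE; case: ifPn => // xD.
  by apply: k0; rewrite inE in xD.
transitivity (\int[rho]_(x in D) (EFin \o k') x).
  rewrite -(Radon_Nikodym_SigmaFinite.change_of_variables rho_mu k'0 mD mk').
  apply: eq_integral => x xD; rewrite -rateE -EFinM /k' patchE xD mulrC//.
by apply: eq_integral => x xD; rewrite /= /k' patchE xD.
Qed.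

Lemma measurable_F_rate D : measurable_fun D (fun x => F (rate x)).
Proof.
apply: measurable_funTS; apply: (@measurableT_comp _ _ _ _ _ _ F).
  by apply: lower_semicontinuous_measurable; exact: entropy_lsc.
exact: measurable_rate.
Qed.

(** On the residual set [rho] vanishes, so the rate is 0 there up to a [mu]-null set; this yields
    the term [F 0%R * mu residual], which the dual objective contains too. *)
Lemma discrepancy_rate : discrepancy F Omega rho mu =
  \int[mu]_(x in reached) F (rate x) + F 0%R * mu residual.
Proof.
have mR : measurable residual by exact: measurable_residual_set.
have mr : measurable reached by exact: measurable_reached.
have F0 x : 0 <= F (rate x) by exact: entropy_ge0.
rewrite /discrepancy asboolT//.
have mFd : measurable_fun Omega (fun x => F (density rho mu x)).
  apply: measurable_funTS; apply: (@measurableT_comp _ _ _ _ _ _ F).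
    by apply: lower_semicontinuous_measurable; exact: entropy_lsc.
  exact: (@measurableT_comp _ _ _ _ _ _ (@fine R)).
transitivity (\int[mu]_(x in Omega) F (rate x)).
  apply: ge0_ae_eq_integral => //.
  - exact: measurable_F_rate.
  - by move=> x _; exact: entropy_ge0.
  - by move: density_rate; apply: filterS => x -> _.
have OE : Omega = reached `|` residual.
  apply/seteqP; split => x; last by case=> -[].
  by move=> Ox; have [|] := pselect (residual x); [right|left].
have disj : [disjoint reached & residual].
  by apply/disj_setPS => x [[_ nRx]].
rewrite {1}OE ge0_integral_setU//; last exact: measurable_F_rate.
congr (_ + _); rewrite -[RHS]integral_cst//.
apply: ge0_ae_eq_integral => //.
- exact: measurable_F_rate.
- by move=> x _; exact: entropy_ge0.
have r0 : \int[mu]_(x in residual) `|(rate x)%:E| = 0.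
  transitivity (\int[mu]_(x in residual) (rate x * 1)%:E).
    by apply: eq_integral => x _; rewrite mulr1 gee0_abs// lee_fin rate_ge0.
  by rewrite integral_rate// integral_cst// mul1e.
have /ae_eq_integral_abs := r0.
move=> /(_ mR) []; first by apply/measurable_EFinP; exact: measurable_rate.
move=> N [mN N0 sN]; exists N; split => //; apply: subset_trans sN => x /= h h'.
by apply: h => Rx; rewrite (EFin_inj (h' Rx)).
Qed.

Lemma discrepancy_weights : discrepancy F Omega sigma nu =
  \sum_(i < M) (m i)%:E * F (mass i / m i)%R.
Proof.
rewrite /discrepancy asboolT//.
have ms i : measurable [set p i] by exact: measurable_set1_rV.
have mFd : measurable_fun Omega (fun x => F (density sigma nu x)).
  apply: measurable_funTS; apply: (@measurableT_comp _ _ _ _ _ _ F).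
    by apply: lower_semicontinuous_measurable; exact: entropy_lsc.
  exact: (@measurableT_comp _ _ _ _ _ _ (@fine R)).
rewrite -(@integral_almost_partition _ _ _ nu _ (fun i => [set p i]))//; last 4 first.
- by move=> i x ->.
- apply/eqP; rewrite eq_le measure_ge0 andbT -(nu_compl_p nuE).
  apply: le_measure; rewrite ?inE.
  + by apply: measurableD => //; apply: fin_bigcup_measurable.
  + by apply: measurableC; apply: fin_bigcup_measurable.
  + by move=> x [].
- move=> i j ij; rewrite (_ : _ `&` _ = set0) ?measure0//.
  by apply/seteqP; split => // x [/= -> /p_inj eij]; rewrite eij eqxx in ij.
- by move=> x _; exact: entropy_ge0.
apply: eq_bigr => i _.
(* Integrating the density over the atom [[set p i]], of mass [m i], determines its value there. *)
have dE : (density sigma nu (p i) = mass i / m i)%R.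
  have := @Radon_Nikodym_integral _ _ _ (charge_of_finite_measure sigma) nu [set p i]
     sigma_nu (ms i).
  rewrite (eq_integral (cst (Radon_Nikodym (charge_of_finite_measure sigma) nu (p i)))); last first.
    by move=> x; rewrite inE => ->.
  rewrite integral_cst// -[X in _ * X]/(nu [set p i]) (nu_p p_inj nuE) /density.
  have fd : Radon_Nikodym (charge_of_finite_measure sigma) nu (p i) \is a fin_num.
    exact: Radon_Nikodym_fin_num.
  rewrite -[X in _ = X * _](fineK fd) -EFinM => sE.
  have : (mass i)%:E = (fine (Radon_Nikodym (charge_of_finite_measure sigma) nu (p i)) * m i)%:E.
    rewrite -sE -(massE p mOmega) -(marginal2_p mOmega p_inj gamma_slices).
    by [].
  by move=> [->]; rewrite mulfK// gt_eqF.
rewrite (eq_integral (cst (F (mass i / m i)%R))); last first.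
  by move=> x; rewrite inE => ->; rewrite dE.
by rewrite integral_cst// -[X in _ * X]/(nu [set p i]) (nu_p p_inj nuE) muleC.
Qed.

(* The integrands are nonnegative: the first by maximality of the potential, the
   other two by the Young inequality for [F] and its conjugate. *)
Definition cost_gap w : \bar R := \sum_(i < M)
  \int[gamma]_(q in slice i) (c q.1 (p i) + (pot w q.1 - w ord0 i)%:E).

Definition marginal_gap w : \bar R :=
  \int[mu]_(x in reached) (F (rate x) + (Fs (pot w x) - rate x * pot w x)%:E).

Definition weight_gap (w : 'rV[R]_M) : \bar R := \sum_(i < M)
  (m i)%:E * (F (mass i / m i)%R + (Fs (- w ord0 i) + w ord0 i * (mass i / m i))%:E).

Lemma measurable_pot_fst w i : measurable_fun (slice i) (fun q : E2 => pot w q.1).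
Proof.
apply: (@measurable_comp _ _ _ _ _ _ Omega (pot w)) => //.
- by move=> _ [q [Oq _] <-].
- exact: measurable_potential.
- exact: measurable_funTS.
Qed.

Lemma measurable_cost_slice i : measurable_fun (slice i) (fun q : E2 => c q.1 (p i)).
Proof.
apply: (@measurable_comp _ _ _ _ _ _ Omega (fun x => c x (p i))) => //.
- by move=> _ [q [Oq _] <-].
- exact: measurable_cost_to.
- exact: measurable_funTS.
Qed.

(* [K0] and [K] bound the potential and its conjugate from above; subtracting
   from them turns the signed integrands into nonnegative ones. *)
Section identities.
Variables (w : 'rV[R]_M) (K0 K : R).
Hypothesis wK0 : forall i, (w ord0 i <= K0)%R.
Hypothesis K00 : (0 <= K0)%R.

Let Ik := \int[mu]_(x in reached) (rate x * (K0 - pot w x))%:E.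

Let pot_le x : Omega x -> (pot w x <= K0)%R.
Proof. exact: potential_le. Qed.

(** The link between two identities: an integral against the plan in that of the cost, and against
    [mu], weighted by the rate, in that of the first marginal. *)
Lemma excess_integral : \sum_(i < M) \int[gamma]_(q in slice i) (K0 - pot w q.1)%:E = Ik.
Proof.
have mr : measurable reached by exact: measurable_reached.
have mR : measurable residual by exact: measurable_residual_set.
have mk : measurable_fun Omega (fun x => (K0 - pot w x)%:E).
  by apply/measurable_EFinP; apply: measurable_funB => //; exact: measurable_potential.
have k0 x : Omega x -> 0 <= (K0 - pot w x)%:E.
  by move=> Ox; rewrite lee_fin subr_ge0 pot_le.
have mfst : measurable (@fst 'rV[R]_d 'rV[R]_d @^-1` Omega).
  by rewrite -[X in measurable X]setTI; exact: measurable_fst.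
rewrite (@integral_slices _ _ _ _ _ mOmega p_inj gamma gamma_slices
  (fst @^-1` Omega) (fun q => (K0 - pot w q.1)%:E)) //; last 3 first.
- by move=> i q [].
- apply: (@measurable_comp _ _ _ _ _ _ Omega (fun x => (K0 - pot w x)%:E)) => //.
    by move=> _ [q Oq <-].
  exact: measurable_funTS.
- by move=> q; exact: k0.
transitivity (\int[rho]_(x in Omega) (K0 - pot w x)%:E).
  rewrite [RHS](@ge0_integral_pushforward _ _ _ _ _ _ measurable_fst gamma)//.
  by move=> x; rewrite inE; exact: k0.
rewrite (@ge0_negligible_integral _ _ _ rho Omega residual)// /Ik integral_rate//.
- apply: measurable_funB => //; exact: measurable_potential_reached.
- by move=> x [Ox _]; rewrite subr_ge0 pot_le.
Qed.

(** With [h] the potential, [c + (K0 - w_i)] splits on the i-th slice as [(c + h - w_i) + (K0 - h)],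
    both summands being nonnegative. *)
Lemma cost_identity :
  \int[gamma]_(q in Omega `*` Omega) c q.1 q.2 +
    (\sum_(i < M) (K0 - w ord0 i) * mass i)%:E = cost_gap w + Ik.
Proof.
have ms i : measurable (slice i) by exact: measurable_slice.
rewrite -(@integral_slices _ _ _ _ _ mOmega p_inj gamma gamma_slices)//; last 4 first.
- exact: measurableX.
- by move=> i; exact: slice_sub.
- exact: measurable_cost.
- by move=> q [? ?]; exact: c_ge0.
rewrite -excess_integral -sumEFin /cost_gap -!big_split/=.
apply: eq_bigr => i _.
have wi0 : (0 <= K0 - w ord0 i)%R by rewrite subr_ge0.
have mgap : measurable_fun (slice i)
    (fun q => c q.1 (p i) + (pot w q.1 - w ord0 i)%:E).
  apply: emeasurable_funD; first exact: measurable_cost_slice.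
  by apply/measurable_EFinP; apply: measurable_funB => //; exact: measurable_pot_fst.
rewrite EFinM -(massE p mOmega) -integral_cst//.
have -> : \int[gamma]_(q in slice i) c q.1 q.2 =
    \int[gamma]_(q in slice i) c q.1 (p i).
  by apply: eq_integral => -[x y]; rewrite inE => -[_ /= ->].
have c0 q : slice i q -> 0 <= c q.1 (p i) by move=> [Oq _]; exact: c_ge0.
have g0 q : slice i q -> 0 <= c q.1 (p i) + (pot w q.1 - w ord0 i)%:E.
  by move=> [Oq _]; exact: (cost_gap_ge0 c_ge0 Omega_p).
have k0 (q : E2) : slice i q -> 0 <= (K0 - pot w q.1)%:E.
  by move=> [Oq _]; rewrite lee_fin subr_ge0 pot_le.
have mk : measurable_fun (slice i) (fun q : E2 => (K0 - pot w q.1)%:E).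
  by apply/measurable_EFinP; apply: measurable_funB => //; exact: measurable_pot_fst.
have w0 (q : E2) : slice i q -> 0 <= cst (K0 - w ord0 i)%:E q.
  by move=> _; rewrite lee_fin.
rewrite -(ge0_integralD gamma (ms i) c0 (@measurable_cost_slice i) w0)//.
rewrite -(ge0_integralD gamma (ms i) g0 mgap k0 mk).
apply: eq_integral => -[x y]; rewrite inE => -[/= Ox _].
rewrite -addeA -EFinD; congr (_ + _%:E); lra.
Qed.

Hypothesis FsK : (Fs K0 <= K)%R.
Hypothesis K_ge0 : (0 <= K)%R.

(** With [h] the potential and [r] the rate, both sides integrate [F r + r * (K0 - h) + K], split
    into nonnegative summands in two ways. *)
Lemma marginal_identity :
  \int[mu]_(x in reached) F (rate x) + Ik + (K * fine (mu reached))%:E =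
  marginal_gap w + (K0 * \sum_(i < M) mass i)%:E +
  \int[mu]_(x in reached) (K - Fs (pot w x))%:E.
Proof.
have mr : measurable reached by exact: measurable_reached.
have mu_r : mu reached \is a fin_num by exact: fin_num_measure.
have mpot : measurable_fun reached (pot w) by exact: measurable_potential_reached.
have mrate : measurable_fun reached rate by exact: measurable_rate.
have mFs : measurable_fun reached (fun x => Fs (pot w x)).
  exact: measurable_rconjugate_potential.
have mF : measurable_fun reached (fun x => F (rate x)) by exact: measurable_F_rate.
have F0 x : 0 <= F (rate x) by exact: entropy_ge0.
have -> : (K * fine (mu reached))%:E = \int[mu]_(x in reached) (cst K%:E) x.
  by rewrite integral_cst// EFinM fineK.
have -> : (K0 * \sum_(i < M) mass i)%:E = \int[mu]_(x in reached) (rate x * K0)%:E.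
  rewrite integral_rate// integral_cst// EFinM.
  by rewrite -(total_mass_reached mOmega radial_c Omega_p p_inj gamma_slices rho_residual).
have gap0 x : 0 <= F (rate x) + (Fs (pot w x) - rate x * pot w x)%:E.
  have := young hF (pot w x) (rate x); have := F0 x.
  case: (F (rate x)) => [r| |]//= _; rewrite -!EFinD !lee_fin; lra.
have ik0 x : reached x -> 0 <= (rate x * (K0 - pot w x))%:E.
  by move=> [Ox _]; rewrite lee_fin mulr_ge0 ?rate_ge0// subr_ge0 pot_le.
have mik : measurable_fun reached (fun x => (rate x * (K0 - pot w x))%:E).
  by apply/measurable_EFinP; apply: measurable_funM => //; exact: measurable_funB.
have mrK : measurable_fun reached (fun x => (rate x * K0)%:E).
  by apply/measurable_EFinP; exact: measurable_funM.
have mKF : measurable_fun reached (fun x => (K - Fs (pot w x))%:E).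
  by apply/measurable_EFinP; exact: measurable_funB.
have mgap : measurable_fun reached
    (fun x => F (rate x) + (Fs (pot w x) - rate x * pot w x)%:E).
  apply: emeasurable_funD => //; apply/measurable_EFinP.
  by apply: measurable_funB => //; exact: measurable_funM.
have KF0 x : reached x -> 0 <= (K - Fs (pot w x))%:E.
  move=> [Ox _]; rewrite lee_fin subr_ge0 (le_trans _ FsK)//.
  by apply: rconjugate_nd => //; exact: pot_le.
have rK0 x : 0 <= (rate x * K0)%:E by rewrite lee_fin mulr_ge0// rate_ge0.
rewrite /Ik /marginal_gap.
have Fik0 x : reached x -> 0 <= F (rate x) + (rate x * (K0 - pot w x))%:E.
  by move=> rx; rewrite adde_ge0// ik0.
have grK0 x : reached x -> 0 <= F (rate x) + (Fs (pot w x) - rate x * pot w x)%:E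
    + (rate x * K0)%:E.
  by move=> rx; rewrite adde_ge0.
have cK0 (x : 'rV[R]_d) : reached x -> 0 <= cst K%:E x by rewrite lee_fin.
rewrite -(ge0_integralD mu mr (fun x _ => F0 x) mF ik0 mik).
rewrite -(ge0_integralD mu mr Fik0 (emeasurable_funD mF mik) cK0)//.
rewrite -(ge0_integralD mu mr (fun x _ => gap0 x) mgap (fun x _ => rK0 x) mrK).
rewrite -(ge0_integralD mu mr grK0 (emeasurable_funD mgap mrK) KF0 mKF).
apply: eq_integral => x _ /=; have := F0 x.
case: (F (rate x)) => [r| |]// _; rewrite -!EFinD; congr EFin; lra.
Qed.

Lemma weight_identity :
  \sum_(i < M) (m i)%:E * F (mass i / m i)%R +
  (\sum_(i < M) (Fs (- w ord0 i) * m i + w ord0 i * mass i))%:E = weight_gap w.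
Proof.
rewrite -sumEFin -big_split/=; apply: eq_bigr => i _.
have mi := m_gt0 i.
have := entropy_ge0 hF (mass i / m i)%R.
case: (F _) => [r| |]// _.
  apply: (congr1 EFin (_ : m i * r +
    (Fs (- w ord0 i) * m i + w ord0 i * mass i) =
    m i * (r + (Fs (- w ord0 i) + w ord0 i * (mass i / m i))))%R).
  by field; exact: lt0r_neq0.
by rewrite !addye// gt0_muley ?lte_fin.
Qed.

Lemma cost_gap_sum_ge0 : 0 <= cost_gap w.
Proof.
apply: sume_ge0 => i _; apply: integral_ge0 => q [Oq _]; exact: (cost_gap_ge0 c_ge0 Omega_p).
Qed.

Lemma marginal_gap_ge0 : 0 <= marginal_gap w.
Proof.
apply: integral_ge0 => x _.
have := young hF (pot w x) (rate x); have := entropy_ge0 hF (rate x).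
case: (F (rate x)) => [r| |]//= _; rewrite -!EFinD !lee_fin; lra.
Qed.

Lemma weight_gap_ge0 : 0 <= weight_gap w.
Proof.
apply: sume_ge0 => i _; apply: mule_ge0; first by rewrite lee_fin ltW.
have := young hF (- w ord0 i)%R (mass i / m i)%R.
have := entropy_ge0 hF (mass i / m i)%R.
case: (F _) => [r| |]//= _; rewrite -!EFinD !lee_fin; lra.
Qed.

Lemma plan_ledger :
  let primal := transport_energy Omega c F mu nu gamma in
  let dual := dual_objective Omega c F p mu m w in
  [/\ dual <= primal,
      primal < +oo -> primal <= dual ->
        [/\ cost_gap w = 0, marginal_gap w = 0 & weight_gap w = 0] &
      cost_gap w = 0 -> marginal_gap w = 0 -> weight_gap w = 0 -> primal <= dual].
Proof.
have FK x : reached x -> (Fs (pot w x) <= K)%R.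
  move=> [Ox _]; rewrite (le_trans _ FsK)//.
  by apply: rconjugate_nd => //; exact: pot_le.
cbv zeta; rewrite (dual_objectiveE m mOmega radial_c c_ge0 Omega_p overlaps hF FK).
rewrite /transport_energy discrepancy_rate discrepancy_weights.
apply: (ledger _ _ _ _ _ _ _ _ _ cost_identity marginal_identity weight_identity).
- by apply: integral_ge0 => q [? ?]; exact: c_ge0.
- apply: integral_ge0 => x [Ox _].
  by rewrite lee_fin mulr_ge0 ?rate_ge0// subr_ge0 pot_le.
- exact: cost_gap_sum_ge0.
- exact: marginal_gap_ge0.
- exact: weight_gap_ge0.
- by rewrite mule_ge0// entropy_ge0.
- by apply: integral_ge0 => x _; exact: entropy_ge0.
- apply: sume_ge0 => i _; apply: mule_ge0; last exact: entropy_ge0.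
  by rewrite lee_fin ltW.
- by apply: integral_ge0 => x rx; rewrite lee_fin subr_ge0 FK.
(* The terms [w_i * mass i] of the cost and the weight identity cancel. *)
- rewrite mulr_sumr -!big_split/=; apply: eq_bigr => i _; lra.
Qed.

End identities.

End PlanLedger.

Lemma sume_ge0_eq0 (R : realType) (M : nat) (f : 'I_M -> \bar R) :
  (forall i, 0 <= f i) -> \sum_(i < M) f i = 0 -> forall i, f i = 0.
Proof.
move=> f0 sf i; apply/eqP; rewrite eq_le f0 andbT -sf (bigD1 i)//= leeDl//.
by apply: sume_ge0.
Qed.

(** * Vanishing gaps and the optimality conditions *)

Section GapsAndConditions.
Context {R : realType} {d M : nat}.
Variables (Omega : set 'rV[R]_d) (c : 'rV[R]_d -> 'rV[R]_d -> \bar R).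
Variables (p : 'I_M -> 'rV[R]_d) (F : R -> \bar R).
Variables (mu nu : {finite_measure set 'rV[R]_d -> \bar R}) (m : 'I_M -> R).
Hypothesis mOmega : measurable Omega.
Hypothesis radial_c : radial_cost Omega c.
Hypothesis c_ge0 : forall x y, Omega x -> Omega y -> 0 <= c x y.
Hypothesis Omega_p : forall i, Omega (p i).
Hypothesis p_inj : injective p.
Hypothesis overlaps : null_overlaps Omega c p mu.
Hypothesis hF : entropy_function F.
Hypothesis m_gt0 : forall i, (0 < m i)%R.
Hypothesis nuE : forall A, measurable A ->
  nu A = \sum_(i < M) (m i)%:E * \d_(p i) A.
Variable gamma : {finite_measure set ('rV[R]_d * 'rV[R]_d)%type -> \bar R}.
Variable w : 'rV[R]_M.

Local Notation cell := (laguerre_cell Omega c p).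
Local Notation residual := (residual_set Omega c p).
Local Notation reached := (reached Omega c p).
Local Notation pot := (potential c p).
Local Notation Fs := (rconjugate F).
Local Notation E2 := ('rV[R]_d * 'rV[R]_d)%type.
Local Notation slice := (slice Omega p).
Local Notation mass := (mass Omega p gamma).
Local Notation rho := (marginal1 gamma).
Local Notation sigma := (marginal2 gamma).
Local Notation rate := (rate mu gamma).

Let mcell i : measurable (cell w i).
Proof. exact: measurable_laguerre_cell. Qed.

Let mp i : measurable [set p i].
Proof. exact: measurable_set1_rV. Qed.

Let msl i : measurable (slice i).
Proof. exact: measurable_slice. Qed.

Let mreach : measurable reached.
Proof. exact: measurable_reached. Qed.

Let mres : measurable residual.
Proof. exact: measurable_residual_set. Qed.

Lemma restriction_dirac (D : set 'rV[R]_d) (y : 'rV[R]_d) (A : set E2) :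
  measurable D -> measurable A ->
  (restriction rho D \x \d_y) A = rho (ysection A y `&` D).
Proof.
move=> mD mA.
have mAy : measurable (ysection A y) by exact: measurable_ysection.
transitivity (\int[mrestr rho mD]_x (\1_(ysection A y) x)%:E); last first.
  by rewrite integral_indic// setIT.
rewrite -[restriction rho D]/(mrestr rho mD) /product_measure1.
apply: eq_integral => x _.
by rewrite [LHS]diracE indicE mem_xsection mem_ysection.
Qed.

Lemma condition_aP : condition_a Omega c p gamma w <->
  forall A, measurable A ->
    gamma A = \sum_(i < M) rho (ysection A (p i) `&` cell w i).
Proof.
split=> h A mA; rewrite h//; apply: eq_bigr => i _.
  exact: restriction_dirac.
by rewrite restriction_dirac.
Qed.

Section concentrated_on_slices.
Hypothesis gamma_slices : gamma (~` \bigcup_i slice i) = 0.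

(** What a zero cost gap says directly. Passing to (a) also requires discarding the ties between
    cells, by [rho << mu]. *)
Definition cell_plan := forall i, gamma ((Omega `\` cell w i) `*` [set p i]) = 0.

Lemma cost_gap_eq0P : cost_gap Omega c p gamma w = 0 <-> cell_plan.
Proof.
pose g i (q : E2) := c q.1 (p i) + (pot w q.1 - w ord0 i)%:E.
have mg i : measurable_fun (slice i) (g i).
  apply: emeasurable_funD; first exact: measurable_cost_slice.
  by apply/measurable_EFinP; apply: measurable_funB => //; exact: measurable_pot_fst.
have g0 i q : slice i q -> 0 <= g i q.
  by move=> [Oq _]; exact: (cost_gap_ge0 c_ge0 Omega_p).
have abs i : \int[gamma]_(q in slice i) g i q = \int[gamma]_(q in slice i) `|g i q|.
  by apply: eq_integral => q; rewrite inE => sq; rewrite gee0_abs// g0.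
have key i : \int[gamma]_(q in slice i) g i q = 0 <->
    gamma ((Omega `\` cell w i) `*` [set p i]) = 0.
  rewrite abs ae_eq_integral_abs//; split => [[N [mN N0 sN]]|h].
    apply/eqP; rewrite eq_le measure_ge0 andbT -N0; apply: le_measure.
    - by rewrite inE; apply: measurableX => //; exact: measurableD.
    - by rewrite inE.
    move=> [x y] [/= [Ox nC] yp]; apply: sN => /= hx; apply: nC.
    apply/(cost_gap_eq0 c_ge0 Omega_p w i Ox).
    by apply: hx; split.
  exists ((Omega `\` cell w i) `*` [set p i]); split => //.
    by apply: measurableX => //; exact: measurableD.
  move=> [x y] /= hx; apply: contrapT => nq; apply: hx => -[/= Ox yp].
  apply/(cost_gap_eq0 c_ge0 Omega_p w i Ox); apply: contrapT => nC.
  by apply: nq; split.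
rewrite /cell_plan /cost_gap; split => h.
  by move=> i; apply/key; apply: (sume_ge0_eq0 _ h) => j; apply: integral_ge0; exact: g0.
by apply: big1 => i _; apply/key.
Qed.

Lemma rate_residual : rho `<< mu -> (rho residual = 0 <->
  {ae mu, forall x, residual x -> density rho mu x = 0%R}).
Proof.
move=> rho_mu.
have rI : \int[mu]_(x in residual) `|(rate x)%:E| = rho residual.
  transitivity (\int[mu]_(x in residual) (rate x * 1)%:E).
    by apply: eq_integral => x _; rewrite mulr1 gee0_abs// lee_fin rate_ge0.
  by rewrite integral_rate// integral_cst// mul1e.
have mr : measurable_fun residual (EFin \o rate).
  by apply/measurable_EFinP; exact: measurable_rate.
rewrite -rI; rewrite (ae_eq_integral_abs mu mres mr); split => h.
  by move: h (density_rate rho_mu); apply: filterS2 => x h -> Rx; exact: EFin_inj (h Rx).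
by move: h (density_rate rho_mu); apply: filterS2 => x h e Rx; rewrite /= -e h.
Qed.

Lemma marginal_gap_eq0P : rho `<< mu -> (marginal_gap Omega c p F mu gamma w = 0 <->
  forall i, {ae mu, forall x, cell w i x ->
    subdifferential (conjugate F) (cell_potential c p w i x) (density rho mu x)}).
Proof.
move=> rho_mu.
pose g x := F (rate x) + (Fs (pot w x) - rate x * pot w x)%:E.
have g0 x : 0 <= g x.
  rewrite /g; have := young hF (pot w x) (rate x); have := entropy_ge0 hF (rate x).
  case: (F (rate x)) => [r| |]//= _; rewrite -!EFinD !lee_fin; lra.
have mg : measurable_fun reached g.
  apply: emeasurable_funD; first exact: measurable_F_rate.
  apply/measurable_EFinP; apply: measurable_funB.
    exact: measurable_rconjugate_potential.
  apply: measurable_funM; first exact: measurable_rate.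
  exact: measurable_potential_reached.
have abs : marginal_gap Omega c p F mu gamma w = \int[mu]_(x in reached) `|g x|.
  by apply: eq_integral => x _; rewrite gee0_abs.
have gE i x : cell w i x -> g x = 0 <->
    subdifferential (conjugate F) (cell_potential c p w i x) (rate x).
  move=> Cx; rewrite subdifferential_young_eq// -(potential_cell c_ge0 Omega_p Cx) /g.
  have := entropy_ge0 hF (rate x).
  case: (F (rate x)) => [r| |]//= _.
  by split=> -[] h; congr EFin; lra.
rewrite abs (ae_eq_integral_abs mu mreach mg); split => h.
  move=> i; move: h (density_rate rho_mu); apply: filterS2 => x h -> Cx.
  by apply/gE => //; apply: h; exact: cell_subset_reached Cx.
have : {ae mu, forall x, forall i, cell w i x ->
    subdifferential (conjugate F) (cell_potential c p w i x) (density rho mu x)}.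
  by apply: filter_forall => i; exact: h.
move: (density_rate rho_mu); apply: filterS2 => x dx hx rx.
have [i Ci] := reached_cell c_ge0 Omega_p w rx.
by apply/(gE i) => //; rewrite -dx; exact: hx.
Qed.

Lemma weight_gap_eq0P : weight_gap Omega p F m gamma w = 0 <->
  forall i, subdifferential (conjugate F) (- w ord0 i)%R (mass i / m i)%R.
Proof.
pose g i := F (mass i / m i)%R + (Fs (- w ord0 i) + w ord0 i * (mass i / m i))%:E.
have g0 i : 0 <= g i.
  rewrite /g; have := young hF (- w ord0 i)%R (mass i / m i)%R.
  have := entropy_ge0 hF (mass i / m i)%R.
  case: (F _) => [r| |]//= _; rewrite -!EFinD !lee_fin; lra.
have gE i : g i = 0 <->
    subdifferential (conjugate F) (- w ord0 i)%R (mass i / m i)%R.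
  rewrite subdifferential_young_eq// /g.
  have := entropy_ge0 hF (mass i / m i)%R.
  case: (F _) => [r| |]//= _.
  by split=> -[] h; congr EFin; lra.
rewrite /weight_gap; split => h.
  move=> i; have h0 j : 0 <= (m j)%:E * g j.
    by apply: mule_ge0; [rewrite lee_fin ltW|exact: g0].
  have /eqP := sume_ge0_eq0 h0 h i; rewrite mule_eq0 => /orP[/eqP[]mi|/eqP]; last first.
    by move=> ?; exact/gE.
  by have := m_gt0 i; rewrite mi ltxx.
by apply: big1 => i _; have /gE := h i; rewrite /g => ->; rewrite mule0.
Qed.

(** [rho B] collects the mass over [B] from all slices. In the j-th one, [j != i], the part of [B]
    off the j-th cell is null by [cell_plan], and the rest lies in an overlap, null for [mu] and
    hence for [rho]. *)
Lemma rho_cell i (B : set 'rV[R]_d) : rho `<< mu -> cell_plan ->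
  measurable B -> B `<=` cell w i -> rho B = gamma (B `*` [set p i]).
Proof.
move=> rho_mu cp mB BC.
have BO : B `<=` Omega by move=> x /BC [].
rewrite (marginal1_slices mOmega p_inj gamma_slices mB BO).
rewrite (bigD1 i)//= big1 ?adde0// => j ji.
apply/eqP; rewrite eq_le measure_ge0 andbT.
have ov0 : gamma ((cell w i `&` cell w j) `*` setT) = 0.
  rewrite (_ : _ `*` _ = fst @^-1` (cell w i `&` cell w j)); last first.
    by apply/seteqP; split => q //= -[].
  have /null_content_dominatesP := rho_mu; apply; first exact: measurableI.
  by apply: overlaps; rewrite eq_sym.
have <- : gamma ((cell w i `&` cell w j) `*` setT) +
    gamma ((Omega `\` cell w j) `*` [set p j]) = 0 by rewrite ov0 cp adde0.
have m1 : measurable ((cell w i `&` cell w j) `*` [set: 'rV[R]_d]).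
  by apply: measurableX => //; exact: measurableI.
have m2 : measurable ((Omega `\` cell w j) `*` [set p j]).
  by apply: measurableX => //; exact: measurableD.
apply: le_trans (measureU2 _ m1 m2).
apply: le_measure; rewrite ?inE; [exact: measurableX|exact: measurableU|].
move=> [x y] [/= Bx yp]; have [Cj|nCj] := pselect (cell w j x).
  by left; split => //; split => //; exact: BC.
by right; split => //; split => //; exact: BO.
Qed.

Lemma mass_cell i : rho `<< mu -> cell_plan -> rho (cell w i) = (mass i)%:E.
Proof.
move=> rho_mu cp; rewrite (@rho_cell i)// -(massE p mOmega).
have m1 : measurable (cell w i `*` [set p i]) by exact: measurableX.
have m2 : measurable ((Omega `\` cell w i) `*` [set p i]).
  by apply: measurableX => //; exact: measurableD.
have sE : slice i = (cell w i `*` [set p i]) `|` ((Omega `\` cell w i) `*` [set p i]).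
  apply/seteqP; split => -[x y]; last by case=> -[/= []].
  by move=> [/= Ox yp]; have [|] := pselect (cell w i x); [left|right].
have -> : gamma (slice i) = gamma (cell w i `*` [set p i]) +
    gamma ((Omega `\` cell w i) `*` [set p i]).
  rewrite sE; apply: measureU => //.
  by apply/seteqP; split => // -[x y] [[/= Cx _] [/= [_ nCx] _]].
by rewrite cp adde0.
Qed.

Lemma cell_plan_condition_a : rho `<< mu -> cell_plan -> condition_a Omega c p gamma w.
Proof.
move=> rho_mu cp; apply/condition_aP => A mA.
rewrite (measure_slices mOmega p_inj gamma_slices mA); apply: eq_bigr => i _.
have mAi : measurable (ysection A (p i)) by exact: measurable_ysection.
have mB : measurable (ysection A (p i) `&` cell w i) by exact: measurableI.
rewrite (@rho_cell i)//.
have m1 : measurable ((ysection A (p i) `&` cell w i) `*` [set p i]).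
  exact: measurableX.
have m2 : measurable (A `&` ((Omega `\` cell w i) `*` [set p i])).
  by apply: measurableI => //; apply: measurableX => //; exact: measurableD.
have sE : A `&` slice i = ((ysection A (p i) `&` cell w i) `*` [set p i])
    `|` (A `&` ((Omega `\` cell w i) `*` [set p i])).
  apply/seteqP; split => -[x y].
    move=> [Axy [/= Ox yp]]; have [Cx|nCx] := pselect (cell w i x); last by right.
    by left; split => //=; split => //; apply/ysectionP; rewrite -yp.
  move=> [[/= [/ysectionP Axp Cx] ->]|[Axy [/= [Ox _] yp]]]; last by split.
  by split => //; split => //=; case: Cx.
have e1 : gamma (A `&` slice i) =
    gamma ((ysection A (p i) `&` cell w i) `*` [set p i]) +
    gamma (A `&` ((Omega `\` cell w i) `*` [set p i])).
  rewrite sE; apply: measureU => //.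
  by apply/seteqP; split => // -[x y] [[/= [_ Cx] _] [_ [/= [_ nCx] _]]].
have e2 : gamma (A `&` ((Omega `\` cell w i) `*` [set p i])) = 0.
  apply/eqP; rewrite eq_le measure_ge0 andbT -(cp i).
  apply: le_measure; rewrite ?inE; [exact: m2| |by move=> q []].
  by apply: measurableX => //; exact: measurableD.
by rewrite [LHS]e1 e2 adde0.
Qed.

End concentrated_on_slices.
End GapsAndConditions.

(** * Weak duality and complementary slackness *)

Section Optimality.
Context {R : realType} {d M : nat}.
Variables (Omega : set 'rV[R]_d) (c : 'rV[R]_d -> 'rV[R]_d -> \bar R).
Variables (p : 'I_M -> 'rV[R]_d) (F : R -> \bar R).
Variables (mu nu : {finite_measure set 'rV[R]_d -> \bar R}) (m : 'I_M -> R).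
Hypothesis mOmega : measurable Omega.
Hypothesis radial_c : radial_cost Omega c.
Hypothesis c_ge0 : forall x y, Omega x -> Omega y -> 0 <= c x y.
Hypothesis Omega_p : forall i, Omega (p i).
Hypothesis p_inj : injective p.
Hypothesis overlaps : null_overlaps Omega c p mu.
Hypothesis hF : entropy_function F.
Hypothesis m_gt0 : forall i, (0 < m i)%R.
Hypothesis nuE : forall A, measurable A ->
  nu A = \sum_(i < M) (m i)%:E * \d_(p i) A.

Local Notation cell := (laguerre_cell Omega c p).
Local Notation residual := (residual_set Omega c p).
Local Notation slice := (slice Omega p).
Local Notation E2 := ('rV[R]_d * 'rV[R]_d)%type.
Local Notation energy := (transport_energy Omega c F mu nu).
Local Notation dual := (dual_objective Omega c F p mu m).
Local Notation plan := {finite_measure set ('rV[R]_d * 'rV[R]_d)%type -> \bar R}.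
Implicit Types (gamma : plan) (w : 'rV[R]_M).

Let mp i : measurable [set p i].
Proof. exact: measurable_set1_rV. Qed.

Let msl i : measurable (slice i).
Proof. exact: measurable_slice. Qed.

Let mslices : measurable (\bigcup_i slice i).
Proof. exact: fin_bigcup_measurable. Qed.

Let mres : measurable residual.
Proof. exact: measurable_residual_set. Qed.

Lemma plan_ledgerW gamma w : gamma (~` \bigcup_i slice i) = 0 ->
  marginal1 gamma `<< mu -> marginal2 gamma `<< nu -> marginal1 gamma residual = 0 ->
  [/\ dual w <= energy gamma,
      energy gamma < +oo -> energy gamma <= dual w ->
        [/\ cost_gap Omega c p gamma w = 0, marginal_gap Omega c p F mu gamma w = 0 &
            weight_gap Omega p F m gamma w = 0] &
      cost_gap Omega c p gamma w = 0 -> marginal_gap Omega c p F mu gamma w = 0 ->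
      weight_gap Omega p F m gamma w = 0 -> energy gamma <= dual w].
Proof.
move=> gs rmu snu rR.
pose K0 := (\sum_(i < M) `|w ord0 i|)%R.
have K00 : (0 <= K0)%R by apply: sumr_ge0.
have wK i : (w ord0 i <= K0)%R.
  rewrite (le_trans (ler_norm _))// /K0 (bigD1 i)//= lerDl; exact: sumr_ge0.
apply: (plan_ledger mOmega radial_c c_ge0 Omega_p p_inj overlaps hF m_gt0 nuE
  gs rmu snu rR wK K00 (K := Num.max (rconjugate F K0) 0%R)).
  by rewrite le_max lexx.
by rewrite le_max lexx orbT.
Qed.

Lemma slices_of_marginal2 gamma : concentrated gamma (Omega `*` Omega) ->
  marginal2 gamma `<< nu -> gamma (~` \bigcup_i slice i) = 0.
Proof.
move=> gO /null_content_dominatesP snu.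
have mPp : measurable (\bigcup_i [set p i]) by apply: fin_bigcup_measurable.
have s0 : marginal2 gamma (~` \bigcup_i [set p i]) = 0.
  by apply: snu; [exact: measurableC|exact: (nu_compl_p nuE)].
apply/eqP; rewrite eq_le measure_ge0 andbT.
have <- : gamma (~` (Omega `*` Omega)) + marginal2 gamma (~` \bigcup_i [set p i]) = 0.
  by rewrite s0 adde0.
have m1 : measurable (~` (Omega `*` Omega)) by apply: measurableC; exact: measurableX.
have m2 : measurable (@snd 'rV[R]_d 'rV[R]_d @^-1` (~` \bigcup_i [set p i])).
  by rewrite -[X in measurable X]setTI; apply: measurable_snd => //; exact: measurableC.
apply: le_trans (measureU2 gamma m1 m2).
apply: le_measure; rewrite ?inE; [exact: measurableC|exact: measurableU|].
move=> [x y] /= nS; apply: contrapT => h; apply: nS.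
have [Oxy|nO] := pselect ((Omega `*` Omega) (x, y)); last by exfalso; apply: h; left.
have [[i _ yp]|ny] := pselect ((\bigcup_i [set p i]) y); last by exfalso; apply: h; right.
by exists i => //; split => //; case: Oxy.
Qed.

(** A finite second discrepancy concentrates the plan on the atoms of [nu], and a finite cost
    integral excludes mass over the residual set, where every cost is +oo. *)
Lemma finite_energy_plan gamma : concentrated gamma (Omega `*` Omega) ->
  energy gamma < +oo ->
  [/\ gamma (~` \bigcup_i slice i) = 0, marginal1 gamma `<< mu,
      marginal2 gamma `<< nu & marginal1 gamma residual = 0].
Proof.
move=> gO; rewrite /transport_energy /discrepancy.
have cost0 : 0 <= \int[gamma]_(q in Omega `*` Omega) c q.1 q.2.
  by apply: integral_ge0 => q [? ?]; exact: c_ge0.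
have I0 (ka : {finite_measure set 'rV[R]_d -> \bar R}) (f : 'rV[R]_d -> R) :
    0 <= \int[ka]_(x in Omega) F (f x).
  by apply: integral_ge0 => x _; exact: entropy_ge0.
have [rmu|_] := asboolP (marginal1 gamma `<< mu); last first.
  rewrite addey ?gt_eqF//; last exact: lt_le_trans cost0.
  by case: ifPn => _; rewrite addye// gt_eqF//; exact: lt_le_trans (I0 _ _).
have [snu|_] := asboolP (marginal2 gamma `<< nu); last first.
  by rewrite addey// gt_eqF// (lt_le_trans ltNy0)// adde_ge0.
move=> fin; have gs := slices_of_marginal2 gO snu; split => //.
have cost_fin : \int[gamma]_(q in Omega `*` Omega) c q.1 q.2 < +oo.
  apply: le_lt_trans fin; rewrite -addeA leeDl// adde_ge0//; exact: I0.
rewrite (marginal1_slices mOmega p_inj gs mres); last by move=> x [].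
apply: big1 => i _.
have mRp : measurable (residual `*` [set p i]) by exact: measurableX.
have sub : residual `*` [set p i] `<=` Omega `*` Omega.
  by move=> [x y] [/= [Ox _] ->]; split => //=.
have : \int[gamma]_(q in residual `*` [set p i]) c q.1 q.2 < +oo.
  apply: le_lt_trans cost_fin; apply: ge0_subset_integral => //.
  - exact: measurableX.
  - exact: measurable_cost.
  - by move=> q [? ?]; exact: c_ge0.
rewrite (eq_integral (cst +oo)); last first.
  by move=> [x y]; rewrite inE => -[/= [_ cx] ->]; rewrite cx.
rewrite integral_cst// => h.
have := measure_ge0 gamma (residual `*` [set p i]).
rewrite le_eqVlt => /predU1P[<-//|g_gt0].
by rewrite gt0_mulye in h.
Qed.

Lemma weak_duality gamma w : concentrated gamma (Omega `*` Omega) ->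
  dual w <= energy gamma.
Proof.
move=> gO; have [->|] := eqVneq (energy gamma) +oo; first by rewrite leey.
rewrite -ltey => /(finite_energy_plan gO)[gs rmu snu rR].
by have [] := plan_ledgerW w gs rmu snu rR.
Qed.

Lemma conditions_of_no_gap gamma w : concentrated gamma (Omega `*` Omega) ->
  energy gamma < +oo -> energy gamma <= dual w ->
  [/\ condition_a Omega c p gamma w, condition_b Omega c F p mu gamma w &
      condition_c Omega c F p m gamma w].
Proof.
move=> gO fin ed; have [gs rmu snu rR] := finite_energy_plan gO fin.
have [_ /(_ fin ed) [gap1 gap2 gap3] _] := plan_ledgerW w gs rmu snu rR.
have cp : cell_plan Omega c p gamma w.
  by apply/(cost_gap_eq0P mOmega radial_c c_ge0 Omega_p).
split.
- by apply: (cell_plan_condition_a (mu := mu)).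
- split => //.
    by apply/(marginal_gap_eq0P mOmega radial_c c_ge0 Omega_p hF).
  by apply/(rate_residual mOmega radial_c Omega_p).
- move=> i; rewrite (mass_cell mOmega radial_c Omega_p p_inj overlaps gs)//.
  by move/(weight_gap_eq0P Omega p hF m_gt0) : gap3; exact.
Qed.

(** The last clause of the ledger covers infinite energy, so it remains to derive its side
    conditions: (a) puts the plan on the slices, and a [nu]-null set contains no [p i] because
    [m i > 0]. *)
Lemma no_gap_of_conditions gamma w :
  condition_a Omega c p gamma w -> condition_b Omega c F p mu gamma w ->
  condition_c Omega c F p m gamma w -> energy gamma <= dual w.
Proof.
move=> /(condition_aP mOmega radial_c Omega_p) ha [rmu hb hR] hc.
have gs : gamma (~` \bigcup_i slice i) = 0.
  rewrite ha; last exact: measurableC.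
  apply: big1 => i _; rewrite (_ : _ `&` _ = set0) ?measure0//.
  apply/seteqP; split => // x [/ysectionP nS [Ox _ _]]; apply: nS.
  by exists i => //; split.
have snu : marginal2 gamma `<< nu.
  apply/null_content_dominatesP => A mA nuA.
  have mA' : measurable (@snd 'rV[R]_d 'rV[R]_d @^-1` A).
    by rewrite -[X in measurable X]setTI; exact: measurable_snd.
  rewrite /marginal2 /pushforward ha//; apply: big1 => i _.
  rewrite (_ : _ `&` _ = set0) ?measure0//.
  apply/seteqP; split => // x [/ysectionP /= Api _].
  have : (m i)%:E <= 0.
    rewrite -nuA -(nu_p p_inj nuE); apply: le_measure; rewrite ?inE//.
    by move=> _ ->.
  by rewrite lee_fin leNgt m_gt0.
have rR : marginal1 gamma residual = 0.
  by apply/(rate_residual mOmega radial_c Omega_p rmu).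
have cp : cell_plan Omega c p gamma w.
  have mC i : measurable ((Omega `\` cell w i) `*` [set p i]).
    apply: measurableX => //; apply: measurableD => //.
    exact: measurable_laguerre_cell.
  move=> i; rewrite ha//; apply: big1 => j _.
  rewrite (_ : _ `&` _ = set0) ?measure0//.
  by apply/seteqP; split => // x [/ysectionP [/= [_ nCi] /p_inj ji]]; rewrite ji.
have [_ _] := plan_ledgerW w gs rmu snu rR; apply.
- by apply/(cost_gap_eq0P mOmega radial_c c_ge0 Omega_p).
- by apply/(marginal_gap_eq0P mOmega radial_c c_ge0 Omega_p hF).
- apply/(weight_gap_eq0P Omega p hF m_gt0) => i.
  have := hc i; rewrite (mass_cell mOmega radial_c Omega_p p_inj overlaps gs)//.
Qed.

End Optimality.

(** * The potential under a shift of one weight *)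

Section PotentialShift.
Context {R : realType} {d M : nat}.
Variables (Omega : set 'rV[R]_d) (c : 'rV[R]_d -> 'rV[R]_d -> \bar R).
Variables (p : 'I_M -> 'rV[R]_d).
Hypothesis c_ge0 : forall x y, Omega x -> Omega y -> 0 <= c x y.
Hypothesis Omega_p : forall i, Omega (p i).
Variable i : 'I_M.
Implicit Types (w : 'rV[R]_M) (x : 'rV[R]_d).

Local Notation cell := (laguerre_cell Omega c p).
Local Notation reached := (reached Omega c p).
Local Notation pot := (potential c p).

Definition shift_weight w (t : R) : 'rV[R]_M := (w + t *: delta_mx ord0 i)%R.

Lemma shiftE w t j : shift_weight w t ord0 j = (w ord0 j + t * (j == i)%:R)%R.
Proof. by rewrite !mxE eqxx. Qed.

Lemma potential_fin_ge w j x r : Omega x -> c x (p j) = r%:E ->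
  (w ord0 j - r <= pot w x)%R.
Proof.
move=> Ox cE; have := cost_gap_ge0 c_ge0 Omega_p w j Ox.
by rewrite cE -EFinD lee_fin; lra.
Qed.

Lemma reached_value w x : reached x ->
  exists j r, [/\ cell w j x, c x (p j) = r%:E & pot w x = (w ord0 j - r)%R].
Proof.
move=> rx; have [j Cj] := reached_cell c_ge0 Omega_p w rx.
exists j, (fine (c x (p j))); split => //.
  by rewrite fineK// (cell_fin_num c_ge0 Omega_p Cj).
by rewrite (potential_cell c_ge0 Omega_p Cj) /cell_potential addrC.
Qed.

Lemma potential_shift_le w t x : reached x -> (pot (shift_weight w t) x <= pot w x + `|t|)%R.
Proof.
move=> rx; have [j [r [Cj cr ->]]] := reached_value (shift_weight w t) rx.
have := potential_fin_ge w rx.1 cr; rewrite shiftE.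
have : (t * (j == i)%:R <= `|t|)%R.
  by case: (j == i); rewrite ?mulr1 ?mulr0// ler_norm.
lra.
Qed.

Lemma shiftK w t : shift_weight (shift_weight w t) (- t) = w.
Proof. by rewrite /shift_weight scaleNr addrK. Qed.

Lemma potential_shift_ge w t x : reached x -> (pot w x - `|t| <= pot (shift_weight w t) x)%R.
Proof.
by move=> rx; have := potential_shift_le (shift_weight w t) (- t) rx; rewrite shiftK normrN; lra.
Qed.

Lemma potential_shift_in w t x : (0 <= t)%R -> cell w i x ->
  pot (shift_weight w t) x = (pot w x + t)%R.
Proof.
move=> t0 Ci; have rx := cell_subset_reached Ci; apply/eqP; rewrite eq_le.
have cf := cell_fin_num c_ge0 Omega_p Ci.
apply/andP; split; first by rewrite -[X in (_ + X)%R](ger0_norm t0) potential_shift_le.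
rewrite (potential_cell c_ge0 Omega_p Ci) /cell_potential.
have := potential_fin_ge (shift_weight w t) rx.1 (esym (fineK cf)).
rewrite shiftE eqxx mulr1; lra.
Qed.

(** Off the cell the i-th candidate is below the maximum by a positive gap, and only a larger shift
    makes it win. The gap depends on [x], so the claim is not uniform. *)
Lemma potential_shift_out w x : reached x -> ~ cell w i x ->
  \forall t \near 0%R^'+, pot (shift_weight w t) x = pot w x.
Proof.
move=> rx nCi; have [j [r [Cj cr wE]]] := reached_value w rx.
have ji : j != i by apply: contra_notN nCi => /eqP <-.
have ge t : (pot w x <= pot (shift_weight w t) x)%R.
  have := potential_fin_ge (shift_weight w t) rx.1 cr.
  by rewrite shiftE (negbTE ji) mulr0 addr0 wE.
have gap_gt0 : 0 < c x (p i) + (pot w x - w ord0 i)%:E.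
  rewrite lt_neqAle (cost_gap_ge0 c_ge0 Omega_p)// ?andbT; last exact: rx.1.
  apply: contra_notN nCi => /eqP/esym.
  by move/(cost_gap_eq0 c_ge0 Omega_p w i rx.1).
have [e e0 gap_e] : exists2 e : R, (0 < e)%R & e%:E <= c x (p i) + (pot w x - w ord0 i)%:E.
  move: gap_gt0; case: (c x (p i) + _) => [g| |]//; first by exists g.
  by move=> _; exists 1%R => //; rewrite leey.
near=> t; apply/eqP; rewrite eq_le ge andbT.
have t0 : (0 < t)%R by near: t; exact: nbhs_right_gt.
have te : (t <= e)%R by near: t; exact: nbhs_right_le.
have [k [s [Ck cs ->]]] := reached_value (shift_weight w t) rx; rewrite shiftE.
have := potential_fin_ge w rx.1 cs.
have [ki|_] := eqVneq k i; last by rewrite mulr0; lra.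
subst k; move: gap_e; rewrite cs -EFinD lee_fin mulr1; lra.
Unshelve. all: by end_near. Qed.

Lemma potential_shift_neg_out w t x : reached x -> (0 <= t)%R -> ~ cell w i x ->
  pot (shift_weight w (- t)) x = pot w x.
Proof.
move=> rx t0 nCi; have [j [r [Cj cr wE]]] := reached_value w rx.
have ji : j != i by apply: contra_notN nCi => /eqP <-.
apply/eqP; rewrite eq_le; apply/andP; split.
  have [k [s [Ck cs ->]]] := reached_value (shift_weight w (- t)) rx; rewrite shiftE.
  have := potential_fin_ge w rx.1 cs.
  by case: (k == i); rewrite ?mulr1 ?mulr0; lra.
have := potential_fin_ge (shift_weight w (- t)) rx.1 cr.
by rewrite shiftE (negbTE ji) mulr0 addr0 wE.
Qed.

(** With a tie another index would keep the maximum at its old value. Without ties the finitely many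
    gaps to the other candidates are positive, and a small shift leaves the i-th one ahead. *)
Lemma potential_shift_neg_in w x : cell w i x -> (forall j, cell w j x -> j = i) ->
  \forall t \near 0%R^'+, pot (shift_weight w (- t)) x = (pot w x - t)%R.
Proof.
move=> Ci uniq; have rx := cell_subset_reached Ci.
have gap_gt0 j : j != i -> exists2 e : R, (0 < e)%R &
    e%:E <= c x (p j) + (pot w x - w ord0 j)%:E.
  move=> ji; have : 0 < c x (p j) + (pot w x - w ord0 j)%:E.
    rewrite lt_neqAle (cost_gap_ge0 c_ge0 Omega_p)// ?andbT; last exact: rx.1.
    apply: contraNN ji => /eqP/esym.
    by move/(cost_gap_eq0 c_ge0 Omega_p w j rx.1)/uniq => ->.
  case: (c x (p j) + _) => [g| |]//; first by exists g.
  by move=> _; exists 1%R => //; rewrite leey.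
have small : \forall t \near 0%R^'+, forall j, j != i ->
    t%:E <= c x (p j) + (pot w x - w ord0 j)%:E.
  apply: filter_forall => j; have [->|ji] := eqVneq j i; first exact: nearW.
  have [e e0 he] := gap_gt0 j ji; near=> t => _; apply: le_trans he.
  by rewrite lee_fin; near: t; exact: nbhs_right_le.
near=> t; have t0 : (0 < t)%R by near: t; exact: nbhs_right_gt.
apply/eqP; rewrite eq_le; apply/andP; split; last first.
  by have := potential_shift_ge w (- t)%R rx; rewrite normrN gtr0_norm.
have [k [s [Ck cs ->]]] := reached_value (shift_weight w (- t)) rx; rewrite shiftE.
have := potential_fin_ge w rx.1 cs.
have [_|ki] := eqVneq k i; first by rewrite mulr1; lra.
have : t%:E <= c x (p k) + (pot w x - w ord0 k)%:E.
  by move: k ki {s Ck cs}; near: t.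
by rewrite cs -EFinD lee_fin mulr0; lra.
Unshelve. all: by end_near. Qed.

End PotentialShift.

Lemma near_right_natSinv (R : realType) (P : R -> Prop) :
  (\forall t \near 0%R^'+, P t) -> \forall n \near \oo, P (n.+1%:R^-1)%R.
Proof.
move=> [e /= e0 eP]; near=> n; apply: eP => /=; last by rewrite invr_gt0.
rewrite sub0r normrN gtr0_norm ?invr_gt0//.
by near: n; exact: (near_infty_natSinv_lt (PosNum e0)).
Unshelve. all: by end_near. Qed.

(** Slopes of a nondecreasing convex function are nonnegative and largest at the right end, whence a
    Lipschitz bound on []-oo, K]]. *)
Lemma slope_bound (R : realType) (f : R -> R) (K u v : R) :
  convex_on_line f -> {homo f : x y / (x <= y)%R} ->
  (u <= K)%R -> (v <= K)%R ->
  (`|f u - f v| <= right_slope f K * `|u - v|)%R.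
Proof.
move=> cf f_nd; wlog vu : u v / (v <= u)%R => [hw uK vK|uK vK].
  have [/hw|/ltW/hw] := leP v u; first exact.
  by move=> h; rewrite distrC [X in (_ * X)%R]distrC; exact: h.
rewrite !ger0_norm ?subr_ge0//; last exact: f_nd.
have := right_slope_subgradient cf u v.
have := right_slope_nd cf uK.
have : (0 <= u - v)%R by rewrite subr_ge0.
set s := right_slope f u; set t := right_slope f K => uv0 st hs.
have := ler_wpM2r uv0 st; lra.
Qed.

(** * First-order conditions at optimal weights *)

Section FirstOrder.
Context {R : realType} {d M : nat}.
Variables (Omega : set 'rV[R]_d) (c : 'rV[R]_d -> 'rV[R]_d -> \bar R).
Variables (p : 'I_M -> 'rV[R]_d) (F : R -> \bar R).
Variables (mu : {finite_measure set 'rV[R]_d -> \bar R}) (m : 'I_M -> R).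
Hypothesis mOmega : measurable Omega.
Hypothesis radial_c : radial_cost Omega c.
Hypothesis c_ge0 : forall x y, Omega x -> Omega y -> 0 <= c x y.
Hypothesis Omega_p : forall i, Omega (p i).
Hypothesis overlaps : null_overlaps Omega c p mu.
Hypothesis hF : entropy_function F.
Variable w : 'rV[R]_M.
Hypothesis dual_fin : forall w', dual_objective Omega c F p mu m w' < +oo.
Hypothesis w_opt : optimal_weights Omega c F p mu m w.
Variable i : 'I_M.

Local Notation cell := (laguerre_cell Omega c p).
Local Notation residual := (residual_set Omega c p).
Local Notation reached := (reached Omega c p).
Local Notation pot := (potential c p).
Local Notation Fs := (rconjugate F).
Local Notation shift := (shift_weight i w).

(** The added 1 makes [K0] a bound for all weights shifted by [|t| <= 1], so that one constant
    serves the whole limit. *)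
Let K0 : R := (\sum_(j < M) `|w ord0 j| + 1)%R.
Let K : R := Num.max (Fs K0) 0%R.
Let b (w' : 'rV[R]_M) : R := (\sum_(j < M) Fs (- w' ord0 j) * m j)%R.

Let mreach : measurable reached.
Proof. exact: measurable_reached. Qed.

Let mcell : measurable (cell w i).
Proof. exact: measurable_laguerre_cell. Qed.

Let cF : convex_on_line Fs.
Proof. exact: rconjugate_convex. Qed.

Let pot_le t x : (`|t| <= 1)%R -> reached x -> (pot (shift t) x <= K0)%R.
Proof.
move=> t1 rx; apply: (potential_le c_ge0 Omega_p); last exact: rx.1; last first.
  by rewrite addr_ge0// sumr_ge0.
move=> j; rewrite shiftE lerD//.
  by rewrite (le_trans (ler_norm _))// (bigD1 j)//= lerDl sumr_ge0.
case: (j == i); rewrite ?mulr1 ?mulr0 ?ler01//.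
exact: le_trans (ler_norm _) t1.
Qed.

Let shift0 : shift 0%R = w.
Proof. by rewrite /shift_weight scale0r addr0. Qed.

Let FK t x : (`|t| <= 1)%R -> reached x -> (Fs (pot (shift t) x) <= K)%R.
Proof.
move=> t1 rx; rewrite /K le_max; apply/orP; left.
by apply: rconjugate_nd => //; exact: pot_le.
Qed.

Let mFs w' : measurable_fun reached (fun x => Fs (pot w' x)).
Proof. exact: measurable_rconjugate_potential. Qed.

Let excess_ge0 t x : (`|t| <= 1)%R -> reached x -> 0 <= (K - Fs (pot (shift t) x))%:E.
Proof. by move=> t1 rx; rewrite lee_fin subr_ge0 FK. Qed.

Let dualE t : (`|t| <= 1)%R -> dual_objective Omega c F p mu m (shift t) =
  \int[mu]_(x in reached) (K - Fs (pot (shift t) x))%:E -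
  (K * fine (mu reached) + b (shift t))%:E + F 0%R * mu residual.
Proof. by move=> t1; apply: dual_objectiveE => // x rx; exact: FK. Qed.

(** The dual value is this integral plus a real number and a nonnegative term, so its finiteness
    bounds the integral. *)
Let excess_integrable t : (`|t| <= 1)%R ->
  mu.-integrable reached (EFin \o (fun x => K - Fs (pot (shift t) x))%R).
Proof.
move=> t1; apply/integrableP; split.
  by apply/measurable_EFinP; exact: measurable_funB.
rewrite (eq_integral (fun x => (K - Fs (pot (shift t) x))%:E)); last first.
  by move=> x; rewrite inE => rx; rewrite gee0_abs//; exact: excess_ge0.
have := dual_fin (shift t); rewrite dualE//.
have := integral_ge0 mu (fun x rx => @excess_ge0 t x t1 rx).
have : 0 <= F 0%R * mu residual by rewrite mule_ge0// entropy_ge0.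
case: (integral _ _ _) => [r| |]//; first by rewrite ltry.
by case: (F 0%R * _).
Qed.

(** Optimality of [w] against the shifted weights, after cancelling [F 0%R * mu residual], finite
    because the dual value is. *)
Let excess_le t : (`|t| <= 1)%R ->
  \int[mu]_(x in reached) (Fs (pot w x) - Fs (pot (shift t) x))%:E <=
  (m i * (Fs (- w ord0 i - t) - Fs (- w ord0 i)))%:E.
Proof.
move=> t1; have z1 : (`|0 : R| <= 1)%R by rewrite normr0 ler01.
have bE : (m i * (Fs (- w ord0 i - t) - Fs (- w ord0 i)) = b (shift t) - b w)%R.
  rewrite /b -sumrB (bigD1 i)//= big1 ?addr0 => [|j ji].
    by rewrite shiftE eqxx mulr1 opprD; lra.
  by rewrite shiftE (negbTE ji) mulr0 addr0 subrr.
rewrite bE.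
rewrite (eq_integral (fun x => ((K - Fs (pot (shift t) x)) -
    (K - Fs (pot (shift 0%R) x)))%:E)); last first.
  by move=> x _; rewrite shift0; congr EFin; lra.
have it := excess_integrable t1; have i0 := excess_integrable z1.
rewrite (integralB_EFin mreach it i0).
have := w_opt (shift t); have := dual_fin w.
rewrite -{1 3}shift0 !dualE// shift0.
have := integrable_fin_num mreach it; have := integrable_fin_num mreach i0.
have : 0 <= F 0%R * mu residual by rewrite mule_ge0// entropy_ge0.
rewrite /= shift0.
case: (\int[mu]_(x in reached) (K - Fs (pot (shift t) x))%:E) => [u| |]//.
case: (\int[mu]_(x in reached) (K - Fs (pot w x))%:E) => [v| |]//.
case: (F 0%R * _) => [f| |]// _ _ _ _.
by rewrite -!EFinB -!EFinD !lee_fin; lra.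
Qed.

Let q t x : R := ((Fs (pot (shift t) x) - Fs (pot w x)) / t)%R.

(** A shift by [t] moves the potential by at most [|t|], and [slope_bound] turns this into a
    constant dominating all quotients. *)
Let q_le t x : (`|t| <= 1)%R -> t != 0%R -> reached x ->
  (`|q t x| <= right_slope Fs K0)%R.
Proof.
move=> t1 t0 rx; have z1 : (`|0 : R| <= 1)%R by rewrite normr0 ler01.
have hb := slope_bound cF (rconjugate_nd hF) (pot_le t1 rx) (pot_le z1 rx).
rewrite shift0 in hb.
rewrite /q normrM normfV ler_pdivrMr ?normr_gt0//.
apply: le_trans hb _; apply: ler_wpM2l.
  apply: le_trans (right_slope_ge cF _ (_ : -1 < 0)%R); last by rewrite oppr_lt0 ltr01.
  rewrite /slope invrN1 mulrN1 opprB subr_ge0.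
  by apply: rconjugate_nd => //; rewrite lerBlDr lerDl ler01.
have := potential_shift_le c_ge0 Omega_p i w t rx.
have := potential_shift_ge c_ge0 Omega_p i w t rx.
by rewrite ler_norml => *; apply/andP; split; lra.
Qed.

Let mq t : measurable_fun reached (q t).
Proof. by apply: measurable_funM => //; exact: measurable_funB. Qed.

Let q_integral t : (`|t| <= 1)%R -> t != 0%R ->
  (- t)%:E * \int[mu]_(x in reached) (q t x)%:E <=
  (m i * (Fs (- w ord0 i - t) - Fs (- w ord0 i)))%:E.
Proof.
move=> t1 t0; apply: le_trans (excess_le t1).
rewrite -integralZl//.
  rewrite le_eqVlt; apply/orP; left; apply/eqP; apply: eq_integral => x _.
  by rewrite -EFinM /q; congr EFin; field.
apply: measurable_bounded_integrable => //.
  by rewrite ltey_eq fin_num_measure.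
exists (right_slope Fs K0); split; first exact: num_real.
by move=> N KN x rx; apply: le_trans (ltW KN); exact: q_le.
Qed.

(** Dominated convergence: off the i-th cell the quotients vanish eventually, so only the integral
    over the cell survives. *)
Let q_cvg (u : nat -> R) (rs : 'rV[R]_d -> R) :
  (forall n, (`|u n| <= 1)%R) -> (forall n, u n != 0%R) ->
  measurable_fun reached rs ->
  {ae mu, forall x, reached x -> cell w i x -> q (u n) x @[n --> \oo] --> rs x} ->
  (forall x, reached x -> ~ cell w i x -> \forall n \near \oo, q (u n) x = 0%R) ->
  \int[mu]_(x in reached) (q (u n) x)%:E @[n --> \oo] -->
  \int[mu]_(x in cell w i) (rs x)%:E.
Proof.
move=> u1 u0 mrs q_in q_out.
have -> : \int[mu]_(x in cell w i) (rs x)%:E =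
    \int[mu]_(x in reached) ((EFin \o rs) \_ (cell w i)) x.
  rewrite -integral_mkcondr setIidr//.
  by move=> x; exact: cell_subset_reached.
have [] := @dominated_convergence _ _ _ mu reached mreach
  (fun n x => (q (u n) x)%:E) ((EFin \o rs) \_ (cell w i))
  (cst (right_slope Fs K0)%:E) => //.
- by move=> n; apply/measurable_EFinP.
- apply/(measurable_restrict _ mcell mreach).
  apply: (measurable_funS mreach) => [x []//|].
  exact/measurable_EFinP.
- move: q_in; apply: filterS => x q_in rx; rewrite patchE.
  case: ifPn => [|/negP]; rewrite inE => Cx.
    by apply: cvg_EFin; [exact: nearW|exact: q_in].
  apply: cvg_near_cst; have := q_out x rx Cx.
  by apply: filterS => n ->.
- exact: finite_measure_integrable_cst.
- by apply: nearW => x n rx; rewrite lee_fin; exact: q_le.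
Qed.

(** Raising [w_i] by [t > 0] raises the potential by [t] on the whole cell, ties included, and
    lowers [- w_i] by [t]: hence a right slope on one side and a left slope on the other. *)
Lemma first_order_right :
  (m i * left_slope Fs (- w ord0 i))%:E <=
  \int[mu]_(x in cell w i) (right_slope Fs (pot w x))%:E.
Proof.
have u0 n : (n.+1%:R^-1 != 0 :> R)%R by rewrite invr_eq0 pnatr_eq0.
have up n : (0 < n.+1%:R^-1 :> R)%R by rewrite invr_gt0.
have u1 n : (`|n.+1%:R^-1 : R| <= 1)%R.
  by rewrite gtr0_norm// invf_le1 ?ltr0n// ler1n.
have cvgI : \int[mu]_(x in reached) (q (n.+1%:R^-1)%R x)%:E @[n --> \oo] -->
    \int[mu]_(x in cell w i) (right_slope Fs (pot w x))%:E.
  apply: q_cvg => //.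
  - apply: (@measurable_comp _ _ _ _ _ _ setT) => //.
      by apply: nondecreasing_measurable => //; exact: right_slope_nd.
    exact: measurable_potential_reached.
  - apply: nearW => x rx Cx.
    rewrite (_ : (fun n => _) = (fun n => slope Fs (pot w x) n.+1%:R^-1)%R).
      exact: cvg_right_slope.
    apply/funext => n.
    by rewrite /q /slope (potential_shift_in c_ge0 Omega_p (ltW (up n)) Cx).
  - move=> x rx Cx; have := potential_shift_out c_ge0 Omega_p rx Cx.
    move=> /near_right_natSinv; apply: filterS => n e.
    by rewrite /q e subrr mul0r.
have cvgS : (m i * slope Fs (- w ord0 i) (- n.+1%:R^-1))%:E @[n --> \oo] -->
    (m i * left_slope Fs (- w ord0 i))%:E.
  apply: cvg_EFin; first exact: nearW.
  by apply: cvgMr; exact: cvg_left_slope.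
rewrite -(cvg_lim _ cvgI)// -(cvg_lim _ cvgS)//.
apply: lee_lim; [by apply/cvg_ex; eexists; exact: cvgS|
  by apply/cvg_ex; eexists; exact: cvgI|].
apply: nearW => n; have := q_integral (u1 n) (u0 n).
rewrite EFinN mulNe leeNl -EFinN => h.
rewrite -(@lee_pmul2l _ (n.+1%:R^-1)%:E)//.
apply: le_trans h; rewrite -EFinM lee_fin /slope.
rewrite le_eqVlt; apply/orP; left; apply/eqP; field.
by rewrite -invr_eq0.
Qed.

Lemma first_order_left :
  \int[mu]_(x in cell w i) (left_slope Fs (pot w x))%:E <=
  (m i * right_slope Fs (- w ord0 i))%:E.
Proof.
have u0 n : (- n.+1%:R^-1 != 0 :> R)%R by rewrite oppr_eq0 invr_eq0 pnatr_eq0.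
have up n : (0 < n.+1%:R^-1 :> R)%R by rewrite invr_gt0.
have u1 n : (`|- n.+1%:R^-1 : R| <= 1)%R.
  by rewrite normrN gtr0_norm// invf_le1 ?ltr0n// ler1n.
have cvgI : \int[mu]_(x in reached) (q (- n.+1%:R^-1)%R x)%:E @[n --> \oo] -->
    \int[mu]_(x in cell w i) (left_slope Fs (pot w x))%:E.
  apply: q_cvg => //.
  - apply: (@measurable_comp _ _ _ _ _ _ setT) => //.
      by apply: nondecreasing_measurable => //; exact: left_slope_nd.
    exact: measurable_potential_reached.
  - have mcells j : measurable (cell w j) by exact: measurable_laguerre_cell.
    (* Lowering [w_i] lowers the potential only where i is the sole maximiser; by the null overlaps
       this is almost everywhere on the cell. *)
    have := ae_unique_cell mcells (fun j k => overlaps w (i := j) (j := k)).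
    apply: filterS => x uniq rx Cx.
    have near_eq : \forall n \near \oo,
        slope Fs (pot w x) (- n.+1%:R^-1)%R = q (- n.+1%:R^-1)%R x.
      have := potential_shift_neg_in c_ge0 Omega_p Cx (fun j Cj => uniq _ _ Cj Cx).
      by move=> /near_right_natSinv; apply: filterS => n; rewrite /q /slope => ->.
    apply: (@cvg_trans _ (slope Fs (pot w x) (- n.+1%:R^-1)%R @[n --> \oo])).
      exact: near_eq_cvg.
    exact: cvg_left_slope.
  - move=> x rx Cx; apply: nearW => n.
    by rewrite /q (potential_shift_neg_out c_ge0 Omega_p rx (ltW (up n)) Cx) subrr mul0r.
have cvgS : (m i * slope Fs (- w ord0 i) (n.+1%:R^-1))%:E @[n --> \oo] -->
    (m i * right_slope Fs (- w ord0 i))%:E.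
  apply: cvg_EFin; first exact: nearW.
  by apply: cvgMr; exact: cvg_right_slope.
rewrite -(cvg_lim _ cvgI)// -(cvg_lim _ cvgS)//.
apply: lee_lim; [by apply/cvg_ex; eexists; exact: cvgI|
  by apply/cvg_ex; eexists; exact: cvgS|].
apply: nearW => n; have := q_integral (u1 n) (u0 n).
rewrite opprK => h.
rewrite -(@lee_pmul2l _ (n.+1%:R^-1)%:E)//.
apply: (le_trans h); rewrite -EFinM lee_fin /slope.
rewrite le_eqVlt; apply/orP; left; apply/eqP; field.
by rewrite -invr_eq0.
Qed.

End FirstOrder.

(** * Plans given by densities on the slices *)

Section GraphPlan.
Context {R : realType} {d M : nat}.
Variables (mu : {finite_measure set 'rV[R]_d -> \bar R}) (p : 'I_M -> 'rV[R]_d).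
Variable f : 'I_M -> 'rV[R]_d -> \bar R.

(** The sum over [i] of the measure with density [f i] times the Dirac mass at [p i]. The properties
    of [f] are arguments so that the measure instances can be attached to the term. *)
Definition graph_plan (f_ge0 : forall i x, 0 <= f i x)
    (mf : forall i, measurable_fun setT (f i))
    (f_fin : forall i, \int[mu]_x f i x < +oo)
    (A : set ('rV[R]_d * 'rV[R]_d)%type) : \bar R :=
  \sum_(i < M) \int[mu]_(x in ysection A (p i)) f i x.

Hypothesis f_ge0 : forall i x, 0 <= f i x.
Hypothesis mf : forall i, measurable_fun setT (f i).
Hypothesis f_fin : forall i, \int[mu]_x f i x < +oo.

Local Notation plan := (graph_plan f_ge0 mf f_fin).

Let plan0 : plan set0 = 0.
Proof. by rewrite /graph_plan big1// => i _; rewrite ysection0 integral_set0. Qed.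

Let plan_ge0 A : 0 <= plan A.
Proof. by apply: sume_ge0 => i _; exact: integral_ge0. Qed.

Let plan_sigma_additive : semi_sigma_additive plan.
Proof.
move=> A mA tA mUA.
rewrite (_ : (fun n => _) = (fun n => \sum_(i < M)
    \sum_(0 <= k < n) \int[mu]_(x in ysection (A k) (p i)) f i x)); last first.
  by apply/funext => n; rewrite exchange_big.
apply: cvg_nnesum => i _.
  by apply: nearW => n; apply: sume_ge0 => k _; exact: integral_ge0.
rewrite ysection_bigcup ge0_integral_bigcup//.
- apply: is_cvg_ereal_nneg_natsum => k _; exact: integral_ge0.
- by move=> k; exact: measurable_ysection.
- exact: measurable_funTS.
- exact: trivIset_ysection.
Qed.

HB.instance Definition _ := isMeasure.Build _ _ _ plan
  plan0 plan_ge0 plan_sigma_additive.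

Let plan_fin : fin_num_fun plan.
Proof.
move=> A mA; rewrite ge0_fin_numE//; apply: lte_sum_pinfty => i _.
apply: le_lt_trans (f_fin i); apply: ge0_subset_integral => //.
exact: measurable_ysection.
Qed.

HB.instance Definition _ := Measure_isFinite.Build _ _ _ plan plan_fin.

End GraphPlan.

Lemma interval_mix (R : realType) (a b l u : R) :
  (a <= b)%R -> (l <= u)%R -> (l <= b)%R -> (a <= u)%R ->
  exists t : R, (0 <= t <= 1)%R /\ (l <= (1 - t) * a + t * b <= u)%R.
Proof.
move=> ab lu lb au; have [eab|nab] := eqVneq a b.
  by exists 0%R; rewrite lexx ler01 subr0 mul1r mul0r addr0 au eab lb.
have ab0 : (0 < b - a)%R by rewrite subr_gt0 lt_neqAle nab.
(* The least common point of [[a, b]] and [[l, u]]. *)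
pose v := Num.max a l.
have va : (a <= v)%R by rewrite le_max lexx.
have vl : (l <= v)%R by rewrite le_max lexx orbT.
have vb : (v <= b)%R by rewrite ge_max ab.
have vu : (v <= u)%R by rewrite ge_max au.
exists ((v - a) / (b - a))%R; split.
  apply/andP; split; first by rewrite divr_ge0 ?subr_ge0.
  by rewrite ler_pdivrMr// mul1r; lra.
rewrite (_ : (1 - _) * a + _ = v)%R ?vl ?vu//.
by field; rewrite gt_eqF.
Qed.

(** * Construction of a plan without duality gap *)

Section OptimalPlanExists.
Context {R : realType} {d M : nat}.
Variables (Omega : set 'rV[R]_d) (c : 'rV[R]_d -> 'rV[R]_d -> \bar R).
Variables (p : 'I_M -> 'rV[R]_d) (F : R -> \bar R).
Variables (mu : {finite_measure set 'rV[R]_d -> \bar R}) (m : 'I_M -> R).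
Hypothesis mOmega : measurable Omega.
Hypothesis radial_c : radial_cost Omega c.
Hypothesis c_ge0 : forall x y, Omega x -> Omega y -> 0 <= c x y.
Hypothesis Omega_p : forall i, Omega (p i).
Hypothesis overlaps : null_overlaps Omega c p mu.
Hypothesis hF : entropy_function F.
Hypothesis m_gt0 : forall i, (0 < m i)%R.
Variable w : 'rV[R]_M.

Local Notation cell := (laguerre_cell Omega c p).
Local Notation residual := (residual_set Omega c p).
Local Notation reached := (reached Omega c p).
Local Notation pot := (potential c p).
Local Notation Fs := (rconjugate F).
Local Notation plan_type := {finite_measure set ('rV[R]_d * 'rV[R]_d)%type -> \bar R}.

Hypothesis right_cond : forall i, (m i * left_slope Fs (- w ord0 i))%:E <=
  \int[mu]_(x in cell w i) (right_slope Fs (pot w x))%:E.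
Hypothesis left_cond : forall i, \int[mu]_(x in cell w i) (left_slope Fs (pot w x))%:E <=
  (m i * right_slope Fs (- w ord0 i))%:E.

Let mreach : measurable reached.
Proof. exact: measurable_reached. Qed.

Let mcell i : measurable (cell w i).
Proof. exact: measurable_laguerre_cell. Qed.

Let cF : convex_on_line Fs.
Proof. exact: rconjugate_convex. Qed.

Lemma left_slope_ge0 z : (0 <= left_slope Fs z)%R.
Proof.
apply: le_trans (left_slope_ge cF z (_ : -1 < 0)%R); last by rewrite oppr_lt0 ltr01.
rewrite /slope invrN1 mulrN1 opprB subr_ge0.
by apply: rconjugate_nd => //; rewrite lerBlDr lerDl ler01.
Qed.

Lemma right_slope_ge0 z : (0 <= right_slope Fs z)%R.
Proof. exact: le_trans (left_slope_ge0 z) (left_slope_le_right cF z). Qed.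

Lemma integrable_slope i (s : R -> R) : {homo s : x y / (x <= y)%R} ->
  (forall z, (0 <= s z)%R) ->
  mu.-integrable (cell w i) (EFin \o (s \o pot w)).
Proof.
move=> s_nd s0.
pose K0 := (\sum_(j < M) `|w ord0 j|)%R.
have K00 : (0 <= K0)%R by apply: sumr_ge0.
have wK j : (w ord0 j <= K0)%R.
  by rewrite (le_trans (ler_norm _))// /K0 (bigD1 j)//= lerDl sumr_ge0.
apply: measurable_bounded_integrable => //.
- by rewrite ltey_eq fin_num_measure.
- apply: (measurable_funS mreach); first exact: cell_subset_reached.
  apply: (@measurable_comp _ _ _ _ _ _ setT) => //.
    by apply: nondecreasing_measurable.
  exact: measurable_potential_reached.
- exists (s K0); split; first exact: num_real.
  move=> N KN x Cx; apply: le_trans (ltW KN).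
  rewrite ger0_norm//=; apply: s_nd; apply: (potential_le c_ge0 Omega_p) => //.
  by case: Cx.
Qed.

(** Mixing the slopes gives the i-th cell any mass between the two integrals. The subgradients at
    [- w_i] form the interval between the one-sided slopes. The first-order conditions say that this
    interval meets that of the masses divided by [m i]. *)
Lemma exists_mixture : exists t : 'I_M -> R, forall i, [/\ (0 <= t i <= 1)%R &
  subgradient Fs (- w ord0 i)
   ((1 - t i) * (fine (\int[mu]_(x in cell w i) (left_slope Fs (pot w x))%:E) / m i) +
    t i * (fine (\int[mu]_(x in cell w i) (right_slope Fs (pot w x))%:E) / m i))%R].
Proof.
suff /choice[t ht] : forall i, exists t : R, [/\ (0 <= t <= 1)%R &
  subgradient Fs (- w ord0 i)
   ((1 - t) * (fine (\int[mu]_(x in cell w i) (left_slope Fs (pot w x))%:E) / m i) +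
    t * (fine (\int[mu]_(x in cell w i) (right_slope Fs (pot w x))%:E) / m i))%R].
  by exists t.
move=> i.
have il : mu.-integrable (cell w i) (EFin \o (left_slope Fs \o pot w)).
  by apply: integrable_slope; [exact: left_slope_nd|exact: left_slope_ge0].
have ir : mu.-integrable (cell w i) (EFin \o (right_slope Fs \o pot w)).
  by apply: integrable_slope; [exact: right_slope_nd|exact: right_slope_ge0].
have fl := integrable_fin_num (mcell i) il; have fr := integrable_fin_num (mcell i) ir.
have lr : \int[mu]_(x in cell w i) (left_slope Fs (pot w x))%:E <=
    \int[mu]_(x in cell w i) (right_slope Fs (pot w x))%:E.
  apply: le_integral => // x _; rewrite lee_fin; exact: left_slope_le_right.
have := left_cond i; have := right_cond i; move: lr fl fr => /=.
case: (\int[mu]_(x in cell w i) (left_slope Fs (pot w x))%:E) => [a| |]//.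
case: (\int[mu]_(x in cell w i) (right_slope Fs (pot w x))%:E) => [b| |]//.
rewrite !lee_fin /= => ab _ _ lb au.
have lu := left_slope_le_right cF (- w ord0 i)%R.
have mi := m_gt0 i.
have hab : (a / m i <= b / m i)%R by rewrite ler_pM2r ?invr_gt0.
have hlb : (left_slope Fs (- w ord0 i) <= b / m i)%R by rewrite ler_pdivlMr// mulrC.
have hau : (a / m i <= right_slope Fs (- w ord0 i))%R by rewrite ler_pdivrMr// mulrC.
have [t [t01 /andP[tl tu]]] := interval_mix hab lu hlb hau.
exists t; split => //.
apply: subgradientP => s s0.
  exact: le_trans tu (right_slope_le cF _ s0).
exact: le_trans (left_slope_ge cF _ s0) tl.
Qed.

(* On the i-th cell the density is a mixture of the one-sided slopes of the
   conjugate, both of which lie in its subdifferential; the first-order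
   conditions allow to choose the mixing parameter so that (c) holds. *)
Lemma exists_plan : exists gamma : plan_type,
  [/\ concentrated gamma (Omega `*` Omega), condition_a Omega c p gamma w,
      condition_b Omega c F p mu gamma w & condition_c Omega c F p m gamma w].
Proof.
have [t ht] := exists_mixture.
pose r i x := ((1 - t i) * left_slope Fs (pot w x) + t i * right_slope Fs (pot w x))%R.
have r0 i x : (0 <= r i x)%R.
  have [/andP[t0 t1] _] := ht i.
  by rewrite addr_ge0// mulr_ge0 ?left_slope_ge0 ?right_slope_ge0// subr_ge0.
have il i : mu.-integrable (cell w i) (EFin \o (left_slope Fs \o pot w)).
  by apply: integrable_slope; [exact: left_slope_nd|exact: left_slope_ge0].
have ir i : mu.-integrable (cell w i) (EFin \o (right_slope Fs \o pot w)).
  by apply: integrable_slope; [exact: right_slope_nd|exact: right_slope_ge0].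
have rI i : \int[mu]_(x in cell w i) (r i x)%:E =
    ((1 - t i) * fine (\int[mu]_(x in cell w i) (left_slope Fs (pot w x))%:E) +
     t i * fine (\int[mu]_(x in cell w i) (right_slope Fs (pot w x))%:E))%:E.
  have := integralD (mcell i) (integrableZl (mcell i) (1 - t i)%R (il i))
    (integrableZl (mcell i) (t i) (ir i)).
  have fl := integrable_fin_num (mcell i) (il i).
  have fr := integrable_fin_num (mcell i) (ir i).
  rewrite !integralZl// => h; rewrite EFinD !EFinM (fineK fl) (fineK fr).
  exact: h.
have mr i : measurable_fun (cell w i) (EFin \o r i).
  have := emeasurable_funD (measurable_int _ (integrableZl (mcell i) (1 - t i)%R (il i)))
    (measurable_int _ (integrableZl (mcell i) (t i) (ir i))).
  exact.
pose f i := (EFin \o r i) \_ (cell w i).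
have f0 i x : 0 <= f i x by rewrite /f patchE; case: ifPn => // _; rewrite lee_fin.
have mf i : measurable_fun setT (f i).
  by apply/measurable_restrict => //; rewrite setTI.
have ffin i : \int[mu]_x f i x < +oo.
  by rewrite /f -integral_mkcond rI ltry.
pose gamma : plan_type := graph_plan p f0 mf ffin.
pose g x := \sum_(i < M) f i x.
have g0 x : 0 <= g x by apply: sume_ge0.
have mg : measurable_fun setT g by exact: emeasurable_sum.
have rhoE (B : set 'rV[R]_d) : measurable B -> marginal1 gamma B = \int[mu]_(x in B) g x.
  move=> mB; rewrite /g ge0_integral_sum//; last by move=> i; exact: measurable_funTS.
  apply: eq_bigr => i _; congr (integral _ _ _).
  by apply/seteqP; split => x; [move=> /ysectionP|move=> Bx; apply/ysectionP].
have rmu : marginal1 gamma `<< mu.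
  apply/null_content_dominatesP => B mB B0; rewrite rhoE//.
  by apply: null_set_integral => //; exact: measurable_funTS.
have cell_g : {ae mu, forall x, forall i, cell w i x -> g x = (r i x)%:E}.
  have := ae_unique_cell mcell (fun j k => overlaps w (i := j) (j := k)).
  apply: filterS => x uniq i Ci; rewrite /g (bigD1 i)//= big1 ?adde0.
    by rewrite /f patchE mem_set.
  move=> j ji; rewrite /f patchE memNset// => Cj.
  by move/eqP : ji; apply; exact: uniq.
have rho_cell_f (B : set 'rV[R]_d) i : measurable B ->
    marginal1 gamma (B `&` cell w i) = \int[mu]_(x in B) f i x.
  move=> mB; rewrite rhoE; last exact: measurableI.
  rewrite /f -integral_mkcondr; apply: ge0_ae_eq_integral => //.
  - exact: measurableI.
  - exact: measurable_funTS.
  - by apply: (measurable_funS (mcell i)) => // x [].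
  - by move=> x _; rewrite lee_fin.
  - by move: cell_g; apply: filterS => x gE [_ Ci]; exact: gE.
(* The Radon-Nikodym derivative and [g] have the same integral over every measurable set. *)
have dens : {ae mu, forall x, density (marginal1 gamma) mu x = fine (g x)}.
  have : ae_eq mu setT (Radon_Nikodym (charge_of_finite_measure (marginal1 gamma)) mu) g.
    apply: integral_ae_eq => //.
      exact: Radon_Nikodym_integrable.
    by move=> E _ mE; rewrite -Radon_Nikodym_integral//; exact: rhoE.
  by apply: filterS => x /(_ I) gx; rewrite /density gx.
exists gamma; split.
- rewrite /concentrated /gamma /= /graph_plan big1// => i _.
  apply: integral0_eq => x /ysectionP nO; rewrite /f patchE memNset// => -[Ox _ _].
  by apply: nO; split => //=; exact: Omega_p.
- apply/(condition_aP mOmega radial_c Omega_p) => A mA.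
  apply: eq_bigr => i _; rewrite rho_cell_f//; exact: measurable_ysection.
- split => //.
    move=> i; move: dens cell_g; apply: filterS2 => x dE gE Ci.
    rewrite dE (gE i Ci) /= -(potential_cell c_ge0 Omega_p Ci).
    apply/(subdifferentialP hF); apply: subgradient_convex.
    + exact: left_slope_subgradient.
    + exact: right_slope_subgradient.
    + by have [] := ht i.
  move: dens; apply: filterS => x dE Rx; rewrite dE /g big1// => i _.
  by rewrite /f patchE memNset// => /cell_subset_reached[].
- move=> i; apply/(subdifferentialP hF).
  rewrite -[cell w i]setTI rho_cell_f// /f -integral_mkcond rI /=.
  by rewrite mulrDl -!mulrA; have [] := ht i.
Qed.

End OptimalPlanExists.

Unset Implicit Arguments.

Theorem theorem3p3 (R : realType) (d : nat) (U Omega : set 'rV[R]_d)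
  (hU : open U) (hOmega : Omega = closure U)
  (F : R -> \bar R) (hF : entropy_function F)
  (c : 'rV[R]_d -> 'rV[R]_d -> \bar R)
  (hc : cost_function Omega c) (hrad : radial_cost Omega c)
  (mu nu : {finite_measure set 'rV[R]_d -> \bar R})
  (hmu : concentrated mu Omega) (hnu : concentrated nu Omega)
  (hmuL : mu `<< @lebesgue_rV R d)
  (M : nat) (m : 'I_M -> R) (p : 'I_M -> 'rV[R]_d)
  (hm : forall i, (0 < m i)%R) (hp : forall i, Omega (p i)) (hinj : injective p)
  (hnuE : forall A, measurable A -> nu A = \sum_(i < M) (m i)%:E * \d_(p i) A)
  (hline : d = 1%N -> null_overlaps Omega c p mu)
  (gamma : {finite_measure set ('rV[R]_d * 'rV[R]_d)%type -> \bar R})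
  (hgamma : concentrated gamma (Omega `*` Omega))
  (w : 'rV[R]_M) :
  (transport_value Omega c F mu nu < +oo ->
   optimal_plan Omega c F mu nu gamma ->
   optimal_weights Omega c F p mu m w ->
   [/\ condition_a Omega c p gamma w,
       condition_b Omega c F p mu gamma w &
       condition_c Omega c F p m gamma w]) /\
  ([/\ condition_a Omega c p gamma w,
       condition_b Omega c F p mu gamma w &
       condition_c Omega c F p m gamma w] ->
   optimal_plan Omega c F mu nu gamma /\
   optimal_weights Omega c F p mu m w).
Proof.
have mOmega : measurable Omega.
  rewrite -[X in measurable X]setCK; apply: measurableC; apply: sub_sigma_algebra.
  by rewrite openC hOmega; exact: closed_closure.
have [c_ge0 _] := hc.
have overlaps := null_overlaps_of_radial mOmega hrad hp hmuL hinj hline.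
have weak := weak_duality mOmega hrad c_ge0 hp hinj overlaps hF hm hnuE.
have no_gap := no_gap_of_conditions mOmega hrad c_ge0 hp hinj overlaps hF hm hnuE.
split.
  move=> /ereal_inf_lt[_ [gamma0 gamma0O <-] fin0] [_ gamma_opt] w_opt.
  (* A finite value of [W] provides a plan of finite energy, which by weak duality bounds the dual
     objective at all weights. *)
  have dual_fin w' : dual_objective Omega c F p mu m w' < +oo.
    exact: le_lt_trans (weak gamma0 w' gamma0O) fin0.
  have [gamma1 [gamma1O a1 b1 c1]] := exists_plan mOmega hrad c_ge0 hp overlaps hF hm
    (first_order_right mOmega hrad c_ge0 hp overlaps hF dual_fin w_opt)
    (first_order_left mOmega hrad c_ge0 hp overlaps hF dual_fin w_opt).
  (* [gamma] may differ from the constructed [gamma1], but its energy is no larger, so it has no gap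
     either. *)
  apply: (conditions_of_no_gap mOmega hrad c_ge0 hp hinj overlaps hF hm hnuE hgamma).
    exact: le_lt_trans (gamma_opt gamma0 gamma0O) fin0.
  exact: le_trans (gamma_opt gamma1 gamma1O) (no_gap gamma1 w a1 b1 c1).
move=> [ha hb hc']; have gw := no_gap gamma w ha hb hc'.
split; last by move=> w'; exact: le_trans (weak gamma w' hgamma) gw.
by split => // gamma' gamma'O; exact: le_trans gw (weak gamma' w gamma'O).
Qed.
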